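(* Consider the following decision problem: given a minimal valid function $\pi$ for $R_f(\mathbb{R},\mathbb{Z})$ that is piecewise linear (possibly discontinuous) with a set of rational breakpoints with least common denominator $q$, decide whether $\pi$ is extreme for $R_f(\mathbb{R},\mathbb{Z})$ or not. There exists an algorithm for this problem that takes a number of elementary operations over the reals that is bounded by a polynomial in $q$.
   Context: Let $f\in\mathbb{R}$. $R_f(\mathbb{R},\mathbb{Z})$ is the convex hull of the set of all functions $s\colon\mathbb{R}\to\mathbb{Z}_+$ of finite support with $\sum_{r\in\mathbb{R}} r\,s(r)\in f+\mathbb{Z}$ (the hull is taken in the vector space of finitely supported functions $\mathbb{R}\to\mathbb{R}$). A valid function is a function $\pi\colon\mathbb{R}\to\mathbb{R}$ with $\pi\ge 0$ and $\sum_{r}\pi(r)s(r)\ge 1$ for all $s\in R_f(\mathbb{R},\mathbb{Z})$. A valid function $\pi$ is minimal if there is no valid function $\pi'\ne\pi$ with $\pi'\le\pi$ pointwise. A valid function $\pi$ is extreme if $\pi=\frac12(\pi^1+\pi^2)$ with $\pi^1,\pi^2$ valid functions implies $\pi=\pi^1=\pi^2$. Piecewise linear: let $0=x_0<x_1<\dots<x_n=1$ and let $B=\{x_i+t: 0\le i\le n-1,\ t\in\mathbb{Z}\}$ be the set of breakpoints. A function $\pi$, periodic modulo $\mathbb{Z}$, is piecewise linear with breakpoints in $B$ if on each open interval between consecutive elements of $B$ it agrees with an affine function (its values at the points of $B$ are arbitrary, so $\pi$ may be discontinuous there). Such a function is given by finitely many data: $f$, the breakpoints $x_i$, the values $\pi(x_i)$,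 and the slope and intercept of $\pi$ on each interval $(x_i,x_{i+1})$. Elementary operations over the reals are arithmetic operations and comparisons of real numbers. *)

(* Defs.v *)
From HB Require Import structures.
From mathcomp Require Import all_boot all_order all_algebra.
From mathcomp Require Import boolp classical_sets functions cardinality fsbigop.
From mathcomp Require Import reals.

Set Implicit Arguments.
Unset Strict Implicit.
Unset Printing Implicit Defensive.

Import Order.TTheory GRing.Theory Num.Theory.
Local Open Scope classical_set_scope.
Local Open Scope ring_scope.

Section GroupProblem.
Variable R : realType.
Implicit Types (f : R) (s pi : R -> R).

(* The feasible s : R -> Z_+, regarded as real-valued functions.  The sum
   \sum_(r \in setT) is the finitely supported sum of fsbigop. *)
Definition integer_solutions f : set (R -> R) :=
  [set s | [/\ finite_set [set r | s r != 0],
               forall r, s r \is a Num.nat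
             & \sum_(r \in [set: R]) r * s r - f \is a Num.int]].

Definition conv_hull (S : set (R -> R)) : set (R -> R) :=
  [set s | exists (m : nat) (lam : 'I_m -> R) (y : 'I_m -> R -> R),
    [/\ forall i, 0 <= lam i, \sum_i lam i = 1, forall i, S (y i)
      & forall r, s r = \sum_i lam i * y i r]].

Definition group_relaxation f : set (R -> R) :=
  conv_hull (integer_solutions f).

Definition valid f pi : Prop :=
  (forall r, 0 <= pi r) /\
  (forall s, group_relaxation f s -> 1 <= \sum_(r \in [set: R]) pi r * s r).

Definition minimal f pi : Prop :=
  valid f pi /\
  ~ (exists pi', [/\ valid f pi', pi' <> pi & forall r, pi' r <= pi r]).

Definition extreme f pi : Prop :=
  valid f pi /\
  (forall pi1 pi2, valid f pi1 -> valid f pi2 ->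
     (forall r, pi r = 2^-1 * (pi1 r + pi2 r)) -> pi = pi1 /\ pi = pi2).

(* [x] lists x_0, ..., x_n; [v] lists the values pi(x_i), and [a], [b] the
   slopes and intercepts on ]x_i, x_(i+1)[, for i < n.  By periodicity it is
   enough to describe pi on [0, 1[; the intercept refers to ]x_i, x_(i+1)[
   itself and not to its integer translates. *)
Definition piecewise_linear (n : nat) (x : n.+1.-tuple R) (v a b : n.-tuple R)
    pi : Prop :=
  [/\ x`_0 = 0, x`_n = 1,
      forall i, (i < n)%N -> x`_i < x`_i.+1,
      forall r (t : int), pi (r + t%:~R) = pi r
    & forall i, (i < n)%N ->
        pi x`_i = v`_i /\
        (forall r, x`_i < r < x`_i.+1 -> pi r = a`_i * r + b`_i)].

Definition common_denominator (xs : seq R) (q : nat) : Prop :=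
  (0 < q)%N /\ (forall r, r \in xs -> q%:R * r \is a Num.int).

Definition least_common_denominator (xs : seq R) (q : nat) : Prop :=
  common_denominator xs q /\
  (forall q', common_denominator xs q' -> (q <= q')%N).

Definition encode (n : nat) f (x : n.+1.-tuple R) (v a b : n.-tuple R) : seq R :=
  f :: x ++ v ++ a ++ b.

End GroupProblem.

(* While programs of a real random access machine: natural number registers,
   and a memory of real numbers addressed by natural numbers.  The only real
   constants are 0 and 1, and there is neither a rounding operation nor any
   other passage from reals to naturals except through comparisons. *)

Inductive nexp :=
| NReg of nat
| NCst of nat
| NAdd of nexp & nexp
| NSub of nexp & nexp
| NMul of nexp & nexp.

Inductive rexp :=
| RMem of nexp
| RZero
| ROne
| RAdd of rexp & rexp
| RSub of rexp & rexp
| RMul of rexp & rexp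
| RDiv of rexp & rexp.

Inductive bexp :=
| BLeN of nexp & nexp
| BLeR of rexp & rexp
| BNot of bexp
| BAnd of bexp & bexp.

Inductive cmd :=
| Skip
| NSet of nat & nexp
| RSet of nexp & rexp
| Seq of cmd & cmd
| If of bexp & cmd & cmd
| While of bexp & cmd.

(* Every node of an expression is charged one unit, so that the cost of a run
   bounds the number of real operations and comparisons and also accounts for
   index arithmetic and memory accesses. *)
Fixpoint ncost (e : nexp) : nat :=
  match e with
  | NReg _ | NCst _ => 1
  | NAdd e1 e2 | NSub e1 e2 | NMul e1 e2 => (ncost e1 + ncost e2).+1
  end.

Fixpoint rcost (e : rexp) : nat :=
  match e with
  | RMem k => (ncost k).+1
  | RZero | ROne => 1
  | RAdd e1 e2 | RSub e1 e2 | RMul e1 e2 | RDiv e1 e2 =>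
      (rcost e1 + rcost e2).+1
  end.

Fixpoint bcost (e : bexp) : nat :=
  match e with
  | BLeN e1 e2 => (ncost e1 + ncost e2).+1
  | BLeR e1 e2 => (rcost e1 + rcost e2).+1
  | BNot e1 => (bcost e1).+1
  | BAnd e1 e2 => (bcost e1 + bcost e2).+1
  end.

Section Semantics.
Variable R : realType.

Record state := State { nregs : nat -> nat; rmem : nat -> R }.

Definition upd (T : Type) (g : nat -> T) (k : nat) (z : T) : nat -> T :=
  fun j => if j == k then z else g j.

Fixpoint neval (st : state) (e : nexp) : nat :=
  match e with
  | NReg k => nregs st k
  | NCst k => k
  | NAdd e1 e2 => (neval st e1 + neval st e2)%N
  | NSub e1 e2 => (neval st e1 - neval st e2)%N
  | NMul e1 e2 => (neval st e1 * neval st e2)%N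
  end.

(* Division by 0 returns 0, as in the library; this adds no power since a
   program can test its denominators. *)
Fixpoint reval (st : state) (e : rexp) : R :=
  match e with
  | RMem k => rmem st (neval st k)
  | RZero => 0
  | ROne => 1
  | RAdd e1 e2 => reval st e1 + reval st e2
  | RSub e1 e2 => reval st e1 - reval st e2
  | RMul e1 e2 => reval st e1 * reval st e2
  | RDiv e1 e2 => reval st e1 / reval st e2
  end.

Fixpoint beval (st : state) (e : bexp) : bool :=
  match e with
  | BLeN e1 e2 => (neval st e1 <= neval st e2)%N
  | BLeR e1 e2 => reval st e1 <= reval st e2
  | BNot e1 => ~~ beval st e1
  | BAnd e1 e2 => beval st e1 && beval st e2
  end.

(* [exec c st t st']: started in [st], [c] halts in [st'] at total cost [t]. *)
Inductive exec : cmd -> state -> nat -> state -> Prop :=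
| ExecSkip st : exec Skip st 1 st
| ExecNSet st k e :
    exec (NSet k e) st (ncost e).+1
      (State (upd (nregs st) k (neval st e)) (rmem st))
| ExecRSet st k e :
    exec (RSet k e) st (ncost k + rcost e).+1
      (State (nregs st) (upd (rmem st) (neval st k) (reval st e)))
| ExecSeq st st1 st2 c1 c2 t1 t2 :
    exec c1 st t1 st1 -> exec c2 st1 t2 st2 ->
    exec (Seq c1 c2) st (t1 + t2).+1 st2
| ExecIf st st' e c1 c2 t :
    exec (if beval st e then c1 else c2) st t st' ->
    exec (If e c1 c2) st (bcost e + t).+1 st'
| ExecWhileFalse st e c :
    ~~ beval st e -> exec (While e c) st (bcost e).+1 st
| ExecWhileTrue st st1 st2 e c t1 t2 :
    beval st e -> exec c st t1 st1 -> exec (While e c) st1 t2 st2 ->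
    exec (While e c) st (bcost e + t1 + t2).+1 st2.

(* Register 0 initially holds the size parameter of the input, and finally
   the answer, any nonzero value meaning yes. *)
Definition init (n : nat) (input : seq R) : state :=
  State (fun k => if k == 0%N then n else 0%N) (fun k => input`_k).

Definition accepting (st : state) : Prop := nregs st 0%N <> 0%N.

Definition decides_within (c : cmd) (n : nat) (input : seq R) (bound : nat)
    (P : Prop) : Prop :=
  exists (t : nat) (st : state),
    [/\ exec c (init n input) t st, (t <= bound)%N & accepting st <-> P].

End Semantics.

(* Main.v *)
Require Import Defs.
From mathcomp Require Import all_boot all_order all_algebra.
From mathcomp Require Import boolp classical_sets functions cardinality fsbigop.
From mathcomp Require Import reals.
From mathcomp Require Import ring lra zify.

(** Consider the perturbations [g] for which [pi + g] and [pi - g] are both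
    valid.  As [pi] is minimal, they are the functions with
    [|g x| <= pi x], [|g x| <= 1 - pi x] and
    [|g x + g y - g (x + y)| <= pi x + pi y - pi (x + y)], and [pi] is extreme
    iff 0 is the only one (lemma [extremeP]).  These inequalities do not mention
    [f], which is fortunate: a program without rounding could not reduce a large
    [f] modulo 1 in time polynomial in [q].

    The slacks on the right are affine on the cells of a triangulation of the
    plane with vertices in the multiples of [1 / q].  For [g] piecewise linear
    on a uniform grid, the inequalities can therefore be tested at the limits at
    the vertices of cells (the corners), and up to scaling [g] this amounts to
    finitely many linear equations: wherever the right-hand side of one of the
    inequalities vanishes at a corner, so does its left-hand side
    ([tight_system]).  So a nonzero solution shows that [pi] is not extreme.

    For the converse let [g] be any nonzero perturbation.  Call an interval of
    the grid covered if every perturbation is affine on it.  If all intervals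
    are covered, [g] itself solves the system.  Otherwise put on each uncovered
    interval the same zigzag, which is odd about the midpoint of the interval,
    and 0 on the others.  Where the slack vanishes on a whole triangle, the
    three intervals involved are covered, because a bounded solution of
    Cauchy's equation on an open set is affine ([triangle_affine]); where it
    vanishes on one edge of a triangle only, the edge translates or reflects one
    interval onto another, and both are covered or neither is
    ([triangle_transfer]).  In all cases the zigzags cancel to the order to
    which the slack vanishes ([zigzag_triangle]), so some multiple of this
    function is a perturbation; its breakpoints are multiples of [1 / (3 q)].
    Hence the system on the grid of denominator [3 q] has a nonzero solution
    iff [pi] is not extreme ([extreme_tight_system]).

    The program finds [q] by trial, tabulates [pi] on the grid of denominator
    [3 q], and runs through the corners, maintaining a square matrix whose
    columns span the solutions of the equations met so far ([eliminated]).  It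
    accepts iff this matrix ends up being 0.  Programs are written in a small
    language in which loop bounds are fixed on entry, so that their meaning is
    a function on states and the running time of their compiled form can be
    bounded once and for all ([compile_meaning]). *)

Set Implicit Arguments.
Unset Strict Implicit.
Unset Printing Implicit Defensive.

Import Order.TTheory GRing.Theory Num.Theory.
Local Open Scope ring_scope.

(** * Valid functions and their perturbations *)

Section Valid.
Variable R : realType.
Implicit Types (f x y u : R) (pi g : R -> R) (L t : seq R).

Let fsum_seq (D : seq R) (F : R -> R) :
  uniq D -> (forall r, r \notin D -> F r = 0) ->
  \sum_(r \in [set: R]) F r = \sum_(r <- D) F r.
Proof.
move=> uD F0; rewrite (fsbigE D) //; last by move=> r _ /F0.
by apply: eq_bigl => r; rewrite in_setT.
Qed.

Let sum_multiset (D : seq R) (k : R -> nat) (F : R -> R) :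
  \sum_(r <- flatten [seq nseq (k r) r | r <- D]) F r =
  \sum_(r <- D) F r * (k r)%:R.
Proof.
rewrite big_flatten big_map; apply: eq_bigr => r _.
by rewrite big_nseq iter_addr addr0 mulr_natr.
Qed.

Let sum_count L (D : seq R) (F : R -> R) : uniq D -> {subset L <= D} ->
  \sum_(r <- D) F r * (count_mem r L)%:R = \sum_(r <- L) F r.
Proof.
move=> uD; elim: L => [|u L IH] sLD.
  by rewrite big_nil big1 // => r _; rewrite mulr0.
rewrite big_cons -IH; last by move=> r rL; apply: sLD; rewrite inE rL orbT.
have uinD : u \in D by apply: sLD; rewrite mem_head.
rewrite (bigD1_seq u) //= (bigD1_seq u uinD uD) //= eqxx natrD mulrDr mulr1.
rewrite -addrA; congr (_ + (_ + _)); apply: eq_bigr => r /negbTE ne.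
by rewrite eq_sym ne.
Qed.

(** An integer solution is the multiplicity function of a finite list of reals
    whose sum is congruent to [f]; passing to convex combinations does not
    change the linear inequalities that hold. *)
Lemma validP f pi :
  valid f pi <->
  (forall r, 0 <= pi r) /\
  (forall L, \sum_(r <- L) r - f \is a Num.int -> 1 <= \sum_(r <- L) pi r).
Proof.
split=> -[pi0 piV]; split=> //.
  move=> L Lf; pose D := undup L; have uD : uniq D by apply: undup_uniq.
  have sLD : {subset L <= D} by move=> r; rewrite mem_undup.
  pose s r : R := (count_mem r L)%:R.
  have s0 r : r \notin D -> s r = 0.
    by rewrite mem_undup => /count_memPn rL; rewrite /s rL.
  have sumE F : \sum_(r \in [set: R]) F r * s r = \sum_(r <- L) F r.
    rewrite (@fsum_seq D) ?sum_count // => r /s0 ->; exact: mulr0.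
  rewrite -sumE; apply: piV; exists 1%N, (fun=> 1), (fun=> s); split=> //.
  - by rewrite big_ord1.
  - move=> _; split; last by rewrite (sumE id).
      apply: (@sub_finite_set _ _ [set` D]%classic); last by apply/finite_seqP;
        exists D.
      by move=> r /= sr; apply: contraT => /s0 /eqP; rewrite (negbTE sr).
    by move=> r; apply/natrP; exists (count_mem r L).
  - by move=> r; rewrite big_ord1 mul1r.
move=> s [m [lam [y [lam0 lam1 Sy sE]]]].
have /choice[D DP] i : exists D : seq R,
    uniq D /\ forall r, r \notin D -> y i r = 0.
  have [/finite_seqP[D DE] _ _] := Sy i; exists (undup D).
  split=> [|r]; first exact: undup_uniq.
  rewrite mem_undup; apply: contraNeq => yr.
  by have : [set` D]%classic r by rewrite -DE.
pose E := undup (flatten [seq D i | i <- enum 'I_m]).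
have yE i r : r \notin E -> y i r = 0.
  move=> rE; apply: (DP i).2; apply: contra rE => rD.
  rewrite mem_undup; apply/flattenP; exists (D i) => //.
  by apply/mapP; exists i; rewrite ?mem_enum.
have -> : \sum_(r \in [set: R]) pi r * s r =
          \sum_i lam i * \sum_(r \in [set: R]) pi r * y i r.
  rewrite (@fsum_seq E) ?undup_uniq//; last first.
    by move=> r rE; rewrite sE big1 ?mulr0// => i _; rewrite yE ?mulr0.
  under [RHS]eq_bigr => i _.
    rewrite (@fsum_seq E) ?undup_uniq//; last by move=> r /yE ->; rewrite mulr0.
    rewrite mulr_sumr; over.
  rewrite exchange_big; apply: eq_bigr => r _; rewrite sE mulr_sumr.
  by apply: eq_bigr => i _; rewrite mulrCA.
rewrite -lam1; apply: ler_sum => i _; rewrite -[leLHS]mulr1 ler_wpM2l//.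
have [_ yN yf] := Sy i; have [uD yD] := DP i.
pose L := flatten [seq nseq (Num.trunc (y i r)) r | r <- D i].
have sumE F : \sum_(r \in [set: R]) F r * y i r = \sum_(r <- L) F r.
  rewrite (@fsum_seq (D i)) // ?sum_multiset; last first.
    by move=> r /yD ->; rewrite mulr0.
  by apply: eq_bigr => r _; rewrite truncnK.
by rewrite sumE piV // -sumE.
Qed.

(** A list is rewritten by replacing each copy of [u] with the list [t]; if
    [t] sums to [u] modulo 1 this preserves feasibility, so lowering [pi] at
    [u] to the total of [pi] on [t] keeps it valid. *)
Lemma minimal_le_sum f pi u t : minimal f pi -> u \notin t ->
  \sum_(r <- t) r - u \is a Num.int -> pi u <= \sum_(r <- t) pi r.
Proof.
move=> [/validP[pi0 piV] pimin] ut tu; rewrite leNgt; apply/negP => lt_tu.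
apply: pimin; pose pi' r := if r == u then \sum_(r <- t) pi r else pi r.
exists pi'; split; last 1 first.
- by move=> r; rewrite /pi'; case: eqP => // ->; apply: ltW.
- apply/validP; split=> [r|L Lf].
    by rewrite /pi'; case: eqP => // _; apply: sumr_ge0.
  pose L' := flatten [seq if r == u then t else [:: r] | r <- L].
  suff [sumL' sumpi] : \sum_(r <- L') r - \sum_(r <- L) r \is a Num.int /\
      \sum_(r <- L') pi r = \sum_(r <- L) pi' r.
    rewrite -sumpi; apply: piV.
    rewrite -[X in X - f](subrK (\sum_(r <- L) r)) -addrA rpredD //.
  rewrite !big_flatten !big_map; split; last first.
    by apply: eq_bigr => r _; rewrite /pi'; case: ifP => // _; rewrite big_seq1.
  rewrite -sumrB; elim/big_ind: _ => [||r _]; first exact: rpred0.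
    exact: rpredD.
  by case: ifP => [/eqP ->|_] //; rewrite big_seq1 subrr rpred0.
by move=> /(congr1 (@^~ u)); rewrite /pi' eqxx => tuE;
  rewrite tuE ltxx in lt_tu.
Qed.

Lemma minimal_ge0 f pi x : minimal f pi -> 0 <= pi x.
Proof. by move=> [[]]. Qed.

Lemma minimal_int f pi x : minimal f pi -> x \is a Num.int -> pi x = 0.
Proof.
move=> mp xZ; apply/le_anti; rewrite (minimal_ge0 _ mp) andbT.
have := @minimal_le_sum f pi x [::] mp; rewrite !big_nil; apply=> //.
by rewrite sub0r rpredN.
Qed.

Lemma minimal_subadd f pi x y : minimal f pi -> pi (x + y) <= pi x + pi y.
Proof.
move=> mp; have [->|x0] := eqVneq x 0.
  by rewrite add0r lerDr (minimal_ge0 _ mp).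
have [->|y0] := eqVneq y 0; first by rewrite addr0 lerDl (minimal_ge0 _ mp).
have := @minimal_le_sum f pi (x + y) [:: x; y] mp.
rewrite !big_cons !big_nil !addr0; apply; last by rewrite subrr rpred0.
by rewrite !inE negb_or -subr_eq0 addrAC subrr add0r y0 -subr_eq0 addrK.
Qed.

(** A feasible list that meets a point where [pi] exceeds 1 satisfies the
    inequality already because of that point, so [pi] can be truncated at 1. *)
Lemma minimal_le1 f pi x : minimal f pi -> pi x <= 1.
Proof.
move=> [/validP[pi0 piV] pimin]; rewrite leNgt; apply/negP => lt1.
apply: pimin; exists (fun r => Num.min (pi r) 1); split; last 1 first.
- by move=> r; rewrite ge_min lexx.
- apply/validP; split=> [r|L Lf]; first by rewrite le_min pi0 ler01.
  have [/allP le1|/allPn[r rL]] := boolP (all (fun r => pi r <= 1) L).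
    by rewrite (eq_big_seq pi) ?piV// => r /le1 /min_idPl.
  rewrite -ltNge => /ltW /min_idPr r1.
  rewrite (perm_big _ (perm_to_rem rL)) big_cons /= r1 lerDl sumr_ge0// => s _.
  by rewrite le_min pi0 ler01.
move=> /(congr1 (@^~ x)) /=; rewrite (min_idPr (ltW lt1)) => piE.
by rewrite -piE ltxx in lt1.
Qed.

Lemma valid_ge1 f pi x : valid f pi -> x - f \is a Num.int -> 1 <= pi x.
Proof.
by move=> /validP[_ /(_ [:: x])]; rewrite !big_seq1.
Qed.

Lemma subadd_valid f pi : (forall r, 0 <= pi r) -> pi 0 = 0 ->
  (forall x y, pi (x + y) <= pi x + pi y) ->
  (forall x, x - f \is a Num.int -> 1 <= pi x) -> valid f pi.
Proof.
move=> pi0 p0 sub pif; apply/validP; split=> // L /pif /le_trans; apply.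
elim: L => [|x L IH]; rewrite ?big_nil ?p0 // !big_cons.
by apply: (le_trans (sub _ _)); rewrite lerD2l.
Qed.

Lemma valid_mean f pi1 pi2 : valid f pi1 -> valid f pi2 ->
  valid f (fun r => 2^-1 * (pi1 r + pi2 r)).
Proof.
move=> /validP[p10 p1V] /validP[p20 p2V]; apply/validP; split=> [r|L Lf].
  by have := p10 r; have := p20 r; lra.
rewrite -mulr_sumr big_split /=; have := p1V L Lf; have := p2V L Lf; lra.
Qed.

Lemma minimal_mean f pi pi1 pi2 : minimal f pi -> valid f pi1 -> valid f pi2 ->
  (forall r, pi r = 2^-1 * (pi1 r + pi2 r)) -> minimal f pi1.
Proof.
move=> [pV pmin] v1 v2 piE; split=> // -[pi' [v' ne le']]; apply: ne.
apply: contrapT => ne; apply: pmin; exists (fun r => 2^-1 * (pi' r + pi2 r)).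
split; first exact: valid_mean.
  move=> eqpi; apply: ne; apply/funext => r.
  by have := congr1 (@^~ r) eqpi; rewrite /= piE; lra.
by move=> r; rewrite piE; have := le' r; lra.
Qed.

(** For [C = 1] this says that both [pi + g] and [pi - g] take values in [0, 1]
    and are subadditive.  The factor [C] allows one to work with [g] before it
    is scaled down. *)
Definition perturbation pi (C : R) g : Prop :=
  [/\ forall x, `|g x| <= C * pi x,
      forall x, `|g x| <= C * (1 - pi x)
    & forall x y, `|g x + g y - g (x + y)| <= C * (pi x + pi y - pi (x + y))].

Lemma perturbation_scale pi (C D : R) g : 0 <= D -> perturbation pi C g ->
  perturbation pi (D * C) (fun x => D * g x).
Proof.
move=> D0 [g0 g1 gD];
  have gs (s t : R) : `|s| <= C * t -> `|D * s| <= D * C * t.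
  by move=> st; rewrite normrM (ger0_norm D0) -mulrA ler_wpM2l.
split=> [x|x|x y]; [exact/gs/g0|exact/gs/g1|].
by rewrite -mulrDr -mulrBr; apply/gs/gD.
Qed.

Lemma perturbation0 f pi : minimal f pi -> perturbation pi 1 (fun=> 0).
Proof.
move=> mp; split=> [x|x|x y]; rewrite ?addr0 ?subrr normr0 mul1r.
- exact: (minimal_ge0 _ mp).
- by rewrite subr_ge0 (minimal_le1 _ mp).
- by rewrite subr_ge0 (minimal_subadd _ _ mp).
Qed.

Lemma minimal_valid_add f pi g : minimal f pi -> perturbation pi 1 g ->
  valid f (fun x => pi x + g x).
Proof.
move=> mp [g0 g1 gD]; apply: subadd_valid.
- by move=> x; have := g0 x; rewrite ler_norml; lra.
- have := g0 0; rewrite (minimal_int mp (rpred0 _)) mulr0 normr_le0 => /eqP ->.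
  by rewrite addr0.
- by move=> x y; have := gD x y; rewrite ler_norml; lra.
- move=> x xf; have := valid_ge1 mp.1 xf; have := g1 x.
  by rewrite ler_norml; lra.
Qed.

(** Both [pi1] and [pi2] in a decomposition of a minimal [pi] are themselves
    minimal, hence subadditive with values in [0, 1], which makes
    [pi1 - pi] a perturbation. *)
Lemma extremeP f pi : minimal f pi ->
  extreme f pi <-> (forall g, perturbation pi 1 g -> forall x, g x = 0).
Proof.
move=> mp; split=> [[_ ext] g gP x|noP].
  have gN : perturbation pi 1 (fun x => - g x).
    case: gP => [g0 g1 gD]; split=> [y|y|y z]; rewrite ?normrN ?g0 ?g1//.
    by rewrite -!opprD normrN; apply: gD.
  have [eqpi _] := ext _ _ (minimal_valid_add mp gP) (minimal_valid_add mp gN)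
    ltac:(by move=> r /=; lra).
  by have /= := congr1 (@^~ x) eqpi; lra.
split=> [|pi1 pi2 v1 v2 piE]; first exact: mp.1.
have m1 := minimal_mean mp v1 v2 piE.
have m2 : minimal f pi2.
  by apply: (minimal_mean mp v2 v1) => r; rewrite piE addrC.
have pert : perturbation pi 1 (fun x => pi1 x - pi x).
  split=> [x|x|x y]; rewrite mul1r ler_norml !piE.
  - have := minimal_ge0 x m1; have := minimal_ge0 x m2; lra.
  - have := minimal_le1 x m1; have := minimal_le1 x m2; lra.
  - have := minimal_subadd x y m1; have := minimal_subadd x y m2; lra.
have eq1 x : pi1 x = pi x by have := noP _ pert x; lra.
by split; apply/funext => x; [rewrite eq1|have := eq1 x; rewrite !piE; lra].
Qed.

(** The slack of [pi] at [(x, k)] is 0 for an integer [k]. *)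
Lemma perturbation_periodic f pi (C : R) g : minimal f pi ->
  perturbation pi C g -> forall x (k : int), g (x + k%:~R) = g x.
Proof.
move=> mp [g0 _ gD] x k.
have gz y : y \is a Num.int -> g y = 0.
  move=> yZ; have := g0 y; rewrite (minimal_int mp yZ) mulr0 normr_le0.
  by move/eqP.
have le0 y (l : int) : pi y + pi l%:~R - pi (y + l%:~R) <= 0.
  rewrite (minimal_int mp (intr_int _ _)).
  have := minimal_subadd (y + l%:~R) (- l%:~R) mp.
  rewrite (minimal_int mp (x := - _)) ?rpredN ?intr_int//.
  by rewrite addrK; lra.
have slack0 : pi x + pi k%:~R - pi (x + k%:~R) = 0.
  apply/le_anti; rewrite le0 /=; have := minimal_subadd x k%:~R mp; lra.
have := gD x k%:~R; rewrite slack0 mulr0 normr_le0 (gz k%:~R) ?intr_int//.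
by rewrite addr0 subr_eq0 => /eqP.
Qed.

End Valid.

(** * Piecewise linear functions on a uniform grid *)

Section Grid.
Variable R : realType.
Implicit Types (x y C xi eta : R) (z h : nat -> R) (k l m : nat).

Definition gridpt m k xi : R := (k%:R + xi) / m%:R.

Definition piece z k xi : R :=
  if xi == 0 then z (3 * k)%N
  else (1 - xi) * z (3 * k + 1)%N + xi * z (3 * k + 2)%N.

(** The function of period 1 given by [F k] on [[k / m, (k + 1) / m[], in the
    local coordinate of that interval. *)
Definition cellwise m (F : nat -> R -> R) x : R :=
  let u := m%:R * (x - (Num.floor x)%:~R) in
  F (Num.trunc u) (u - (Num.trunc u)%:R).

(** The piecewise linear functions, with three consecutive entries of [z] for
    each interval: from position [3 * k] on, the value at [k / m], the right
    limit there and the left limit at [(k + 1) / m]. *)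
Definition pwl m z : R -> R := cellwise m (piece z).

Lemma cellwise_periodic m F x (k : int) :
  cellwise m F (x + k%:~R) = cellwise m F x.
Proof.
rewrite /cellwise; have -> // : x + k%:~R - (Num.floor (x + k%:~R))%:~R =
                        x - (Num.floor x)%:~R.
by rewrite floorDrz ?intr_int// intrKfloor intrD; ring.
Qed.

Lemma pwl_periodic m z x (k : int) : pwl m z (x + k%:~R) = pwl m z x.
Proof. exact: cellwise_periodic. Qed.

Lemma gridptS m k : gridpt m k 1 = gridpt m k.+1 0.
Proof. by rewrite /gridpt addr0 -natr1. Qed.

Lemma gridptD m k l xi eta :
  gridpt m k xi + gridpt m l eta = gridpt m (k + l) (xi + eta).
Proof. by rewrite /gridpt -mulrDl natrD addrACA. Qed.

Lemma cellwise_gridpt m F k xi : (0 < m)%N -> 0 <= xi < 1 ->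
  cellwise m F (gridpt m k xi) = F (k %% m)%N xi.
Proof.
move=> m0 /andP[xi0 xi1]; have m0' : 0 < m%:R :> R by rewrite ltr0n.
have ->: gridpt m k xi = gridpt m (k %% m) xi + (Posz (k %/ m)%N)%:~R.
  rewrite /gridpt {1}(divn_eq k m) natrD natrM -pmulrn.
  by field; rewrite gt_eqF.
rewrite cellwise_periodic /cellwise; set l := (k %% m)%N.
have lm : l%:R + 1 <= m%:R :> R by rewrite natr1 ler_nat ltn_mod.
have l0 : 0 <= l%:R :> R by [].
have -> : Num.floor (gridpt m l xi) = 0.
  apply: floor_def; rewrite add0r divr_ge0 ?ler0n ?addr_ge0//=.
  by rewrite ltr_pdivrMr// mul1r; lra.
rewrite subr0 /gridpt mulrCA divff ?gt_eqF// mulr1.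
have -> : Num.trunc (l%:R + xi) = l.
  by apply: truncn_def; rewrite -natr1; lra.
by rewrite addrC addKr.
Qed.

Lemma pwl_gridpt m z k xi : (0 < m)%N -> 0 <= xi < 1 ->
  pwl m z (gridpt m k xi) = piece z (k %% m) xi.
Proof. exact: cellwise_gridpt. Qed.

Lemma gridptP m x : (0 < m)%N -> exists k xi (j : int),
  [/\ (k < m)%N, 0 <= xi < 1 & x = gridpt m k xi + j%:~R].
Proof.
move=> m0; have m0' : 0 < m%:R :> R by rewrite ltr0n.
pose u := m%:R * (x - (Num.floor x)%:~R).
have /andP[fx xf] := floor_itv x; rewrite intrD in xf.
have u0 : 0 <= u by rewrite mulr_ge0 ?ler0n// subr_ge0.
have um : u < m%:R by rewrite -[ltRHS]mulr1 ltr_pM2l// ltrBlDl.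
have /andP[tu ut] := truncn_itv u0.
exists (Num.trunc u), (u - (Num.trunc u)%:R), (Num.floor x); split.
- by rewrite truncn_lt_nat.
- by rewrite -natr1 in ut; apply/andP; split; lra.
- by rewrite /gridpt [_ + (u - _)]addrC subrK /u; field; rewrite gt_eqF.
Qed.

Lemma piece_end z k : piece z k 0 = z (3 * k)%N.
Proof. by rewrite /piece eqxx. Qed.

Lemma piece_in z k xi : 0 < xi ->
  piece z k xi = (1 - xi) * z (3 * k + 1)%N + xi * z (3 * k + 2)%N.
Proof. by move=> xi0; rewrite /piece gt_eqF. Qed.

(** The additivity defect of [pwl m z] is affine on each relatively open cell
    of the subdivision of the plane by the lines on which [x], [y] or [x + y]
    is a multiple of [1 / m].  A corner type records, for [x], [y] and
    [x + y], which of the three entries of its interval is the limit in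
    question (0 for the value, 1 and 2 for the limits at the left and right
    end), and whether a carry occurs in [k + l].  Up to exchanging [x] and
    [y], these are all the limits of the defect at the vertices of cells. *)
Definition corner_types : seq (nat * nat * nat * nat) :=
  [:: (0, 0, 0, 0); (0, 1, 1, 0); (0, 2, 2, 0); (1, 1, 1, 0);
      (2, 1, 2, 0); (2, 1, 0, 1); (2, 2, 2, 1); (2, 1, 1, 1)]%N.

Definition defect m z k l (c : nat * nat * nat * nat) : R :=
  let: (t1, t2, t3, e) := c in
  z (3 * k + t1)%N + z (3 * l + t2)%N - z (3 * ((k + l + e) %% m) + t3)%N.

Definition slack (g : R -> R) x y : R := g x + g y - g (x + y).

Section Cells.
Variables (m k l : nat) (z : nat -> R).
Hypotheses (m0 : (0 < m)%N) (km : (k < m)%N) (lm : (l < m)%N).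
Let S xi eta := slack (pwl m z) (gridpt m k xi) (gridpt m l eta).
Let D z k l (t1 t2 t3 e : nat) := defect m z k l (t1, t2, t3, e).

Lemma slack_vertex : S 0 0 = D z k l 0 0 0 0.
Proof.
rewrite /S /slack /D /defect gridptD addr0 !pwl_gridpt ?lexx ?ltr01//.
by rewrite !(modn_small km) !(modn_small lm) !piece_end !addn0.
Qed.

Lemma slack_edge eta : 0 < eta < 1 ->
  S 0 eta = (1 - eta) * D z k l 0 1 1 0 + eta * D z k l 0 2 2 0.
Proof.
move=> /andP[e0 e1]; have e01 : 0 <= eta < 1 by rewrite ltW.
rewrite /S /slack /D /defect gridptD add0r !pwl_gridpt ?lexx ?ltr01//.
by rewrite !(modn_small km) !(modn_small lm) piece_end !piece_in// !addn0; ring.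
Qed.

Lemma slack_lower xi eta : 0 < xi -> 0 < eta -> xi + eta < 1 ->
  S xi eta = (1 - xi - eta) * D z k l 1 1 1 0 + xi * D z k l 2 1 2 0
             + eta * D z l k 2 1 2 0.
Proof.
move=> x0 e0 s1; rewrite /S /slack /D /defect gridptD.
rewrite !pwl_gridpt ?(ltW x0) ?(ltW e0) ?addr_ge0 ?(ltW x0) ?(ltW e0) //=;
  try lra.
rewrite !(modn_small km) !(modn_small lm) !piece_in// ?addr_gt0//.
by rewrite [(l + k)%N]addnC !addn0; ring.
Qed.

Lemma slack_diagonal xi : 0 < xi < 1 ->
  S xi (1 - xi) = xi * D z k l 2 1 0 1 + (1 - xi) * D z l k 2 1 0 1.
Proof.
move=> /andP[x0 x1]; rewrite /S /slack /D /defect gridptD [xi + _]addrC subrK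
  gridptS.
rewrite !pwl_gridpt ?(ltW x0) ?lexx ?ltr01 ?subr_ge0 ?(ltW x1)//=;
  try lra.
rewrite !(modn_small km) !(modn_small lm) piece_end !piece_in ?subr_gt0//.
by rewrite [(l + k)%N]addnC -[(k + l).+1]addn1 !addn0; ring.
Qed.

Lemma slack_upper xi eta : xi < 1 -> eta < 1 -> 1 < xi + eta ->
  S xi eta = (xi + eta - 1) * D z k l 2 2 2 1 + (1 - eta) * D z k l 2 1 1 1
             + (1 - xi) * D z l k 2 1 1 1.
Proof.
move=> x1 e1 s1; rewrite /S /slack /D /defect gridptD.
have -> : gridpt m (k + l) (xi + eta) = gridpt m (k + l + 1) (xi + eta - 1).
  by rewrite /gridpt natrD; congr (_ / _); ring.
rewrite !pwl_gridpt; try by apply/andP; split; lra.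
all: try exact: m0.
rewrite !(modn_small km) !(modn_small lm) !piece_in; try lra.
by rewrite [(l + k)%N]addnC; ring.
Qed.

End Cells.

Lemma convex2 (C s1 s2 a1 a2 b1 b2 : R) : 0 <= s1 -> 0 <= s2 ->
  `|a1| <= C * b1 -> `|a2| <= C * b2 ->
  `|s1 * a1 + s2 * a2| <= C * (s1 * b1 + s2 * b2).
Proof.
move=> s10 s20 h1 h2; apply: le_trans (ler_normD _ _) _.
rewrite !normrM (ger0_norm s10) (ger0_norm s20) mulrDr !(mulrCA C).
by apply: lerD; apply: ler_wpM2l.
Qed.

Lemma convex3 (C s1 s2 s3 a1 a2 a3 b1 b2 b3 : R) :
  0 <= s1 -> 0 <= s2 -> 0 <= s3 ->
  `|a1| <= C * b1 -> `|a2| <= C * b2 -> `|a3| <= C * b3 ->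
  `|s1 * a1 + s2 * a2 + s3 * a3| <= C * (s1 * b1 + s2 * b2 + s3 * b3).
Proof.
move=> s10 s20 s30 h1 h2 h3; have := @convex2 C 1 s3 _ _ _ _ ler01 s30
  (convex2 s10 s20 h1 h2) h3.
by rewrite !mul1r.
Qed.

(** Passing to the limit at the end point of a segment. *)
Lemma affine_le_end (a b : R) :
  (forall s : R, 0 < s < 1 / 2 -> 0 <= a + s * b) -> 0 <= a.
Proof.
move=> ge0; rewrite leNgt; apply/negP => a0.
pose s : R := (- a) / (4 * (`|b| - a)).
have nb : 0 <= `|b| by []; have p : 0 < `|b| - a by lra.
have sE : s * (`|b| - a) = - a / 4 by rewrite /s; field; rewrite gt_eqF.
have s0 : 0 < s by apply: divr_gt0; lra.
have s1 : s < 1 / 2 by nra.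
have := ge0 s; rewrite s0 s1 => /(_ isT).
have : s * b <= s * `|b| by rewrite ler_pM2l// ler_norm.
nra.
Qed.

Lemma norm_le_end (C a b a' b' : R) :
  (forall s : R, 0 < s < 1 / 2 -> `|a + s * b| <= C * (a' + s * b')) ->
  `|a| <= C * a'.
Proof.
move=> h; rewrite ler_norml -subr_ge0 opprK -[X in _ && X]subr_ge0.
apply/andP; split.
  apply: (@affine_le_end _ (b + C * b')) => s /h.
  by rewrite ler_norml => /andP[]; lra.
apply: (@affine_le_end _ (C * b' - b)) => s /h.
by rewrite ler_norml => /andP[]; lra.
Qed.

Definition corner_bound m C h z : Prop :=
  (forall k t, (k < m)%N -> (t < 3)%N ->
     `|z (3 * k + t)%N| <= C * h (3 * k + t)%N /\
     `|z (3 * k + t)%N| <= C * (1 - h (3 * k + t)%N)) /\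
  (forall k l c, (k < m)%N -> (l < m)%N -> c \in corner_types ->
     `|defect m z k l c| <= C * defect m h k l c).

(** Every point lies in the relative interior of a cell, on which both sides
    are the same convex combination of their values at the corners. *)
Lemma corner_bound_perturbation m C h z : (0 < m)%N ->
  corner_bound m C h z -> perturbation (pwl m h) C (pwl m z).
Proof.
move=> m0 [b1 b2].
have unary k xi : (k < m)%N -> 0 <= xi < 1 ->
    `|piece z k xi| <= C * piece h k xi /\
    `|piece z k xi| <= C * (1 - piece h k xi).
  move=> km /andP[xi0 xi1]; rewrite /piece; case: ifP => _.
    by have := b1 k 0 km isT; rewrite addn0.
  have [p1 q1] := b1 k 1 km isT; have [p2 q2] := b1 k 2 km isT.
  have xi1' : 0 <= 1 - xi by lra.
  split; first exact: convex2.
  have := convex2 xi1' xi0 q1 q2; congr (_ <= C * _); ring.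
have binary k l xi eta : (k < m)%N -> (l < m)%N -> 0 <= xi < 1 -> 0 <= eta < 1
  ->
    `|slack (pwl m z) (gridpt m k xi) (gridpt m l eta)| <=
    C * slack (pwl m h) (gridpt m k xi) (gridpt m l eta).
  move=> km lm /andP[x0 x1] /andP[e0 e1].
  have edge k' l' eta' : (k' < m)%N -> (l' < m)%N -> 0 <= eta' < 1 ->
      `|slack (pwl m z) (gridpt m k' 0) (gridpt m l' eta')| <=
      C * slack (pwl m h) (gridpt m k' 0) (gridpt m l' eta').
    move=> km' lm' /andP[]; rewrite le_eqVlt => /orP[/eqP<- _|e0' e1'].
      by rewrite !slack_vertex//; apply: b2.
    rewrite !slack_edge ?e0'//; apply: convex2; try lra; exact: b2.
  have slackC g x y : slack g x y = slack g y x :> R.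
    by rewrite /slack [g x + _]addrC [x + y]addrC.
  move: x0; rewrite le_eqVlt => /orP[/eqP<-|x0]; first by apply: edge;
    rewrite ?e0.
  move: e0; rewrite le_eqVlt => /orP[/eqP<-|e0].
    by rewrite slackC [in leRHS]slackC; apply: edge; rewrite ?(ltW x0).
  have [s1|s1|s1] := ltgtP (xi + eta) 1.
  - rewrite !slack_lower//; apply: convex3; try lra; exact: b2.
  - rewrite !slack_upper//; apply: convex3; try lra; exact: b2.
  - have -> : eta = 1 - xi by lra.
    rewrite !slack_diagonal ?x0//; apply: convex2; try lra; exact: b2.
have unaryx x : `|pwl m z x| <= C * pwl m h x /\
    `|pwl m z x| <= C * (1 - pwl m h x).
  have [k [xi [j [km xi01 ->]]]] := gridptP x m0.
  by rewrite !pwl_periodic !pwl_gridpt// !modn_small//; apply: unary.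
split=> [x|x|x y]; [exact: (unaryx x).1|exact: (unaryx x).2|].
have [k [xi [i [km xi01 ->]]]] := gridptP x m0.
have [l [eta [j [lm eta01 ->]]]] := gridptP y m0.
by rewrite addrACA -intrD !pwl_periodic; apply: binary.
Qed.

(** Conversely the inequalities at corners are limits of those inside cells. *)
Lemma perturbation_corner_bound m C h z : (0 < m)%N ->
  perturbation (pwl m h) C (pwl m z) -> corner_bound m C h z.
Proof.
move=> m0 [p0 p1 pD].
have lim2 (a1 a2 b1 b2 : R) : (forall s, 0 < s < 1 ->
    `|(1 - s) * a1 + s * a2| <= C * ((1 - s) * b1 + s * b2)) ->
    `|a1| <= C * b1 /\ `|a2| <= C * b2.
  move=> H; split.
    apply: (@norm_le_end _ _ (a2 - a1) _ (b2 - b1)) => s /andP[s0 s1].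
    by have := H s ltac:(lra); congr (`|_| <= C * _); ring.
  apply: (@norm_le_end _ _ (a1 - a2) _ (b1 - b2)) => s /andP[s0 s1].
  by have := H (1 - s) ltac:(lra); congr (`|_| <= C * _); ring.
have lim3 (a1 a2 a3 b1 b2 b3 : R) : (forall s1 s2 s3,
  0 < s1 -> 0 < s2 -> 0 < s3 ->
    s1 + s2 + s3 = 1 ->
    `|s1 * a1 + s2 * a2 + s3 * a3| <= C * (s1 * b1 + s2 * b2 + s3 * b3)) ->
    `|a1| <= C * b1 /\ `|a2| <= C * b2.
  move=> H; split.
    apply: (@norm_le_end _ _ ((a2 + a3) / 2 - a1) _ ((b2 + b3) / 2 - b1)).
    move=> s /andP[s0 s1].
    have := H (1 - s) (s / 2) (s / 2) ltac:(lra) ltac:(lra) ltac:(lra)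
      ltac:(lra).
    by congr (`|_| <= C * _); lra.
  apply: (@norm_le_end _ _ ((a1 + a3) / 2 - a2) _ ((b1 + b3) / 2 - b2)).
  move=> s /andP[s0 s1].
  have := H (s / 2) (1 - s) (s / 2) ltac:(lra) ltac:(lra) ltac:(lra) ltac:(lra).
  by congr (`|_| <= C * _); lra.
split=> [k t km|k l c km lm].
  have pE z' xi : 0 <= xi < 1 -> pwl m z' (gridpt m k xi) = piece z' k xi.
    by move=> h01; rewrite pwl_gridpt// modn_small.
  have /lim2 [q1 q2] (s : R) (s01 : 0 < s < 1) :
      `|(1 - s) * z (3 * k + 1)%N + s * z (3 * k + 2)%N| <=
      C * ((1 - s) * h (3 * k + 1)%N + s * h (3 * k + 2)%N).
    have /andP[s0 s1] := s01; rewrite -!piece_in// -!pE ?(ltW s0)//.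
  have /lim2 [r1 r2] (s : R) (s01 : 0 < s < 1) :
      `|(1 - s) * z (3 * k + 1)%N + s * z (3 * k + 2)%N| <=
      C * ((1 - s) * (1 - h (3 * k + 1)%N) + s * (1 - h (3 * k + 2)%N)).
    have /andP[s0 s1] := s01; have := p1 (gridpt m k s).
    rewrite !pE ?(ltW s0)// !piece_in//; congr (_ <= C * _); ring.
  have q0 := p0 (gridpt m k 0); have r0 := p1 (gridpt m k 0).
  rewrite !pE ?lexx ?ltr01// !piece_end in q0 r0.
  by case: t => [|[|[|//]]] _; rewrite ?addn0.
have v := pD (gridpt m k 0) (gridpt m l 0).
have /lim2 [e1 e2] (eta : R) (h01 : 0 < eta < 1) :
    `|(1 - eta) * defect m z k l (0, 1, 1, 0)%N
      + eta * defect m z k l (0, 2, 2, 0)%N| <=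
    C * ((1 - eta) * defect m h k l (0, 1, 1, 0)%N
         + eta * defect m h k l (0, 2, 2, 0)%N).
  by rewrite -!slack_edge//; apply: pD.
have /lim2 [d1 _] (xi : R) (h01 : 0 < xi < 1) :
    `|(1 - xi) * defect m z k l (2, 1, 0, 1)%N
      + xi * defect m z l k (2, 1, 0, 1)%N| <=
    C * ((1 - xi) * defect m h k l (2, 1, 0, 1)%N
      + xi * defect m h l k (2, 1, 0, 1)%N).
  have h01' : 0 < 1 - xi < 1 by lra.
  have sl z' := slack_diagonal z' m0 km lm h01'.
  have xiE : 1 - (1 - xi) = xi by ring.
  by rewrite xiE in sl; rewrite -!sl; apply: pD.
have /lim3 [w1 w2] (s1 s2 s3 : R) (s10 : 0 < s1) (s20 : 0 < s2) (s30 : 0 < s3)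
    (s123 : s1 + s2 + s3 = 1) :
    `|s1 * defect m z k l (1, 1, 1, 0)%N + s2 * defect m z k l (2, 1, 2, 0)%N
      + s3 * defect m z l k (2, 1, 2, 0)%N| <=
    C * (s1 * defect m h k l (1, 1, 1, 0)%N + s2 * defect m h k l (2, 1, 2, 0)%N
      + s3 * defect m h l k (2, 1, 2, 0)%N).
  have -> : s1 = 1 - s2 - s3 by lra.
  by rewrite -!slack_lower//; [apply: pD|lra|lra].
have /lim3 [u1 u2] (s1 s2 s3 : R) (s10 : 0 < s1) (s20 : 0 < s2) (s30 : 0 < s3)
    (s123 : s1 + s2 + s3 = 1) :
    `|s1 * defect m z k l (2, 2, 2, 1)%N + s2 * defect m z k l (2, 1, 1, 1)%N
      + s3 * defect m z l k (2, 1, 1, 1)%N| <=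
    C * (s1 * defect m h k l (2, 2, 2, 1)%N + s2 * defect m h k l (2, 1, 1, 1)%N
      + s3 * defect m h l k (2, 1, 1, 1)%N).
  have sl z' := @slack_upper m k l z' m0 km lm (1 - s3) (1 - s2)
    ltac:(lra) ltac:(lra) ltac:(lra).
  have e1' : 1 - s3 + (1 - s2) - 1 = s1 by lra.
  have e2' : 1 - (1 - s2) = s2 by ring.
  have e3' : 1 - (1 - s3) = s3 by ring.
  by rewrite e1' e2' e3' in sl; rewrite -!sl; apply: pD.
have v0 : `|defect m z k l (0, 0, 0, 0)%N| <= C * defect m h k l (0, 0, 0, 0)%N.
  by rewrite -!slack_vertex.
rewrite !inE.
by do 7![case/orP => [/eqP -> //|]] => /eqP ->.
Qed.

End Grid.

(** * Reduction to a finite linear system *)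

Section Finite.
Variable R : realType.
Implicit Types (x y C xi eta : R) (z h : nat -> R) (k l m : nat).

(** Wherever one of the bounds on a perturbation is 0, so is the quantity that
    it bounds; for functions on the grid this is a system of linear equations
    for [z], which is selected by the values [h] of [pi]. *)
Definition tight_system m h z : Prop :=
  (forall k t, (k < m)%N -> (t < 3)%N ->
     h (3 * k + t)%N = 0 \/ h (3 * k + t)%N = 1 -> z (3 * k + t)%N = 0) /\
  (forall k l c, (k < m)%N -> (l < m)%N -> c \in corner_types ->
     defect m h k l c = 0 -> defect m z k l c = 0).

Lemma corner_bound_tight m C h z : corner_bound m C h z -> tight_system m h z.
Proof.
move=> [b1 b2]; split=> [k t km t3|k l c km lm cc] h0.
  have [p q] := b1 k t km t3; apply/eqP; rewrite -normr_le0.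
  by case: h0 => h0; [move: p|move: q]; rewrite h0 ?subrr mulr0.
by apply/eqP; rewrite -normr_le0 (le_trans (b2 k l c km lm cc))// h0 mulr0.
Qed.

Lemma uniform_bound (r : seq (R * R)) :
  (forall p, p \in r -> 0 <= p.1 /\ (p.1 = 0 -> p.2 = 0)) ->
  exists2 C, 0 < C & forall p, p \in r -> `|p.2| <= C * p.1.
Proof.
elim: r => [|p r IH] rP; first by exists 1.
have [|C C0 CP] := IH; first by move=> s sr; apply: rP; rewrite inE sr orbT.
have [p0 p00] := rP p (mem_head _ _).
have D0 : 0 <= `|p.2| / p.1 by rewrite divr_ge0.
exists (C + `|p.2| / p.1) => [|s]; first by rewrite ltr_wpDr.
rewrite inE mulrDl => /orP[/eqP ->|sr].
  have [z|nz] := eqVneq p.1 0; first by rewrite p00 ?z ?mulr0 ?normr0 ?addr0.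
  by rewrite divfK// lerDr mulr_ge0// ltW.
have [s0 _] : _ := rP s (mem_behead (s := p :: r) sr).
by apply: (le_trans (CP _ sr)); rewrite lerDl mulr_ge0.
Qed.

(** The corner inequalities as one list, from which a common constant can be
    obtained. *)
Definition slacks m h z : seq (R * R) :=
  [seq (h (3 * p.1 + p.2)%N, z (3 * p.1 + p.2)%N)
     | p <- allpairs pair (iota 0 m) (iota 0 3)] ++
  [seq (1 - h (3 * p.1 + p.2)%N, z (3 * p.1 + p.2)%N)
     | p <- allpairs pair (iota 0 m) (iota 0 3)] ++
  [seq (defect m h p.1.1 p.1.2 p.2, defect m z p.1.1 p.1.2 p.2)
     | p <- allpairs pair (allpairs pair (iota 0 m) (iota 0 m)) corner_types].

Lemma slacksP m h z (P : R * R -> Prop) :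
  (forall p, p \in slacks m h z -> P p) <->
  (forall k t, (k < m)%N -> (t < 3)%N ->
     P (h (3 * k + t)%N, z (3 * k + t)%N) /\
     P (1 - h (3 * k + t)%N, z (3 * k + t)%N)) /\
  (forall k l c, (k < m)%N -> (l < m)%N -> c \in corner_types ->
     P (defect m h k l c, defect m z k l c)).
Proof.
split=> [H|[H1 H2] p].
  split=> [k t km t3|k l c km lm cc].
    have kt : (k, t) \in allpairs pair (iota 0 m) (iota 0 3).
      by apply: allpairs_f; rewrite mem_iota add0n.
    split; apply: H; rewrite !mem_cat; apply/orP.
      by left; apply/mapP; exists (k, t).
    by right; apply/orP; left; apply/mapP; exists (k, t).
  apply: H; rewrite !mem_cat; apply/orP; right; apply/orP; right.
  apply/mapP; exists (k, l, c) => //; apply: allpairs_f => //.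
  by apply: allpairs_f; rewrite mem_iota add0n.
rewrite !mem_cat => /or3P[] /mapP[q /allpairsP[[a b] [ai bi ->]] ->].
- move: ai bi; rewrite !mem_iota !add0n /= => am b3.
  by case: (H1 a b am b3).
- move: ai bi; rewrite !mem_iota !add0n /= => am b3.
  by case: (H1 a b am b3).
- move: ai bi => /allpairsP[[k l] [+ + ->]]; rewrite !mem_iota !add0n /=.
  by move=> km lm cc; apply: H2.
Qed.

(** The equations only control the slacks that vanish; the others are finitely
    many positive numbers and leave room for a multiple of [z]. *)
Lemma tight_corner_bound m h z : corner_bound m 1 h (fun=> 0) ->
  tight_system m h z -> exists2 C, 0 < C & corner_bound m C h z.
Proof.
move=> [n1 n2] [t1 t2].
have d0 k l c : defect m (fun=> 0 : R) k l c = 0.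
  by case: c => [[[? ?] ?] ?]; rewrite /defect addr0 subr0.
have [|C C0 CP] := @uniform_bound (slacks m h z).
  apply/slacksP; split=> [k t km t3|k l c km lm cc].
    have [] := n1 k t km t3; rewrite normr0 !mul1r => p1 p2.
    split; split=> //= e; apply: t1 => //; [by left|right; lra].
  have := n2 k l c km lm cc; rewrite d0 normr0 mul1r => p.
  by split=> //=; apply: t2.
by exists C => //; move/slacksP: CP.
Qed.

(** Nothing is required at the end points, where perturbations may jump. *)
Definition affine_on (F : R -> R) : Prop :=
  exists a b, forall xi, 0 < xi < 1 -> F xi = a + b * xi.

Lemma affine_on_rev F : affine_on F -> affine_on (fun xi => F (1 - xi)).
Proof.
move=> [a [b FE]]; exists (a + b), (- b) => xi h01.
by rewrite FE; [ring|lra].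
Qed.

Lemma affine_on_opp F : affine_on F -> affine_on (fun xi => - F xi).
Proof.
by move=> [a [b FE]]; exists (- a), (- b) => xi h01; rewrite FE//; ring.
Qed.

Lemma affine_on_revE F : affine_on (fun xi => F (1 - xi)) <-> affine_on F.
Proof.
split=> [/affine_on_rev [a [b FE]]|/affine_on_rev//].
by exists a, b => xi /FE; rewrite opprB addrC subrK.
Qed.

Lemma affine_on_oppE F : affine_on (fun xi => - F xi) <-> affine_on F.
Proof.
split=> [/affine_on_opp [a [b FE]]|/affine_on_opp//].
by exists a, b => xi /FE; rewrite opprK.
Qed.

(** Subtract the line through two points of the graph; the remainder [N] obeys
    the same equation and vanishes at 1/4 and 3/4, hence (by reflection at
    1/4, 1/2 and 3/4) repeats itself after 1/2, while [N] halves when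
    the distance to 1/2 is halved.  So any bound for [N] can be halved. *)
Lemma midpoint_affine (F : R -> R) (B : R) :
  (forall xi, 0 < xi < 1 -> `|F xi| <= B) ->
  (forall xi eta, 0 < xi < 1 -> 0 < eta < 1 ->
     F ((xi + eta) / 2) = (F xi + F eta) / 2) ->
  affine_on F.
Proof.
move=> FB mid; pose b := 2 * (F (3 / 4) - F (1 / 4));
  pose a := F (1 / 4) - b / 4.
exists a, b => xi h01; apply/eqP; rewrite -subr_eq0.
pose N x := F x - (a + b * x); rewrite -/(N xi).
have Nmid u v : 0 < u < 1 -> 0 < v < 1 -> 2 * N ((u + v) / 2) = N u + N v.
  by move=> hu hv; rewrite /N mid//; field.
have N1 : N (1 / 4) = 0 by rewrite /N /a; field.
have N3 : N (3 / 4) = 0 by rewrite /N /a /b; field.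
have N2 : N (1 / 2) = 0.
  have := Nmid (1 / 4) (3 / 4) ltac:(lra) ltac:(lra).
  have -> : (1 / 4 + 3 / 4) / 2 = 1 / 2 :> R by lra.
  by rewrite N1 N3; lra.
have half u : 0 < u < 1 -> 2 * N ((u + 1 / 2) / 2) = N u.
  by move=> hu; rewrite Nmid ?N2 ?addr0//; lra.
have refl4 u : 0 < u < 1 / 2 -> N (1 / 2 - u) = - N u.
  move=> hu; have := Nmid u (1 / 2 - u) ltac:(lra) ltac:(lra).
  have -> : (u + (1 / 2 - u)) / 2 = 1 / 4 by lra.
  by rewrite N1; lra.
have refl2 u : 0 < u < 1 -> N (1 - u) = - N u.
  move=> hu; have := Nmid u (1 - u) ltac:(lra) ltac:(lra).
  have -> : (u + (1 - u)) / 2 = 1 / 2 by lra.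
  by rewrite N2; lra.
have shift u : 0 < u < 1 / 2 -> N (u + 1 / 2) = N u.
  move=> hu; have -> : u + 1 / 2 = 1 - (1 / 2 - u) by lra.
  by rewrite refl2 ?refl4 ?opprK//; lra.
have halve S : (forall u, 0 < u < 1 -> `|N u| <= S) ->
    forall u, 0 < u < 1 -> `|N u| <= S / 2.
  move=> NS; have mid' u : 1 / 4 < u < 3 / 4 -> `|N u| <= S / 2.
    move=> hu; have := half (2 * u - 1 / 2) ltac:(lra).
    have -> : (2 * u - 1 / 2 + 1 / 2) / 2 = u by lra.
    by have := NS (2 * u - 1 / 2) ltac:(lra); rewrite !ler_norml; lra.
  have S0 : 0 <= S / 2.
    by have := NS (1 / 2) ltac:(lra); rewrite N2 normr0; lra.
  move=> u hu; have [u1|u1|->] := ltgtP u (1 / 4); last by rewrite N1 normr0.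
    by rewrite -shift; [apply: mid'|]; lra.
  have [u3|u3|->] := ltgtP u (3 / 4); last by rewrite N3 normr0.
    by apply: mid'; lra.
  have -> : u = (u - 1 / 2) + 1 / 2 by lra.
  by rewrite shift; [apply: mid'|]; lra.
have bound n : forall u, 0 < u < 1 ->
    `|N u| <= (B + `|a| + `|b|) / 2 ^+ n.
  elim: n => [|n IH] u hu; last first.
    by have := halve _ IH u hu; rewrite exprSr invfM mulrA.
  rewrite expr0 divr1 /N; apply: le_trans (ler_normB _ _) _.
  rewrite -[leRHS]addrA; apply: lerD; first exact: FB.
  apply: le_trans (ler_normD _ _) _;
    rewrite lerD2l normrM (ger0_norm (x := u)); last lra.
  by rewrite ler_piMr//; lra.
set S := B + _ + _ in bound.
rewrite -normr_le0 leNgt; apply/negP => Npos.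
have S0 : 0 <= S by have := bound 0%N _ h01; rewrite expr0 divr1; lra.
pose n := Num.bound (S / `|N xi|).
have := bound n _ h01; rewrite leNgt => /negP; apply.
rewrite ltr_pdivrMr ?exprn_gt0// mulrC -ltr_pdivrMr//.
have : S / `|N xi| < n%:R.
  by have := archi_boundP (divr_ge0 S0 (ltW Npos)).
move=> /lt_trans; apply; rewrite -natrX ltr_nat; exact: ltn_expl.
Qed.

(** Moving [t] from the first variable to the second leaves the third
    unchanged, so the increments of [G1] do not depend on where they start. *)
Lemma triangle_affine (G1 G2 G3 : R -> R) (B : R) :
  (forall xi, 0 < xi < 1 -> `|G1 xi| <= B) ->
  (forall xi eta zeta, 0 < xi -> 0 < eta -> 0 < zeta -> xi + eta + zeta = 1 ->
     G1 xi + G2 eta + G3 zeta = 0) ->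
  affine_on G1.
Proof.
move=> GB G0; apply: midpoint_affine GB _ => u v.
wlog uv : u v / u <= v => [H|hu hv].
  have [/H//|/ltW vu hu hv] := leP u v.
  by rewrite addrC [in RHS]addrC; apply: H.
(* [d] is half of the step from [u] to [v]; [e] is so small that all points
   used stay inside the triangle. *)
pose e := (1 - v) / 2; pose d := (v - u) / 2.
have e1 := G0 u (d + e) (1 - u - (d + e)).
have e2 := G0 (u + d) e (1 - u - (d + e)).
have e3 := G0 (u + d) (d + e) (1 - (u + d) - (d + e)).
have e4 := G0 v e (1 - (u + d) - (d + e)).
have -> : (u + v) / 2 = u + d by rewrite /d; field.
have := e1 ltac:(rewrite /d /e; lra) ltac:(rewrite /d /e; lra)
           ltac:(rewrite /d /e; lra) ltac:(rewrite /d /e; lra).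
have := e2 ltac:(rewrite /d /e; lra) ltac:(rewrite /d /e; lra)
           ltac:(rewrite /d /e; lra) ltac:(rewrite /d /e; lra).
have := e3 ltac:(rewrite /d /e; lra) ltac:(rewrite /d /e; lra)
           ltac:(rewrite /d /e; lra) ltac:(rewrite /d /e; lra).
have := e4 ltac:(rewrite /d /e; lra) ltac:(rewrite /d /e; lra)
           ltac:(rewrite /d /e; lra) ltac:(rewrite /d /e; lra).
by lra.
Qed.

(** If the defect only vanishes in the limit [zeta -> 0], comparing two
    values of [eta] at the same small [zeta] eliminates [G3]. *)
Lemma triangle_transfer (G1 G2 G3 : R -> R) (A : R) :
  (forall xi eta zeta, 0 < xi -> 0 < eta -> 0 < zeta -> xi + eta + zeta = 1 ->
     `|G1 xi + G2 eta + G3 zeta| <= A * zeta) ->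
  affine_on G1 -> affine_on G2.
Proof.
move=> GA [a [b G1E]].
pose M eta := G2 eta - b * eta.
have Mconst u v : 0 < u < 1 -> 0 < v < 1 -> `|M u - M v| <= 0.
  move=> hu hv; rewrite -(mulr0 1).
  pose w := Num.min (1 - u) (1 - v); have w0 : 0 < w.
    by rewrite lt_min; lra.
  apply: (@norm_le_end _ _ _ 0 _ (2 * A * w)) => s /andP[s0 s1].
  have wu : w <= 1 - u by rewrite ge_min lexx.
  have wv : w <= 1 - v by rewrite ge_min lexx orbT.
  have sw : 0 < s * w < w by rewrite mulr_gt0//= gtr_pMl//; lra.
  have := GA (1 - u - s * w) u (s * w); have := GA (1 - v - s * w) v (s * w).
  rewrite !G1E; try lra; rewrite mulr0 mul1r addr0 add0r => Hv Hu.
  have := Hv ltac:(lra) ltac:(lra) ltac:(lra) ltac:(lra).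
  have := Hu ltac:(lra) ltac:(lra) ltac:(lra) ltac:(lra).
  rewrite /M !ler_norml; lra.
exists (M (1 / 2)), b => xi h01.
have := Mconst xi (1 / 2) h01 ltac:(lra); rewrite normr_le0 subr_eq0 => /eqP <-.
by rewrite /M subrK.
Qed.

End Finite.

(** * Covered intervals *)

Section Covering.
Variable R : realType.
Implicit Types (x y C xi eta : R) (z h : nat -> R) (k l m : nat).

(** The two one-sided limits are extrapolated from the values at one and two
    thirds of the interval. *)
Lemma pwl_refine m (g : R -> R) : (0 < m)%N ->
  (forall x (j : int), g (x + j%:~R) = g x) ->
  (forall k, (k < m)%N -> affine_on (fun xi => g (gridpt m k xi))) ->
  exists z, forall x, g x = pwl m z x.
Proof.
move=> m0 gper gaff.
pose G k xi := g (gridpt m k xi).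
pose z i := let k := (i %/ 3)%N in
  if (i %% 3 == 0)%N then G k 0
  else if (i %% 3 == 1)%N then 2 * G k (1 / 3) - G k (2 / 3)
  else 2 * G k (2 / 3) - G k (1 / 3).
have zE k t : (t < 3)%N -> ((3 * k + t) %/ 3 = k)%N /\ ((3 * k + t) %% 3 = t)%N.
  by move=> t3; rewrite mulnC divnMDl// divn_small// addn0 modnMDl modn_small.
exists z => x; have [k [xi [j [km /andP[xi0 xi1] ->]]]] := gridptP x m0.
rewrite gper pwl_periodic pwl_gridpt ?xi0// modn_small//.
move: xi0; rewrite le_eqVlt => /orP[/eqP <-|xi0].
  by rewrite piece_end /z -[(3 * k)%N]addn0; have [-> ->] := zE k 0%N isT.
rewrite piece_in// /z.
have [-> ->] := zE k 1%N isT; have [-> ->] /= := zE k 2%N isT.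
have [a [b E]] := gaff k km; by rewrite /G !E; lra.
Qed.

Lemma pwl_eq0 m z : (0 < m)%N ->
  (forall k t, (k < m)%N -> (t < 3)%N -> z (3 * k + t)%N = 0) <->
  (forall x, pwl m z x = 0).
Proof.
move=> m0; split=> [z0 x|p0 k t km].
  have [k [xi [j [km xi01 ->]]]] := gridptP x m0.
  rewrite pwl_periodic pwl_gridpt// modn_small// /piece -[X in z X]addn0.
  by case: ifP => _; rewrite !z0// ?mulr0 ?addr0.
have pE xi : 0 <= xi < 1 -> piece z k xi = 0.
  by move=> h01; rewrite -(p0 (gridpt m k xi)) pwl_gridpt// modn_small.
have e0 := pE 0 ltac:(lra); have e1 := pE (1 / 3) ltac:(lra).
have e2 := pE (2 / 3) ltac:(lra).
rewrite piece_end in e0; rewrite !piece_in in e1 e2; try lra.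
by case: t => [|[|[|//]]] _; rewrite ?addn0//; lra.
Qed.

(** A perturbation can fail to be piecewise linear on the grid of [pi] only on
    the intervals that are not covered. *)
Definition covered (pi : R -> R) m k : Prop :=
  forall g, perturbation pi 1 g -> affine_on (fun xi => g (gridpt m k xi)).

(** In the slack [A xi + B eta + D zeta] of a triangle, with coordinates that
    add up to 1, a weight is the value at the vertex where its coordinate is 1.
    So the slack vanishes on the edge [zeta = 0] iff [A] and [B] are 0, and
    this edge relates the intervals of [xi] and [eta]. *)
Definition linked (A B D : R) (P1 P2 P3 : Prop) : Prop :=
  [/\ A = 0 -> B = 0 -> D = 0 -> [/\ P1, P2 & P3],
      A = 0 -> B = 0 -> (P1 <-> P2), A = 0 -> D = 0 -> (P1 <-> P3)
    & B = 0 -> D = 0 -> (P2 <-> P3)].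

(** The family [G1], [G2], [G3] is indexed by all perturbations [i] at once,
    since being covered is a statement about all of them. *)
Lemma triangle_linked (I : Type) (Q : I -> Prop) (G1 G2 G3 : I -> R -> R)
    (A B D : R) (P1 P2 P3 : Prop) :
  (P1 <-> forall i, Q i -> affine_on (G1 i)) ->
  (P2 <-> forall i, Q i -> affine_on (G2 i)) ->
  (P3 <-> forall i, Q i -> affine_on (G3 i)) ->
  (forall i xi, Q i -> `|G1 i xi| <= 1 /\ `|G2 i xi| <= 1 /\ `|G3 i xi| <= 1) ->
  (forall i xi eta zeta, Q i -> 0 < xi -> 0 < eta -> 0 < zeta ->
     xi + eta + zeta = 1 ->
     `|G1 i xi + G2 i eta + G3 i zeta| <= A * xi + B * eta + D * zeta) ->
  linked A B D P1 P2 P3.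
Proof.
move=> E1 E2 E3 Gb H.
split=> [a0 b0 d0|a0 b0|a0 d0|b0 d0].
- have H0 i xi eta zeta : Q i -> 0 < xi -> 0 < eta -> 0 < zeta ->
      xi + eta + zeta = 1 -> G1 i xi + G2 i eta + G3 i zeta = 0.
    move=> Qi x0 e0 z0 s; apply/eqP; rewrite -normr_le0.
    by have := H i _ _ _ Qi x0 e0 z0 s; rewrite a0 b0 d0 !mul0r !addr0.
  split; [apply/E1|apply/E2|apply/E3] => i Qi.
  + apply: (@triangle_affine _ (G1 i) (G2 i) (G3 i) 1).
      by move=> xi _; have [] := Gb i xi Qi.
    by move=> x y z *; rewrite H0.
  + apply: (@triangle_affine _ (G2 i) (G1 i) (G3 i) 1).
      by move=> xi _; have [_ []] := Gb i xi Qi.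
    by move=> x y z *; rewrite (addrC (G2 i x)) H0// [y + x]addrC.
  + apply: (@triangle_affine _ (G3 i) (G1 i) (G2 i) 1).
      by move=> xi _; have [_ []] := Gb i xi Qi.
    move=> x y z *; rewrite -addrA addrC H0//.
    by rewrite addrC addrA.
- rewrite E1 E2; split=> aff i Qi; have := aff i Qi.
    apply: (@triangle_transfer _ _ _ (G3 i) D) => x y z *.
    by have := H i x y z; rewrite a0 b0 !mul0r !add0r; apply.
  apply: (@triangle_transfer _ _ _ (G3 i) D) => x y z *.
  rewrite (addrC (G2 i x)); have := H i y x z.
  by rewrite a0 b0 !mul0r !add0r; apply=> //; rewrite [y + x]addrC.
- rewrite E1 E3; split=> aff i Qi; have := aff i Qi.
    apply: (@triangle_transfer _ _ _ (G2 i) B) => x y z *.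
    rewrite addrAC; have := H i x z y.
    by rewrite a0 d0 !mul0r add0r addr0; apply=> //; rewrite addrAC.
  apply: (@triangle_transfer _ _ _ (G2 i) B) => x y z *.
  have -> : G3 i x + G1 i y + G2 i z = G1 i y + G2 i z + G3 i x by ring.
  have := H i y z x; rewrite a0 d0 !mul0r add0r addr0; apply=> //.
  by rewrite addrAC [y + x]addrC.
- rewrite E2 E3; split=> aff i Qi; have := aff i Qi.
    apply: (@triangle_transfer _ _ _ (G1 i) A) => x y z *.
    have -> : G2 i x + G3 i y + G1 i z = G1 i z + G2 i x + G3 i y by ring.
    have := H i z x y; rewrite b0 d0 !mul0r !addr0; apply=> //.
    by rewrite -addrA addrC.
  apply: (@triangle_transfer _ _ _ (G1 i) A) => x y z *.
  have -> : G3 i x + G2 i y + G1 i z = G1 i z + G2 i y + G3 i x by ring.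
  have := H i z y x; rewrite b0 d0 !mul0r !addr0; apply=> //; lra.
Qed.

Section CoveredCells.
Variables (f : R) (m : nat) (h : nat -> R).
Hypotheses (m0 : (0 < m)%N) (mp : minimal f (pwl m h)).
Let pi := pwl m h.
Let Q := perturbation pi 1.
Local Notation P k := (covered pi m (k %% m)).

Let gper g : Q g -> forall x (j : int), g (x + j%:~R) = g x.
Proof. by move=> gQ; apply: (perturbation_periodic mp gQ). Qed.

Let gle1 g x : Q g -> `|g x| <= 1.
Proof.
case=> _ /(_ x) + _; rewrite mul1r => /le_trans; apply.
by rewrite gerBl (minimal_ge0 _ mp).
Qed.

Let gmod g k xi : Q g -> g (gridpt m (k %% m) xi) = g (gridpt m k xi).
Proof.
move=> /gper gp; rewrite -(gp (gridpt m _ _) (k %/ m)%N); congr g.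
rewrite /gridpt [in RHS](divn_eq k m) natrD natrM -pmulrn.
by field; rewrite gt_eqF ?ltr0n.
Qed.

Let PE k : P k <-> forall g, Q g -> affine_on (fun xi => g (gridpt m k xi)).
Proof.
split=> H g gQ; have [a [b E]] := H g gQ; exists a, b => xi h01.
  by rewrite -gmod// E.
by rewrite gmod// E.
Qed.

(** On a lower triangle, [x + y] is measured from the right end of its interval
    so that the three local coordinates add up to 1. *)
Lemma covered_lower k l : (k < m)%N -> (l < m)%N ->
  linked (defect m h k l (2, 1, 2, 0)%N) (defect m h l k (2, 1, 2, 0)%N)
    (defect m h k l (1, 1, 1, 0)%N) (P k) (P l) (P (k + l)).
Proof.
move=> km lm; apply: (@triangle_linked _ Q (fun g xi => g (gridpt m k xi))
  (fun g xi => g (gridpt m l xi)) (fun g xi => - g (gridpt m (k + l) (1 -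
    xi)))).
- exact: PE.
- exact: PE.
- rewrite PE; split=> H g /H.
    by move=> /affine_on_rev/affine_on_opp.
  by move/affine_on_oppE => /(affine_on_revE (fun xi => g (gridpt m (k + l)
    xi))).
- by move=> g xi Qg; rewrite normrN !gle1.
move=> g xi eta zeta [_ _ gD] x0 e0 z0 s.
have -> : 1 - zeta = xi + eta by rewrite -s addrK.
rewrite -gridptD; apply: le_trans (gD _ _) _.
rewrite -[pi _ + _ - _]/(slack pi _ _) slack_lower//; last by lra.
have -> : zeta = 1 - xi - eta by lra.
by rewrite le_eqVlt; apply/orP; left; apply/eqP; ring.
Qed.

(** Here [x] and [y] are measured from the right. *)
Lemma covered_upper k l : (k < m)%N -> (l < m)%N ->
  linked (defect m h l k (2, 1, 1, 1)%N) (defect m h k l (2, 1, 1, 1)%N)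
    (defect m h k l (2, 2, 2, 1)%N) (P k) (P l) (P (k + l + 1)).
Proof.
move=> km lm; apply: (@triangle_linked _ Q
  (fun g xi => g (gridpt m k (1 - xi))) (fun g xi => g (gridpt m l (1 - xi)))
  (fun g xi => - g (gridpt m (k + l + 1) xi))).
- rewrite PE; split=> H g /H; first exact: affine_on_rev.
  by move/(affine_on_revE (fun xi => g (gridpt m k xi))).
- rewrite PE; split=> H g /H; first exact: affine_on_rev.
  by move/(affine_on_revE (fun xi => g (gridpt m l xi))).
- rewrite PE; split=> H g /H; first exact: affine_on_opp.
  by move/affine_on_oppE.
- by move=> g xi Qg; rewrite normrN !gle1.
move=> g xi eta zeta [_ _ gD] x0 e0 z0 s.
have -> : gridpt m (k + l + 1) zeta = gridpt m k (1 - xi) + gridpt m l (1 -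
  eta).
  by rewrite gridptD /gridpt natrD; congr (_ / _); lra.
apply: le_trans (gD _ _) _.
rewrite -[pi _ + _ - _]/(slack pi _ _) slack_upper//; try lra.
have -> : zeta = 1 - xi - eta by lra.
by rewrite le_eqVlt; apply/orP; left; apply/eqP; ring.
Qed.

Lemma covered_edge k l : (k < m)%N -> (l < m)%N ->
  defect m h k l (0, 1, 1, 0)%N = 0 -> defect m h k l (0, 2, 2, 0)%N = 0 ->
  P l <-> P (k + l).
Proof.
move=> km lm d1 d2.
have gE g xi : Q g -> 0 < xi < 1 ->
    g (gridpt m (k + l) xi) = g (gridpt m k 0) + g (gridpt m l xi).
  move=> [_ _ gD] h01; have := gD (gridpt m k 0) (gridpt m l xi).
  rewrite -[pi _ + _ - _]/(slack pi _ _) slack_edge// d1 d2 !mulr0 addr0 mulr0.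
  by rewrite normr_le0 subr_eq0 gridptD add0r => /eqP ->.
rewrite !PE; split=> H g Qg; have [a [b E]] := H g Qg.
  by exists (g (gridpt m k 0) + a), b => xi h01; rewrite gE// E// addrA.
exists (a - g (gridpt m k 0)), b => xi h01; have := E _ h01; rewrite gE//; lra.
Qed.

Lemma covered_diagonal k l : (k < m)%N -> (l < m)%N ->
  defect m h k l (2, 1, 0, 1)%N = 0 -> defect m h l k (2, 1, 0, 1)%N = 0 ->
  P k <-> P l.
Proof.
move=> km lm d1 d2; pose w : R := gridpt m (k + l) 1.
have gE g xi : Q g -> 0 < xi < 1 ->
    g (gridpt m k xi) + g (gridpt m l (1 - xi)) = g w.
  move=> [_ _ gD] h01; have := gD (gridpt m k xi) (gridpt m l (1 - xi)).
  rewrite -[pi _ + _ - _]/(slack pi _ _) slack_diagonal// d1 d2 !mulr0 addr0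
    mulr0.
  by rewrite normr_le0 subr_eq0 gridptD [xi + _]addrC subrK => /eqP ->.
rewrite !PE; split=> H g Qg; have [a [b E]] := H g Qg.
  exists (g w - a - b), b => xi h01; have := gE g (1 - xi) Qg ltac:(lra).
  by rewrite E ?opprB ?[1 + _]addrC ?subrK; lra.
exists (g w - a - b), b => xi h01; have := gE g xi Qg h01.
by rewrite (E (1 - xi)); lra.
Qed.

(** Where [pi] is constantly 0 or 1, the bounds on the values of a perturbation
    leave no freedom. *)
Lemma covered_flat k : (k < m)%N ->
  (h (3 * k + 1)%N = 0 /\ h (3 * k + 2)%N = 0) \/
  (h (3 * k + 1)%N = 1 /\ h (3 * k + 2)%N = 1) -> P k.
Proof.
move=> km hE; rewrite PE => g [g0 g1 _]; exists 0, 0 => xi /andP[x0 x1].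
have := g0 (gridpt m k xi); have := g1 (gridpt m k xi).
rewrite /pi pwl_gridpt ?(ltW x0)// modn_small// piece_in// !mul1r mul0r addr0.
case: hE => -[-> ->].
  by rewrite !mulr0 addr0 [in X in _ -> X -> _]normr_le0 => _ /eqP.
by rewrite !mulr1 subrK subrr normr_le0 => /eqP.
Qed.

End CoveredCells.

End Covering.

(** * The zigzag perturbation *)

Section Zigzag.
Variable R : realType.
Implicit Types (x y C xi eta : R) (z h : nat -> R) (k l m : nat).

(** Odd with respect to the midpoint, so that it is mapped to itself by the
    translations and, up to sign, by the reflections that link two intervals;
    continuous with value 0 at the ends.  Three pieces are the fewest for such
    a function to be nonzero. *)
Definition zigzag xi : R :=
  if xi <= 1 / 3 then xi else if xi <= 2 / 3 then 1 - 2 * xi else xi - 1.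

Lemma zigzagP xi : [\/ xi <= 1 / 3 /\ zigzag xi = xi,
  1 / 3 < xi <= 2 / 3 /\ zigzag xi = 1 - 2 * xi
  | 2 / 3 < xi /\ zigzag xi = xi - 1].
Proof.
rewrite /zigzag; have [a|a] := leP xi (1 / 3); first exact: Or31.
by have [b|b] := leP xi (2 / 3); [apply: Or32|apply: Or33].
Qed.

Lemma zigzag_rev xi : zigzag (1 - xi) = - zigzag xi.
Proof.
by case: (zigzagP xi) => -[? ->]; case: (zigzagP (1 - xi)) => -[? ->]; lra.
Qed.

Lemma zigzag_le xi : 0 <= xi <= 1 ->
  - xi <= zigzag xi <= xi /\ - (1 - xi) <= zigzag xi <= 1 - xi.
Proof. by case: (zigzagP xi) => -[? ->] ?; split; lra. Qed.

Lemma zigzag_pair xi eta zeta : 0 <= xi -> 0 <= eta -> 0 <= zeta ->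
  xi + eta + zeta = 1 ->
  - (2 * zeta) <= zigzag xi + zigzag eta <= 2 * zeta.
Proof.
by case: (zigzagP xi) => -[? ->]; case: (zigzagP eta) => -[? ->]; lra.
Qed.

(** The coefficient with which the zigzag occurs on an interval, [P] being the
    statement that the interval is covered. *)
Definition uncov (P : Prop) : R := if `[< P >] then 0 else 1.

Lemma uncov_equiv (P1 P2 : Prop) : (P1 <-> P2) -> uncov P1 = uncov P2.
Proof. by move=> e; rewrite /uncov (asbool_equiv_eq e). Qed.

Lemma uncov0 (P : Prop) : P -> uncov P = 0.
Proof. by move=> p; rewrite /uncov asboolT. Qed.

Lemma uncov01 (P : Prop) : uncov P = 0 \/ uncov P = 1.
Proof. by rewrite /uncov; case: asboolP => _; [left|right]. Qed.

(** What the multiple [C] of a slack must satisfy: 3 is the constant in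
    [zigzag_triangle], where a sum of two zigzags is at most [2 * zeta] and
    the third is at most [zeta]. *)
Definition large (C s : R) : Prop := 0 <= s /\ (s = 0 \/ 3 <= C * s).

Lemma large_ge0 C s : large C s -> 0 <= C * s.
Proof. by move=> [_ [->|]]; [rewrite mulr0|lra]. Qed.

Lemma large_mul C s x : large C s -> 0 <= x ->
  s = 0 \/ 3 * x <= C * (s * x).
Proof.
move=> [_ [->|h]] x0; first by left.
by right; rewrite mulrA ler_wpM2r.
Qed.

(** If [D] is the only nonzero weight, the zigzags of [xi] and [eta] have the
    same coefficient and nearly cancel, as [eta] is close to [1 - xi] and the
    zigzag is odd about 1/2 and Lipschitz.  If exactly one weight is 0, its
    variable tends to 1 and the other two to 0 where the slack vanishes, and
    all three zigzags are small there. *)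
Lemma zigzag_triangle C (A B D xi eta zeta : R) (P1 P2 P3 : Prop) :
  large C A -> large C B -> large C D -> linked A B D P1 P2 P3 ->
  0 < xi -> 0 < eta -> 0 < zeta -> xi + eta + zeta = 1 ->
  `|uncov P1 * zigzag xi + uncov P2 * zigzag eta + uncov P3 * zigzag zeta| <=
  C * (A * xi + B * eta + D * zeta).
Proof.
move=> lA lB lD [call c12 c13 c23] x0 e0 z0 s.
have [b1 b1'] := @zigzag_le xi ltac:(lra).
have [b2 b2'] := @zigzag_le eta ltac:(lra).
have [b3 b3'] := @zigzag_le zeta ltac:(lra).
have p12 := @zigzag_pair xi eta zeta (ltW x0) (ltW e0) (ltW z0) s.
have p13 := @zigzag_pair xi zeta eta (ltW x0) (ltW z0) (ltW e0) ltac:(lra).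
have p23 := @zigzag_pair eta zeta xi (ltW e0) (ltW z0) (ltW x0) ltac:(lra).
have A0 : 0 <= C * (A * xi) by rewrite mulrA mulr_ge0 ?(large_ge0 lA) ?ltW.
have B0 : 0 <= C * (B * eta) by rewrite mulrA mulr_ge0 ?(large_ge0 lB) ?ltW.
have D0 : 0 <= C * (D * zeta) by rewrite mulrA mulr_ge0 ?(large_ge0 lD) ?ltW.
have a := large_mul lA (ltW x0); have b := large_mul lB (ltW e0).
have d := large_mul lD (ltW z0).
rewrite ler_norml !mulrDr.
move: (zigzag xi) (zigzag eta) (zigzag zeta) b1 b1' b2 b2' b3 b3' p12 p13 p23.
move: (C * (A * xi)) (C * (B * eta)) (C * (D * zeta)) A0 B0 D0 a b d.
move=> X Y Z A0 B0 D0 a b d p1 p2 p3 b1 b1' b2 b2' b3 b3' p12 p13 p23.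
case: a => a; [case: b => b; case: d => d|case: b => b; case: d => d].
- have [q1 q2 q3] := call a b d.
  by rewrite !uncov0// !mul0r; lra.
- rewrite (uncov_equiv (c12 a b)) -mulrDr.
  by case: (uncov01 P2) => ->; case: (uncov01 P3) => ->;
    clear -s x0 e0 z0 A0 B0 d p12 b3; lra.
- rewrite (uncov_equiv (c13 a d)) [_ * p1 + _ + _]addrAC -mulrDr.
  by case: (uncov01 P3) => ->; case: (uncov01 P2) => ->;
    clear -s x0 e0 z0 A0 D0 b p13 b2; lra.
- by case: (uncov01 P1) => ->; case: (uncov01 P2) => ->;
     case: (uncov01 P3) => ->; clear -s x0 e0 z0 A0 b d b1' b2 b3; lra.
- rewrite (uncov_equiv (c23 b d)) -[_ * p1 + _ + _]addrA -mulrDr.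
  by case: (uncov01 P1) => ->; case: (uncov01 P3) => ->;
    clear -s x0 e0 z0 B0 D0 a p23 b1; lra.
- by case: (uncov01 P1) => ->; case: (uncov01 P2) => ->;
     case: (uncov01 P3) => ->; clear -s x0 e0 z0 B0 a d b1 b2' b3; lra.
- by case: (uncov01 P1) => ->; case: (uncov01 P2) => ->;
     case: (uncov01 P3) => ->; clear -s x0 e0 z0 D0 b a b1 b2 b3'; lra.
- by case: (uncov01 P1) => ->; case: (uncov01 P2) => ->;
     case: (uncov01 P3) => ->; clear -s x0 e0 z0 a b d b1 b2 b3; lra.
Qed.

Lemma zigzag_interval C (A B xi : R) (P : Prop) : large C A -> large C B ->
  (A = 0 -> B = 0 -> P) -> 0 < xi < 1 ->
  `|uncov P * zigzag xi| <= C * ((1 - xi) * A + xi * B).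
Proof.
move=> lA lB cP /andP[x0 x1].
have [b1 b2] := @zigzag_le xi ltac:(lra).
have y0 : 0 <= 1 - xi by lra.
have A0 : 0 <= C * (A * (1 - xi)) by rewrite mulrA mulr_ge0 ?(large_ge0 lA).
have B0 : 0 <= C * (B * xi) by rewrite mulrA mulr_ge0 ?(large_ge0 lB) ?ltW.
rewrite ler_norml ![_ * A]mulrC ![_ * B]mulrC mulrDr.
have [a|a] := large_mul lA y0; have [b|b] := large_mul lB (ltW x0).
- by rewrite uncov0 ?mul0r; [lra|exact: cP].
all: by case: (uncov01 P) => ->; lra.
Qed.

Lemma zigzag_face C (A B xi : R) (P1 P2 : Prop) : large C A -> large C B ->
  (A = 0 -> B = 0 -> (P1 <-> P2)) -> 0 < xi < 1 ->
  `|(uncov P1 - uncov P2) * zigzag xi| <= C * ((1 - xi) * A + xi * B).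
Proof.
move=> lA lB cP h01; apply: le_trans (zigzag_interval lA lB cP h01).
rewrite !normrM ler_wpM2r//.
have [e|ne] := pselect (P1 <-> P2).
  by rewrite (uncov_equiv e) subrr normr0.
rewrite {3}/uncov asboolF// normr1 /uncov.
case: asboolP => p1; case: asboolP => p2;
  by rewrite ?subrr ?subr0 ?sub0r ?normrN ?normr1 ?normr0 ?ler01.
Qed.

Section Perturbation.
Variables (f : R) (m : nat) (h : nat -> R).
Hypotheses (m0 : (0 < m)%N) (mp : minimal f (pwl m h)).
Local Notation P k := (covered (pwl m h) m (k %% m)).

Definition zigzag_perturbation : R -> R :=
  cellwise m (fun k xi => uncov (P k) * zigzag xi).
Let g := zigzag_perturbation.

Let g_gridpt k xi : 0 <= xi < 1 -> g (gridpt m k xi) = uncov (P k) * zigzag xi.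
Proof.
by move=> h01; rewrite /g /zigzag_perturbation cellwise_gridpt// modn_mod.
Qed.

Let g_periodic x (j : int) : g (x + j%:~R) = g x.
Proof. exact: cellwise_periodic. Qed.

Let zz0 : zigzag 0 = 0. Proof. by case: (zigzagP 0) => -[? ->]; lra. Qed.

Lemma zigzag_perturbationP : exists C, perturbation (pwl m h) C g.
Proof.
have nn : corner_bound m 1 h (fun=> 0).
  apply: perturbation_corner_bound => //.
  suff -> : pwl m (fun=> 0 : R) = fun=> 0 by exact: perturbation0 mp.
  by apply/funext; apply/pwl_eq0.
have d0 k l c : defect m (fun=> 0 : R) k l c = 0.
  by case: c => [[[? ?] ?] ?]; rewrite /defect addr0 subr0.
have [C C0 CP] : exists2 C, 0 < C & forall p,
    p \in slacks m h (fun=> 0 : R) -> large C p.1.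
  (* A common constant for bounding 3 by all nonzero slacks. *)
  have /(_ _)[|C C0 CP] := @uniform_bound _
    [seq (p.1, if p.1 == 0 then 0 else 3 : R) | p <- slacks m h (fun=> 0)].
    move=> p /mapP[q qin ->] /=; split; last by move=> ->; rewrite eqxx.
    move: q qin; apply/slacksP; case: nn => n1 n2.
    split=> [k t km t3|k l c km lm cc] /=.
      by have [] := n1 k t km t3; rewrite normr0 !mul1r.
    by have := n2 k l c km lm cc; rewrite d0 normr0 mul1r.
  exists C => // p pin.
  have p0 : 0 <= p.1.
    move: p pin; apply/slacksP; case: nn => n1 n2.
    split=> [k t km t3|k l c km lm cc] /=.
      by have [] := n1 k t km t3; rewrite normr0 !mul1r.
    by have := n2 k l c km lm cc; rewrite d0 normr0 mul1r.
  split=> //; have := CP _ (map_f _ pin); rewrite /=.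
  by case: eqVneq => [->|_]; [left|rewrite ger0_norm; [right|]].
move/slacksP: CP => [l1 l2']; exists C.
have l2 k l c : (k < m)%N -> (l < m)%N -> c \in corner_types ->
    large C (defect m h k l c) := l2' k l c.
have unary k xi : (k < m)%N -> 0 <= xi < 1 ->
    `|uncov (P k) * zigzag xi| <= C * piece h k xi /\
    `|uncov (P k) * zigzag xi| <= C * (1 - piece h k xi).
  move=> km /andP[]; rewrite le_eqVlt => /orP[/eqP <-|x0] x1.
    rewrite zz0 mulr0 normr0 piece_end -[(3 * k)%N]addn0.
    by have [/= /large_ge0 ? /large_ge0 ?] := l1 k 0%N km isT.
  have [/= a1 a2] := l1 k 1%N km isT; have [/= b1 b2] := l1 k 2%N km isT.
  rewrite piece_in//; split.
    apply: zigzag_interval => // [u v|]; last by rewrite x0.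
    by apply: (covered_flat m0 mp km); left.
  have -> : 1 - ((1 - xi) * h (3 * k + 1)%N + xi * h (3 * k + 2)%N) =
      (1 - xi) * (1 - h (3 * k + 1)%N) + xi * (1 - h (3 * k + 2)%N) by ring.
  apply: zigzag_interval => // [u v|]; last by rewrite x0.
  by apply: (covered_flat m0 mp km); right; lra.
have binary k l xi eta : (k < m)%N -> (l < m)%N -> 0 <= xi < 1 -> 0 <= eta < 1
  ->
    `|slack g (gridpt m k xi) (gridpt m l eta)| <=
    C * slack (pwl m h) (gridpt m k xi) (gridpt m l eta).
  move=> km lm /andP[x0 x1] /andP[e0 e1].
  have edge k' l' eta' : (k' < m)%N -> (l' < m)%N -> 0 <= eta' < 1 ->
      `|slack g (gridpt m k' 0) (gridpt m l' eta')| <=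
      C * slack (pwl m h) (gridpt m k' 0) (gridpt m l' eta').
    move=> km' lm' /andP[]; rewrite le_eqVlt => /orP[/eqP<- _|e0' e1'].
      rewrite slack_vertex// /slack gridptD addr0 !g_gridpt ?lexx ?ltr01//.
      rewrite zz0 !mulr0 addr0 subr0 normr0.
      by have /= /large_ge0 := l2 k' l' (0, 0, 0, 0)%N km' lm' isT.
    have a1 := l2 k' l' (0, 1, 1, 0)%N km' lm' isT.
    have a2 := l2 k' l' (0, 2, 2, 0)%N km' lm' isT.
    rewrite slack_edge ?e0'// /slack gridptD add0r !g_gridpt ?lexx ?ltr01 ?(ltW
      e0')//.
    rewrite zz0 mulr0 add0r.
    rewrite -mulrBl; apply: zigzag_face => //; last by rewrite e0'.
    exact: (covered_edge m0 mp km' lm').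
  have slackC g' x y : slack g' x y = slack g' y x :> R.
    by rewrite /slack [g' x + _]addrC [x + y]addrC.
  move: x0; rewrite le_eqVlt => /orP[/eqP<-|x0]; first by apply: edge;
    rewrite ?e0.
  move: e0; rewrite le_eqVlt => /orP[/eqP<-|e0].
    by rewrite slackC [in leRHS]slackC; apply: edge; rewrite ?(ltW x0).
  have [s1|s1|s1] := ltgtP (xi + eta) 1.
  - rewrite slack_lower// /slack gridptD !g_gridpt ?(ltW x0) ?(ltW e0)//;
    last by lra.
    have -> : xi + eta = 1 - (1 - xi - eta) by ring.
    rewrite zigzag_rev mulrN opprK.
    have := zigzag_triangle (l2 k l (2, 1, 2, 0)%N km lm isT)
      (l2 l k (2, 1, 2, 0)%N lm km isT) (l2 k l (1, 1, 1, 0)%N km lm isT)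
      (covered_lower m0 mp km lm) x0 e0 (zeta := 1 - xi - eta)
      ltac:(lra) ltac:(lra).
    by congr (_ <= C * _); ring.
  - rewrite slack_upper//; try lra.
    rewrite /slack gridptD.
    have -> : gridpt m (k + l) (xi + eta) = gridpt m (k + l + 1) (xi + eta - 1).
      by rewrite /gridpt natrD; congr (_ / _); ring.
    rewrite !g_gridpt ?(ltW x0) ?(ltW e0)//; last by lra.
    have := zigzag_triangle (l2 l k (2, 1, 1, 1)%N lm km isT)
      (l2 k l (2, 1, 1, 1)%N km lm isT) (l2 k l (2, 2, 2, 1)%N km lm isT)
      (covered_upper m0 mp km lm) (xi := 1 - xi) (eta := 1 - eta)
      (zeta := xi + eta - 1) ltac:(lra) ltac:(lra) ltac:(lra) ltac:(lra).
    rewrite !zigzag_rev !mulrN -normrN !opprD !opprK.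
    by congr (_ <= C * _); ring.
  - have e : eta = 1 - xi by lra.
    rewrite e slack_diagonal ?x0// /slack gridptD [xi + (1 - xi)]addrC subrK
      gridptS.
    rewrite !g_gridpt ?lexx ?ltr01 ?(ltW x0) -?e ?(ltW e0)// e.
    rewrite zigzag_rev zz0 mulr0 subr0 mulrN -mulrBl [in leRHS]addrC.
    apply: zigzag_face; last by rewrite x0.
    + exact: (l2 l k (2, 1, 0, 1)%N lm km isT).
    + exact: (l2 k l (2, 1, 0, 1)%N km lm isT).
    + by move=> d2 d1; apply: (covered_diagonal m0 mp km lm).
have unaryx x : `|g x| <= C * pwl m h x /\ `|g x| <= C * (1 - pwl m h x).
  have [k [xi [j [km xi01 ->]]]] := gridptP x m0.
  rewrite g_periodic pwl_periodic g_gridpt// pwl_gridpt//.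
  by have := unary k xi km xi01; rewrite !(modn_small km).
split=> [x|x|x y]; [exact: (unaryx x).1|exact: (unaryx x).2|].
have [k [xi [i [km xi01 ->]]]] := gridptP x m0.
have [l [eta [j [lm eta01 ->]]]] := gridptP y m0.
by rewrite addrACA -intrD !pwl_periodic !g_periodic; apply: binary.
Qed.

(** A third of an interval of the grid is an interval of the refined grid, and
    the zigzag breaks exactly at the thirds. *)
Lemma zigzag_perturbation_affine k :
  affine_on (fun xi => g (gridpt (3 * m) k xi)).
Proof.
set u := uncov (P (k %/ 3)).
have E xi : 0 < xi < 1 ->
    g (gridpt (3 * m) k xi) = u * zigzag (((k %% 3)%:R + xi) / 3).
  move=> h01; have k3 : (k %% 3)%:R <= 2 :> R by rewrite (ler_nat _ _ 2) -ltnS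
    ltn_mod.
  have k0 : 0 <= (k %% 3)%:R :> R by [].
  rewrite -g_gridpt; last by lra.
  congr g; rewrite /gridpt {1}(divn_eq k 3) natrD !natrM; field.
  by rewrite pnatr_eq0 -lt0n.
move: E; have : (k %% 3 < 3)%N by rewrite ltn_mod.
case: (k %% 3)%N => [|[|[|//]]] _ E.
- exists 0, (u / 3) => xi h01; rewrite E//.
  have -> : zigzag ((0%:R + xi) / 3) = xi / 3.
    by case: (zigzagP ((0%:R + xi) / 3)) => -[? ->]; lra.
  by field.
- exists (u / 3), (- (2 * u / 3)) => xi h01; rewrite E//.
  have -> : zigzag ((1%:R + xi) / 3) = (1 - 2 * xi) / 3.
    by case: (zigzagP ((1%:R + xi) / 3)) => -[? ->]; lra.
  by field.
- exists (- (u / 3)), (u / 3) => xi h01; rewrite E//.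
  have -> : zigzag ((2%:R + xi) / 3) = (xi - 1) / 3.
    by case: (zigzagP ((2%:R + xi) / 3)) => -[? ->]; lra.
  by field.
Qed.

End Perturbation.

Lemma affine_on_refine m (g : R -> R) : (0 < m)%N ->
  (forall k, affine_on (fun xi => g (gridpt m k xi))) ->
  forall k, affine_on (fun xi => g (gridpt (3 * m) k xi)).
Proof.
move=> m0 aff k; have [a [b E]] := aff (k %/ 3)%N.
exists (a + b * (k %% 3)%:R / 3), (b / 3) => xi h01.
have k3 : (k %% 3)%:R <= 2 :> R by rewrite (ler_nat _ _ 2) -ltnS ltn_mod.
have k0 : 0 <= (k %% 3)%:R :> R by [].
have -> : gridpt (3 * m) k xi = gridpt m (k %/ 3) (((k %% 3)%:R + xi) / 3).
  rewrite /gridpt {1}(divn_eq k 3) natrD !natrM; field.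
  by rewrite pnatr_eq0 -lt0n.
by rewrite E; [field|lra].
Qed.

(** A nonzero perturbation is either itself piecewise linear on the grid of
    [pi], or it witnesses an uncovered interval; then a multiple of the zigzag
    function is a nonzero perturbation, and it is piecewise linear on the grid
    refined by 3. *)
Theorem extreme_tight_system f q (pi : R -> R) (h' h : nat -> R) :
  (0 < q)%N -> minimal f pi -> pi = pwl q h' -> pi = pwl (3 * q) h ->
  extreme f pi <->
  (forall z, tight_system (3 * q) h z ->
     forall k t, (k < 3 * q)%N -> (t < 3)%N -> z (3 * k + t)%N = 0).
Proof.
move=> q0 mp piq pim; have m0 : (0 < 3 * q)%N by rewrite muln_gt0.
split=> [/(extremeP mp) noP z tz|triv].
  have nn : corner_bound (3 * q) 1 h (fun=> 0).
    apply: perturbation_corner_bound => //; rewrite -pim.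
    suff -> : pwl (3 * q) (fun=> 0 : R) = fun=> 0 by exact: perturbation0 mp.
    by apply/funext; apply/pwl_eq0.
  have [C C0 Cz] := tight_corner_bound nn tz.
  apply/pwl_eq0 => // x; apply: (mulfI (x := C^-1));
    first by rewrite invr_eq0 gt_eqF.
  rewrite mulr0; apply: (noP (fun x => C^-1 * pwl (3 * q) z x)).
  rewrite -[1](mulVf (x := C)) ?gt_eqF// pim.
  by apply: perturbation_scale;
    [rewrite invr_ge0 ltW|exact: corner_bound_perturbation].
have system0 C g : perturbation pi C g ->
    (forall k, affine_on (fun xi => g (gridpt (3 * q) k xi))) -> forall x,
      g x = 0.
  move=> gP aff.
  have [z gz] := pwl_refine m0 (perturbation_periodic mp gP) (fun k _ => aff k).
  move=> x; rewrite gz; move: x; apply/(pwl_eq0 z m0)/triv.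
  apply: (@corner_bound_tight _ _ C); apply: perturbation_corner_bound => //.
  by rewrite -pim; have <- : g = pwl (3 * q) z by apply/funext.
apply/(extremeP mp) => g gP.
have [cov|ncov] := pselect (forall k, covered pi q (k %% q)).
  apply: (system0 1 g gP); apply: affine_on_refine => // k.
  have [a [b E]] := cov k g gP; exists a, b => xi h01; rewrite -E//.
  rewrite -(perturbation_periodic mp gP (gridpt q (k %% q) xi) (k %/ q)%N).
  congr g; rewrite /gridpt [in LHS](divn_eq k q) natrD natrM -pmulrn.
  by field; rewrite pnatr_eq0 -lt0n.
have /existsNP[k nk] := ncov.
have mq : minimal f (pwl q h') by rewrite -piq.
have [C zP] := zigzag_perturbationP q0 mq.
rewrite -piq in zP.
have := system0 C _ zP (zigzag_perturbation_affine h' q0).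
move=> /(_ (gridpt q k (1 / 3)));
  rewrite /zigzag_perturbation cellwise_gridpt//; last by lra.
rewrite modn_mod -piq /uncov asboolF// mul1r /zigzag lexx.
lra.
Qed.

End Zigzag.

(** * Elimination *)

Section Elimination.
Variable R : fieldType.
Implicit Types (z : nat -> R) (K : nat -> nat -> R) (a b c N : nat).

(** The solution space of a system in [N] unknowns is maintained as the column
    space of an [N] by [N] matrix. *)
Definition spans N K (P : (nat -> R) -> Prop) : Prop :=
  forall z, P z <->
  exists w : nat -> R, forall i, (i < N)%N -> z i = \sum_(j < N) K i j * w j.

Definition eqform z a b c : R := z a + z b - z c.

(** Imposing one more equation, with value [d j] on the [j]-th column:
    subtracting multiples of a column [p] with [d p != 0] makes the equation
    hold on all columns; column [p] itself becomes 0, so that the size of the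
    matrix never changes. *)
Definition eliminated N a b c K K' : Prop :=
  let d j := eqform (K^~ j) a b c in
  ((forall j, (j < N)%N -> d j = 0) /\
   forall i j, (i < N)%N -> (j < N)%N -> K' i j = K i j) \/
  exists p, [/\ (p < N)%N, d p != 0 &
    forall i j, (i < N)%N -> (j < N)%N -> K' i j = K i j - K i p * (d j / d p)].

Lemma spans_ext N K (P Q : (nat -> R) -> Prop) :
  (forall z, P z <-> Q z) -> spans N K P -> spans N K Q.
Proof. by move=> PQ KP z; rewrite -PQ. Qed.

Lemma spans_id N (K : nat -> nat -> R) :
  (forall i j, (i < N)%N -> (j < N)%N -> K i j = (i == j)%:R) ->
  spans N K (fun=> True).
Proof.
move=> KE z; split=> // _; exists z => i iN.
rewrite (bigD1 (Ordinal iN)) //= KE// eqxx mul1r big1 ?addr0// => j ji.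
by rewrite KE// eq_sym -val_eqE in ji *; rewrite (negbTE ji) mul0r.
Qed.

Lemma spans_trivial N K P : spans N K P ->
  (forall i j, (i < N)%N -> (j < N)%N -> K i j = 0) <->
  (forall z, P z -> forall i, (i < N)%N -> z i = 0).
Proof.
move=> KP; split=> [K0 z /KP[w zE] i iN|triv i j iN jN].
  by rewrite zE// big1// => j _; rewrite K0 ?mul0r.
apply: (triv (K^~ j)) => //; apply/KP; exists (fun k => (k == j)%:R) => k _.
rewrite (bigD1 (Ordinal jN)) //= eqxx mulr1 big1 ?addr0// => l lj.
by rewrite -val_eqE /= in lj; rewrite (negbTE lj) mulr0.
Qed.

Lemma spans_eliminated N a b c K K' (P : (nat -> R) -> Prop) :
  (a < N)%N -> (b < N)%N -> (c < N)%N -> spans N K P ->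
  eliminated N a b c K K' -> spans N K' (fun z => P z /\ eqform z a b c = 0).
Proof.
move=> aN bN cN KP; set d := fun j => eqform (K^~ j) a b c.
have eqformE z w : (forall i, (i < N)%N -> z i = \sum_(j < N) K i j * w j) ->
    eqform z a b c = \sum_(j < N) d j * w j.
  move=> zE; rewrite /eqform !zE// -big_split -sumrB; apply: eq_bigr => j _ /=.
  by rewrite /d /eqform !mulrBl mulrDl.
rewrite /eliminated -/d => -[[d0 K'E]|[p [pN dp K'E]]] z.
  split=> [[/KP[w zE] _]|[w zE]].
    by exists w => i iN; rewrite zE//; apply: eq_bigr => j _; rewrite K'E.
  have {}zE i : (i < N)%N -> z i = \sum_(j < N) K i j * w j.
    by move=> iN; rewrite zE//; apply: eq_bigr => j _; rewrite K'E.
  split; first by apply/KP; exists w.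
  by rewrite (eqformE _ w)// big1// => j _; rewrite /d d0 ?mul0r.
have sumE w i : (i < N)%N -> \sum_(j < N) K' i j * w j =
    \sum_(j < N) K i j * w j - K i p / d p * \sum_(j < N) d j * w j.
  move=> iN; rewrite mulr_sumr -sumrB; apply: eq_bigr => j _.
  by rewrite K'E// mulrBl; congr (_ - _); rewrite -!mulrA; congr (_ * _);
    rewrite mulrCA.
split=> [[/KP[w zE] z0]|[w zE]].
  exists w => i iN; rewrite sumE// -(eqformE z w)// z0 mulr0 subr0; exact: zE.
pose w' k := w k - (k == p)%:R * ((\sum_(j < N) d j * w j) / d p).
have zE' i : (i < N)%N -> z i = \sum_(j < N) K i j * w' j.
  move=> iN; rewrite zE// sumE//; under [RHS]eq_bigr do rewrite mulrBr.
  rewrite sumrB; congr (_ - _);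
    rewrite [RHS](bigD1 (Ordinal pN)) //= eqxx mul1r.
  rewrite [X in _ = _ + X]big1 ?addr0 => [|j jp].
    by rewrite -mulrA [_^-1 * _]mulrC.
  by rewrite -val_eqE /= in jp; rewrite (negbTE jp) mul0r mulr0.
split; first by apply/KP; exists w'.
rewrite (eqformE z w')//; under eq_bigr do rewrite mulrBr.
rewrite sumrB [X in _ - X](bigD1 (Ordinal pN)) //= eqxx mul1r.
rewrite [X in _ - (_ + X)]big1 ?addr0 => [|j jp].
  by rewrite mulrCA divff// mulr1 subrr.
by rewrite -val_eqE /= in jp; rewrite (negbTE jp) mul0r mulr0.
Qed.

End Elimination.

(** * Programs with bounded loops *)

(** In [PFor i e p] the register [i] runs from 0 to the value that [e] has on
    entry. *)
Inductive prog :=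
| PSkip
| PN of nat & nexp
| PR of nexp & rexp
| PSeq of prog & prog
| PIf of bexp & prog & prog
| PFor of nat & nexp & prog.

Fixpoint compile (p : prog) : cmd :=
  match p with
  | PSkip => Skip
  | PN k e => NSet k e
  | PR k e => RSet k e
  | PSeq p1 p2 => Seq (compile p1) (compile p2)
  | PIf b p1 p2 => If b (compile p1) (compile p2)
  | PFor i e p1 =>
      Seq (NSet i (NCst 0))
          (While (BNot (BLeN e (NReg i)))
                 (Seq (compile p1) (NSet i (NAdd (NReg i) (NCst 1)))))
  end.

Fixpoint nvars (e : nexp) : seq nat :=
  match e with
  | NReg k => [:: k]
  | NCst _ => [::]
  | NAdd e1 e2 | NSub e1 e2 | NMul e1 e2 => nvars e1 ++ nvars e2
  end.

Fixpoint writes (p : prog) : seq nat :=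
  match p with
  | PSkip | PR _ _ => [::]
  | PN k _ => [:: k]
  | PSeq p1 p2 | PIf _ p1 p2 => writes p1 ++ writes p2
  | PFor i _ p1 => i :: writes p1
  end.

Fixpoint loop_bounds (p : prog) : seq nexp :=
  match p with
  | PSkip | PR _ _ | PN _ _ => [::]
  | PSeq p1 p2 | PIf _ p1 p2 => loop_bounds p1 ++ loop_bounds p2
  | PFor _ e p1 => e :: loop_bounds p1
  end.

(** All loop bounds are expressions in the registers of [V], which the program
    leaves alone, so they keep their initial values throughout. *)
Fixpoint safe (V : seq nat) (p : prog) : bool :=
  match p with
  | PSkip | PR _ _ => true
  | PN k _ => k \notin V
  | PSeq p1 p2 | PIf _ p1 p2 => safe V p1 && safe V p2
  | PFor i e p1 =>
      [&& i \notin V, i \notin writes p1, all (mem V) (nvars e) & safe V p1]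
  end.

(** A bound on the running time of the compiled program when no loop runs more
    than [M] times: both branches of a conditional are charged, and the
    constants pay for handling the loop register. *)
Fixpoint cost (M : nat) (p : prog) : nat :=
  match p with
  | PSkip => 1
  | PN _ e => (ncost e).+1
  | PR k e => (ncost k + rcost e).+1
  | PSeq p1 p2 => (cost M p1 + cost M p2).+1
  | PIf b p1 p2 => (bcost b + (cost M p1 + cost M p2)).+1
  | PFor i e p1 => M * (ncost e + cost M p1 + 9) + (ncost e + 7)
  end.

(** The nesting of loops is fixed by the program, so a polynomial bound on the
    length of each of them gives a polynomial running time. *)
Lemma cost_poly (P : {poly nat}) (p : prog) :
  exists Q : {poly nat}, forall q, cost P.[q] p = Q.[q].
Proof.
elim: p => [|k e|k e|p1 [Q1 E1] p2 [Q2 E2]|b p1 [Q1 E1] p2 [Q2 E2]|i e p1 [Q1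
  E1]] /=.
- by exists 1%:P => q; rewrite hornerC.
- by exists (ncost e).+1%:P => q; rewrite hornerC.
- by exists (ncost k + rcost e)%N.+1%:P => q; rewrite hornerC.
- by exists (Q1 + Q2 + 1%:P) => q; rewrite E1 E2 !hornerD hornerC; lia.
- by exists (Q1 + Q2 + (bcost b).+1%:P) => q; rewrite E1 E2 !hornerD hornerC;
  lia.
- exists (P * ((ncost e)%:P + Q1 + 9%N%:P) + (ncost e + 7)%N%:P) => q.
  by rewrite E1 !hornerD hornerM !hornerD !hornerC.
Qed.

Section Meaning.
Variable R : realType.
Implicit Types (st s : state R) (p : prog) (i k : nat) (e : nexp).

Definition setn i k st := State (upd (nregs st) i k) (rmem st).

Fixpoint iterate (F : nat -> state R -> state R) n st :=
  if n is n'.+1 then F n' (iterate F n' st) else st.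

Fixpoint meaning p st : state R :=
  match p with
  | PSkip => st
  | PN k e => setn k (neval st e) st
  | PR k e => State (nregs st) (upd (rmem st) (neval st k) (reval st e))
  | PSeq p1 p2 => meaning p2 (meaning p1 st)
  | PIf b p1 p2 => if beval st b then meaning p1 st else meaning p2 st
  | PFor i e p1 =>
      setn i (neval st e)
        (iterate (fun k s => meaning p1 (setn i k s)) (neval st e) st)
  end.

Lemma meaning_seq p1 p2 st : meaning (PSeq p1 p2) st = meaning p2 (meaning p1
  st).
Proof. by []. Qed.

Lemma meaning_if b p1 p2 st : meaning (PIf b p1 p2) st =
  if beval st b then meaning p1 st else meaning p2 st.
Proof. by []. Qed.

Lemma rmem_PR (u : nexp) (e : rexp) st a : rmem (meaning (PR u e) st) a =
  if a == neval st u then reval st e else rmem st a.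
Proof. by []. Qed.

Lemma reval_op st (e1 e2 : rexp) :
  ((reval st (RAdd e1 e2) = (reval st e1 + reval st e2)%R) *
   (reval st (RSub e1 e2) = (reval st e1 - reval st e2)%R) *
   (reval st (RMul e1 e2) = (reval st e1 * reval st e2)%R) *
   (reval st (RDiv e1 e2) = (reval st e1 / reval st e2)%R))%type.
Proof. by []. Qed.

Lemma nregs_PN k e st r : nregs (meaning (PN k e) st) r =
  if r == k then neval st e else nregs st r.
Proof. by []. Qed.

Lemma meaning_frame p st r : r \notin writes p ->
  nregs (meaning p st) r = nregs st r.
Proof.
elim: p st => [|k e|k e|p1 IH1 p2 IH2|b p1 IH1 p2 IH2|i e p1 IH1] st //=.
- by rewrite inE /upd => /negbTE ->.
- by rewrite mem_cat negb_or => /andP[w1 w2]; rewrite IH2// IH1.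
- by rewrite mem_cat negb_or => /andP[w1 w2]; case: ifP; rewrite ?IH1 ?IH2.
rewrite inE negb_or => /andP[/negbTE ri rw]; rewrite /upd ri.
by elim: (neval st e) => //= n IH; rewrite IH1 //= /upd ri.
Qed.

Lemma neval_ext st st' e : (forall r,
  r \in nvars e -> nregs st r = nregs st' r) ->
  neval st e = neval st' e.
Proof.
elim: e => //= [k|e1 IH1 e2 IH2|e1 IH1 e2 IH2|e1 IH1 e2 IH2] H;
  try by rewrite IH1 ?IH2// => r rin; apply: H; rewrite mem_cat rin ?orbT.
by rewrite H ?inE.
Qed.

Lemma safe_writes V p r : safe V p -> r \in V -> r \notin writes p.
Proof.
move=> + rV; elim: p => //= [k e kV|p1 IH1 p2 IH2|b p1 IH1 p2 IH2|i e p1 IH1].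
- by rewrite inE; apply: contraNneq kV => <-.
- by move=> /andP[/IH1 w1 /IH2 w2]; rewrite mem_cat negb_or w1.
- by move=> /andP[/IH1 w1 /IH2 w2]; rewrite mem_cat negb_or w1.
move=> /and4P[iV _ _ /IH1 w1]; rewrite inE negb_or w1 andbT.
by apply: contraNneq iV => <-.
Qed.

(** Evaluating all bounds, even of inner loops, in the initial state [st] is
    justified by [safe]. *)
Fixpoint bounded (M : nat) st p : Prop :=
  match p with
  | PSkip | PR _ _ | PN _ _ => True
  | PSeq p1 p2 | PIf _ p1 p2 => bounded M st p1 /\ bounded M st p2
  | PFor _ e p1 => (neval st e <= M)%N /\ bounded M st p1
  end.

Lemma bounded_ext V M st st' p : safe V p ->
  (forall r, r \in V -> nregs st r = nregs st' r) ->
  bounded M st p -> bounded M st' p.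
Proof.
move=> + VE; elim: p => //= [p1 IH1 p2 IH2|b p1 IH1 p2 IH2|i e p1 IH1].
- by move=> /andP[/IH1 H1 /IH2 H2] [/H1 ? /H2 ?].
- by move=> /andP[/IH1 H1 /IH2 H2] [/H1 ? /H2 ?].
move=> /and4P[_ _ /allP eV /IH1 H1] [eM /H1 ?]; split=> //.
by rewrite -(@neval_ext st)// => r /eV /VE.
Qed.

Lemma compile_meaning V M p st : safe V p -> bounded M st p ->
  exists2 t, exec (compile p) st t (meaning p st) & (t <= cost M p)%N.
Proof.
elim: p st => /= [|k e|k e|p1 IH1 p2 IH2|b p1 IH1 p2 IH2|i e p1 IH1] st.
- by exists 1%N => //; constructor.
- by exists (ncost e).+1 => //; constructor.
- by exists (ncost k + rcost e).+1 => //; constructor.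
- move=> /andP[s1 s2] [b1 b2]; have [t1 e1 le1] := IH1 st s1 b1.
  have [|t2 e2 le2] := IH2 (meaning p1 st) s2.
    apply: (bounded_ext s2 _ b2) => r rV.
    by rewrite meaning_frame// (safe_writes s1).
  by exists (t1 + t2).+1; [apply: ExecSeq e1 e2|rewrite ltnS leq_add].
- move=> /andP[s1 s2] [b1 b2].
  have [t et le_t] : exists2 t,
    exec (if beval st b then compile p1 else compile p2)
      st t (if beval st b then meaning p1 st else meaning p2 st) &
      (t <= cost M p1 + cost M p2)%N.
    case: ifP => _.
      by have [t e1 le1] := IH1 st s1 b1; exists t;
        rewrite ?(leq_trans le1)// leq_addr.
    by have [t e1 le1] := IH2 st s2 b2; exists t;
      rewrite ?(leq_trans le1)// leq_addl.
  exists (bcost b + t).+1; last by rewrite ltnS leq_add2l.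
  exact: ExecIf.
move=> /and4P[iV iw /allP eV s1] [eM b1].
set n := neval st e; rewrite -/n in eM *.
pose F k s := meaning p1 (setn i k s); pose S k := setn i k (iterate F k st).
have SV k r : r \in V -> nregs (S k) r = nregs st r.
  move=> rV; have ri : (r == i) = false.
    by apply/negbTE; apply: contraNneq iV => <-.
  rewrite /= /upd ri; elim: k => //= k IH.
  by rewrite /F meaning_frame ?(safe_writes s1)//= /upd ri.
have Se k : neval (S k) e = n by apply: neval_ext => r /eV /SV.
have Si k : nregs (S k) i = k by rewrite /= /upd eqxx.
pose w := (ncost e + cost M p1 + 9)%N.
have loop k : (k <= n)%N -> exists2 t,
    exec (While (BNot (BLeN e (NReg i)))
      (Seq (compile p1) (NSet i (NAdd (NReg i) (NCst 1))))) (S (n - k)%N) t (S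
        n) &
    (t <= k * w + (ncost e + 4))%N.
  elim: k => [|k IH] kn.
    rewrite subn0; exists (bcost (BNot (BLeN e (NReg i)))).+1;
      last by move=> /=; lia.
    apply: ExecWhileFalse.
    by change (~~ ~~ (neval (S n) e <= nregs (S n) i)%N); rewrite Se Si leqnn.
  have [t2 e2 le2] := IH (ltnW kn).
  have [t1 e1 le1] : exists2 t, exec (compile p1) (S (n - k.+1)%N) t
      (meaning p1 (S (n - k.+1)%N)) & (t <= cost M p1)%N.
    by apply: IH1 => //; apply: (bounded_ext s1 _ b1) => r rV; rewrite SV.
  have nk : (n - k = (n - k.+1).+1)%N by rewrite subnSK.
  have e3 := @ExecNSet R (meaning p1 (S (n - k.+1)%N)) i (NAdd (NReg i) (NCst
    1)).
  have regi : neval (meaning p1 (S (n - k.+1)%N)) (NAdd (NReg i) (NCst 1)) = (n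
    - k)%N.
    by rewrite [LHS]/= meaning_frame// Si nk addn1.
  rewrite regi in e3.
  have e4 : exec (NSet i (NAdd (NReg i) (NCst 1))) (meaning p1 (S (n - k.+1)%N))
     4 (S (n - k)%N).
    have -> : S (n - k)%N = setn i (n - k)%N (meaning p1 (S (n - k.+1)%N)).
      by rewrite /S nk.
    exact: e3.
  have test : beval (S (n - k.+1)%N) (BNot (BLeN e (NReg i))).
    change (~~ (neval (S (n - k.+1)%N) e <= nregs (S (n - k.+1)%N) i)%N).
    by rewrite Se Si -ltnNge; lia.
  eexists; first exact: (ExecWhileTrue test (ExecSeq e1 e4) e2).
  by rewrite /= mulSn /w; lia.
have [t et le_t] := loop n (leqnn n); rewrite subnn in et.
eexists; first exact: (ExecSeq (ExecNSet st i (NCst 0)) et).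
have : (n * w <= M * w)%N by rewrite leq_mul2r eM orbT.
by rewrite /= -/w; lia.
Qed.

(** Loop invariants.  The invariant must not mention the loop register, which
    has a different final value than the last run of the body saw. *)
Lemma for_rule (Inv : nat -> state R -> Prop) i e p st :
  (forall k v s, Inv k s -> Inv k (setn i v s)) ->
  i \notin writes p -> Inv 0%N st ->
  (forall k s, (k < neval st e)%N -> nregs s i = k ->
     (forall r, r \notin i :: writes p -> nregs s r = nregs st r) ->
     Inv k s -> Inv k.+1 (meaning p s)) ->
  Inv (neval st e) (meaning (PFor i e p) st).
Proof.
move=> Iset iw I0 Istep /=; apply: (Iset).
set F := fun k s => _; set n := neval st e.
suff [] : Inv n (iterate F n st) /\
    forall r, r \notin i :: writes p -> nregs (iterate F n st) r = nregs st r
      by [].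
elim: {-2}n (leqnn n) => [|k IH] kn //=.
have [Ik fr] := IH (ltnW kn).
split.
  apply: (Istep k (setn i k _)) => //; first by rewrite /= /upd eqxx.
    move=> r rw; rewrite /= /upd; case: eqP => [ri|_]; last exact: fr.
    by rewrite ri inE eqxx in rw.
  exact: Iset.
move=> r rw; have := rw; rewrite inE negb_or => /andP[/negbTE ri rw'].
by rewrite /F meaning_frame//= /upd ri fr.
Qed.

End Meaning.

(** * The linear algebra program *)

Local Notation rn := 1%N (only parsing).
Local Notation rq := 2%N (only parsing).
Local Notation rm := 3%N (only parsing).
Local Notation rN := 4%N (only parsing).
Local Notation rB := 5%N (only parsing).
Local Notation ri := 6%N (only parsing).
Local Notation rj := 7%N (only parsing).
Local Notation rk := 8%N (only parsing).
Local Notation rl := 9%N (only parsing).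
Local Notation ra := 10%N (only parsing).
Local Notation rb := 11%N (only parsing).
Local Notation rc := 12%N (only parsing).
Local Notation rz := 13%N (only parsing).
Local Notation rp := 14%N (only parsing).
Local Notation rf := 15%N (only parsing).

Definition eqR (e1 e2 : rexp) : bexp := BAnd (BLeR e1 e2) (BLeR e2 e1).
Definition eqN (e1 e2 : nexp) : bexp := BAnd (BLeN e1 e2) (BLeN e2 e1).

Lemma beval_eqR (R : realType) (st : state R) e1 e2 :
  beval st (eqR e1 e2) = (reval st e1 == reval st e2).
Proof. by rewrite eq_le. Qed.

Lemma beval_eqN (R : realType) (st : state R) e1 e2 :
  beval st (eqN e1 e2) = (neval st e1 == neval st e2).
Proof. by rewrite eqn_leq. Qed.

(** Above the address [B] where the input ends, four scratch cells are followed
    by the [N] values of [h] and the rows of an [N] by [N] matrix. *)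
Definition hcell B i : nat := (B + 4 + i)%N.
Definition kcell B N i j : nat := (B + 4 + N + (i * N + j))%N.

Definition scratch k : nexp := NAdd (NReg rB) (NCst k).
Definition haddr (e : nexp) : nexp := NAdd (NAdd (NReg rB) (NCst 4)) e.
Definition kaddr (e1 e2 : nexp) : nexp :=
  NAdd (NAdd (NAdd (NReg rB) (NCst 4)) (NReg rN))
       (NAdd (NMul e1 (NReg rN)) e2).

Definition form_exp (F : nexp -> rexp) : rexp :=
  RSub (RAdd (F (NReg ra)) (F (NReg rb))) (F (NReg rc)).

Definition column_form (e : nexp) : rexp := form_exp (fun i => RMem (kaddr i
  e)).

Definition find_pivot : prog :=
  PSeq (PN rf (NCst 0))
    (PFor rj (NReg rN)
      (PIf (eqR (column_form (NReg rj)) RZero) PSkip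
        (PSeq (PN rf (NCst 1)) (PN rp (NReg rj))))).

Definition update_column : prog :=
  PSeq (PR (scratch 3) (RDiv (column_form (NReg rj)) (column_form (NReg rp))))
    (PFor ri (NReg rN)
      (PR (kaddr (NReg ri) (NReg rj))
        (RSub (RMem (kaddr (NReg ri) (NReg rj)))
              (RMul (RMem (kaddr (NReg ri) (NReg rp))) (RMem (scratch 3)))))).

Definition update_columns : prog :=
  PFor rj (NReg rN) (PIf (eqN (NReg rj) (NReg rp)) PSkip update_column).

(** Column [p] is cleared last, as all other columns are updated from it. *)
Definition clear_column : prog :=
  PFor ri (NReg rN) (PR (kaddr (NReg ri) (NReg rp)) RZero).

Definition eliminate : prog :=
  PSeq find_pivot
    (PIf (BLeN (NCst 1) (NReg rf)) (PSeq update_columns clear_column) PSkip).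

Definition init_matrix : prog :=
  PFor ri (NReg rN) (PFor rj (NReg rN)
    (PIf (eqN (NReg ri) (NReg rj))
      (PR (kaddr (NReg ri) (NReg rj)) ROne)
      (PR (kaddr (NReg ri) (NReg rj)) RZero))).

(** The equation [z a = 0] is the form [z a + z a - z a = 0]. *)
Definition value_equations : prog :=
  PFor ra (NReg rN)
    (PIf (BAnd (BNot (eqR (RMem (haddr (NReg ra))) RZero))
               (BNot (eqR (RMem (haddr (NReg ra))) ROne)))
      PSkip
      (PSeq (PN rb (NReg ra)) (PSeq (PN rc (NReg ra)) eliminate))).

(** Since [k + l + e < 2 * m], one conditional subtraction reduces it
    modulo [m]. *)
Definition corner_registers (c : nat * nat * nat * nat) : prog :=
  let: (t1, t2, t3, e) := c in
  PSeq (PN ra (NAdd (NMul (NCst 3) (NReg rk)) (NCst t1)))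
  (PSeq (PN rb (NAdd (NMul (NCst 3) (NReg rl)) (NCst t2)))
  (PSeq (PN rz (NAdd (NAdd (NReg rk) (NReg rl)) (NCst e)))
  (PSeq (PIf (BLeN (NReg rm) (NReg rz)) (PN rz (NSub (NReg rz) (NReg rm)))
    PSkip)
        (PN rc (NAdd (NMul (NCst 3) (NReg rz)) (NCst t3)))))).

Definition corner_equation c : prog :=
  PSeq (corner_registers c)
    (PIf (eqR (form_exp (fun e => RMem (haddr e))) RZero) eliminate PSkip).

Definition corner_equations : prog :=
  PFor rk (NReg rm) (PFor rl (NReg rm)
    (foldr (fun c => PSeq (corner_equation c)) PSkip corner_types)).

Definition test_matrix : prog :=
  PSeq (PN 0%N (NCst 1))
    (PFor ri (NReg rN) (PFor rj (NReg rN)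
      (PIf (eqR (RMem (kaddr (NReg ri) (NReg rj))) RZero) PSkip
        (PN 0%N (NCst 0))))).

Lemma kcell_eq B N i j i' j' : (j < N)%N -> (j' < N)%N ->
  (kcell B N i j == kcell B N i' j') = (i == i') && (j == j').
Proof.
move=> jN j'N; rewrite eqn_add2l; apply/eqP/andP => [e|[/eqP-> /eqP->//]].
have := congr1 (fun x => x %/ N)%N e; have := congr1 (fun x => x %% N)%N e.
rewrite /= !modnMDl !divnMDl ?(leq_ltn_trans _ jN)// !modn_small//
  !divn_small//.
by rewrite !addn0 => -> ->.
Qed.

Section Specs.
Variables (R : realType) (B N : nat).
Implicit Types st s : state R.

Definition env st : Prop := nregs st rB = B /\ nregs st rN = N.

Definition matrix_at st i j : R := rmem st (kcell B N i j).

(** Linear algebra writes only to the matrix and to the scratch cell [B + 3],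
    which holds the current multiplier; what lies above the matrix is never
    read. *)
Definition same_below st st' : Prop :=
  forall a, (a < B + 4 + N)%N -> a <> (B + 3)%N -> rmem st' a = rmem st a.

Lemma same_below_trans s1 s2 s3 :
  same_below s1 s2 -> same_below s2 s3 -> same_below s1 s3.
Proof. by move=> h1 h2 a aB a3; rewrite h2// h1. Qed.

Lemma env_frame p st : rB \notin writes p -> rN \notin writes p ->
  env st -> env (meaning p st).
Proof. by move=> wB wN [eB eN]; split; rewrite meaning_frame. Qed.

Definition column_at st j : R :=
  eqform (fun i => matrix_at st i j) (nregs st ra) (nregs st rb) (nregs st rc).

Lemma reval_column st e : env st ->
  reval st (column_form e) = column_at st (neval st e).
Proof. by move=> [/= -> ->]. Qed.

Lemma find_pivot_spec st : env st ->
  let st' := meaning find_pivot st in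
  rmem st' = rmem st /\
  ((nregs st' rf = 0%N /\ forall j, (j < N)%N -> column_at st j = 0) \/
   [/\ nregs st' rf = 1%N,
     (nregs st' rp < N)%N & column_at st (nregs st' rp) != 0]).
Proof.
move=> eE; rewrite /find_pivot meaning_seq; set st1 := meaning (PN rf _) st.
pose Inv k s := rmem s = rmem st /\
  ((nregs s rf = 0%N /\ forall j, (j < k)%N -> column_at st j = 0) \/
   [/\ nregs s rf = 1%N, (nregs s rp < N)%N & column_at st (nregs s rp) != 0]).
have NE : neval st1 (NReg rN) = N by case: eE.
set st' := meaning _ st1; suff : Inv N st' by [].
rewrite -NE; apply: for_rule; [by []|by []|by split=> //; left|].
move=> k s kN sk fr [smem sfound].
have es : env s by split; rewrite fr//; case: eE.
have sd : column_at s k = column_at st k by rewrite /column_at /matrix_at smem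
  !fr.
rewrite NE in kN; rewrite meaning_if beval_eqR reval_column// [neval _ _]sk sd;
  case: eqP => [d0|/eqP d0].
  split=> //; case: sfound => [[f0 dj]|]; last by right.
  left; split=> // j; rewrite ltnS leq_eqVlt => /orP[/eqP ->//|]; exact: dj.
by split=> //; right; rewrite /= /upd /= sk.
Qed.

(** The multiplier is stored first, because it depends on entries of the column
    that the loop overwrites. *)
Lemma update_column_spec st : env st ->
  (nregs st rj < N)%N -> (nregs st rp < N)%N -> nregs st rj <> nregs st rp ->
  let st' := meaning update_column st in
  same_below st st' /\
  forall i j, (i < N)%N -> (j < N)%N -> matrix_at st' i j =
    if j == nregs st rj then
      matrix_at st i j - matrix_at st i (nregs st rp) *
        (column_at st j / column_at st (nregs st rp))
    else matrix_at st i j.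
Proof.
move=> eE; set j0 := nregs st rj; set p := nregs st rp => jN pN jp.
pose d := column_at st j0 / column_at st p.
rewrite /update_column meaning_seq; set st1 := meaning (PR _ _) st.
have e1 : env st1 by [].
have st1E a : rmem st1 a = if a == (B + 3)%N then d else rmem st a.
  rewrite rmem_PR [neval _ _]/= eE.1; case: ifP => // _.
  by rewrite reval_op !reval_column.
pose Inv k s := same_below st s /\ rmem s (B + 3)%N = d /\
  forall i j, (i < N)%N -> (j < N)%N -> matrix_at s i j =
    if (j == j0) && (i < k)%N then matrix_at st i j - matrix_at st i p * d
    else matrix_at st i j.
have NE : neval st1 (NReg rN) = N by case: eE.
set st' := meaning _ st1.
suff [sb [_ KE]] : Inv N st'.
  by split=> // i j iN jN'; rewrite KE// iN andbT; case: eqP => // ->.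
rewrite -NE; apply: for_rule; [by []|by []| |].
  split; [|split]; first by move=> a aB /eqP/negbTE a3; rewrite st1E a3.
    by rewrite st1E eqxx.
  move=> i j iN jN'; rewrite ltn0 andbF /matrix_at st1E /kcell;
    case: eqP => //; lia.
move=> k s kN sk fr [sb [sd KE]]; rewrite NE in kN.
have es : env s by split; rewrite fr//; case: eE.
have sj : nregs s rj = j0 by rewrite fr.
have sp : nregs s rp = p by rewrite fr.
have memE a : rmem (meaning (PR (kaddr (NReg ri) (NReg rj))
    (RSub (RMem (kaddr (NReg ri) (NReg rj)))
       (RMul (RMem (kaddr (NReg ri) (NReg rp))) (RMem (scratch 3))))) s) a =
    if a == kcell B N k j0 then matrix_at s k j0 - matrix_at s k p * d
    else rmem s a.
  by rewrite rmem_PR /= es.1 es.2 sk sj sp sd.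
split; [|split].
- move=> a aB a3; rewrite memE ifF ?sb//; apply/negbTE; rewrite /kcell; lia.
- by rewrite memE ifF//; apply/negbTE; rewrite /kcell; lia.
move=> i j iN jN'; rewrite {1}/matrix_at memE kcell_eq// -/(matrix_at s i j).
have [->|ik] := eqVneq i k; last first.
  by rewrite (KE i j)// ltnS (leq_eqVlt i k) (negbTE ik).
rewrite !KE//= ltnn !andbF ltnS leqnn andbT.
by have [->|] := eqVneq j j0.
Qed.

(** Keeps the rows of an equation inside the matrix. *)
Definition rows_in st : Prop :=
  [/\ (nregs st ra < N)%N, (nregs st rb < N)%N & (nregs st rc < N)%N].

Lemma update_columns_spec st : env st -> rows_in st -> (nregs st rp < N)%N ->
  let st' := meaning update_columns st in
  same_below st st' /\
  forall i j, (i < N)%N -> (j < N)%N -> matrix_at st' i j =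
    if j == nregs st rp then matrix_at st i j else
      matrix_at st i j - matrix_at st i (nregs st rp) *
        (column_at st j / column_at st (nregs st rp)).
Proof.
move=> eE [aN bN cN]; set p := nregs st rp => pN.
pose Inv k s := same_below st s /\
  forall i j, (i < N)%N -> (j < N)%N -> matrix_at s i j =
    if (j != p) && (j < k)%N then
      matrix_at st i j - matrix_at st i p * (column_at st j / column_at st p)
    else matrix_at st i j.
have NE : neval st (NReg rN) = N by case: eE.
set st' := meaning _ st; suff [sb KE] : Inv N st'.
  by split=> // i j iN jN; rewrite KE// jN andbT; case: eqP.
rewrite -NE; apply: for_rule; [by []|by []| |].
  by split=> // i j iN jN; rewrite ltn0 andbF.
move=> k s kN sk fr [sb KE]; rewrite NE in kN.
have es : env s by split; rewrite fr//; case: eE.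
have sp : nregs s rp = p by rewrite fr.
have dE j : (j < N)%N -> (j == p) || (j == k) -> column_at s j = column_at st j.
  move=> jN jpk; rewrite /column_at !fr// /eqform !KE//.
  by case/orP: jpk => /eqP ->; rewrite ?eqxx ?ltnn ?andbF.
rewrite meaning_if beval_eqN [neval _ (NReg rj)]/= [neval _ (NReg rp)]/= sk sp.
have [kp|kp] := eqVneq k p.
  split=> // i j iN jN; rewrite KE// ltnS (leq_eqVlt j).
  by have [->|] := eqVneq j k; rewrite // kp eqxx.
have jN : (nregs s rj < N)%N by rewrite sk.
have pN' : (nregs s rp < N)%N by rewrite sp.
have jp : nregs s rj <> nregs s rp by rewrite sk sp; apply/eqP.
have [sb' KE'] := update_column_spec es jN pN' jp.
split=> [|i j iN jN']; first exact: same_below_trans sb sb'.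
rewrite KE'// sk sp; have [->|jk] := eqVneq j k; last first.
  by rewrite KE// ltnS (leq_eqVlt j) (negbTE jk).
rewrite kp ltnSn !dE ?eqxx ?orbT// !KE//.
by rewrite ltnn eqxx andbF.
Qed.

Lemma clear_column_spec st : env st -> (nregs st rp < N)%N ->
  let st' := meaning clear_column st in
  same_below st st' /\
  forall i j, (i < N)%N -> (j < N)%N -> matrix_at st' i j =
    if j == nregs st rp then 0 else matrix_at st i j.
Proof.
move=> eE; set p := nregs st rp => pN.
pose Inv k s := same_below st s /\
  forall i j, (i < N)%N -> (j < N)%N -> matrix_at s i j =
    if (j == p) && (i < k)%N then 0 else matrix_at st i j.
have NE : neval st (NReg rN) = N by case: eE.
set st' := meaning _ st; suff [sb KE] : Inv N st'.
  by split=> // i j iN jN; rewrite KE// iN andbT.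
rewrite -NE; apply: for_rule; [by []|by []| |].
  by split=> // i j iN jN; rewrite ltn0 andbF.
move=> k s kN sk fr [sb KE]; rewrite NE in kN.
have es : env s by split; rewrite fr//; case: eE.
have sp : nregs s rp = p by rewrite fr.
have memE a : rmem (meaning (PR (kaddr (NReg ri) (NReg rp)) RZero) s) a =
    if a == kcell B N k p then 0 else rmem s a.
  by rewrite rmem_PR /= es.1 es.2 sk sp.
split.
  by move=> a aB a3; rewrite memE ifF ?sb//; apply/negbTE; rewrite /kcell; lia.
move=> i j iN jN; rewrite {1}/matrix_at memE kcell_eq// -/(matrix_at s i j).
have [->|ik] := eqVneq i k; last first.
  by rewrite (KE i j)// ltnS (leq_eqVlt i k) (negbTE ik).
by rewrite KE// ltnn andbF ltnS leqnn andbT.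
Qed.

Lemma eliminate_spec st : env st -> rows_in st ->
  let st' := meaning eliminate st in
  same_below st st' /\
  eliminated N (nregs st ra) (nregs st rb) (nregs st rc)
    (matrix_at st) (matrix_at st').
Proof.
move=> eE rin; rewrite /eliminate meaning_seq; set s1 := meaning find_pivot st.
have [mem1 piv] := find_pivot_spec eE; rewrite -/s1 in mem1 piv.
have e1 : env s1 by apply: env_frame.
have K1 i j : matrix_at s1 i j = matrix_at st i j by rewrite /matrix_at mem1.
have testE : beval s1 (BLeN (NCst 1) (NReg rf)) = (0 < nregs s1 rf)%N by [].
rewrite meaning_if testE; case: piv => [[-> d0]|[-> pN dp]].
  split; first by move=> a _ _; rewrite mem1.
  by left; split.
set p := nregs s1 rp in pN dp *.
have abc r : r \in [:: ra; rb; rc] -> nregs s1 r = nregs st r.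
  by rewrite !inE => /or3P[] /eqP ->; rewrite meaning_frame.
have d1 j : column_at s1 j = column_at st j by rewrite /column_at !abc//
  /eqform !K1.
have rin1 : rows_in s1 by case: rin => *; split; rewrite abc.
have [sb2 K2] := update_columns_spec e1 rin1 pN.
rewrite ltn0Sn meaning_seq; set s2 := meaning update_columns s1 in sb2 K2 *.
have e2 : env s2 by apply: env_frame.
have p2 : nregs s2 rp = p by rewrite meaning_frame.
have p2N : (nregs s2 rp < N)%N by rewrite p2.
have [sb3 K3] := clear_column_spec e2 p2N.
split; first by move=> a aB a3; rewrite sb3// sb2// mem1.
right; exists p; split=> // i j iN jN; rewrite K3// p2.
have [->|jp] := eqVneq j p; first by rewrite divff// mulr1 subrr.
by rewrite K2// -/p (negbTE jp) !K1 !d1.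
Qed.

Lemma init_matrix_spec st : env st ->
  let st' := meaning init_matrix st in
  same_below st st' /\
  forall i j, (i < N)%N -> (j < N)%N -> matrix_at st' i j = (i == j)%:R.
Proof.
move=> eE.
pose Inv k s := same_below st s /\
  forall i j, (i < k)%N -> (j < N)%N -> matrix_at s i j = (i == j)%:R.
have NE : neval st (NReg rN) = N by case: eE.
set st' := meaning _ st; suff : Inv N st' by [].
rewrite -NE; apply: for_rule; [by []|by []|by []|].
move=> k s kN sk fr [sb KE]; rewrite NE in kN.
have es : env s by split; rewrite fr//; case: eE.
pose Inv' l s' := same_below st s' /\
  (forall i j, (i < k)%N -> (j < N)%N -> matrix_at s' i j = (i == j)%:R) /\
  forall j, (j < l)%N -> matrix_at s' k j = (k == j)%:R.
have NE' : neval s (NReg rN) = N by case: es.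
set s' := meaning _ s; suff [sb' [KE1 KE2]] : Inv' N s'.
  split=> // i j; rewrite ltnS leq_eqVlt => /orP[/eqP ->|ik]; first exact: KE2.
  exact: KE1.
rewrite -NE'; apply: for_rule; [by []|by []|by []|].
move=> l t lN tl frt [tb [TE1 TE2]]; rewrite NE' in lN.
have et : env t by split; rewrite frt//; case: es.
have ti : nregs t ri = k by rewrite frt.
have memE a : rmem (meaning (PIf (eqN (NReg ri) (NReg rj))
      (PR (kaddr (NReg ri) (NReg rj)) ROne)
      (PR (kaddr (NReg ri) (NReg rj)) RZero)) t) a =
    if a == kcell B N k l then (k == l)%:R else rmem t a.
  rewrite meaning_if beval_eqN [neval _ (NReg ri)]/= [neval _ (NReg rj)]/= ti
    tl.
  by case: (k == l); rewrite rmem_PR /= et.1 et.2 ti tl.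
split; [|split].
- by move=> a aB a3; rewrite memE ifF ?tb//; apply/negbTE; rewrite /kcell; lia.
- move=> i j ik jN; rewrite {1}/matrix_at memE kcell_eq// ltn_eqF//=;
  exact: TE1.
- move=> j jl; rewrite {1}/matrix_at memE kcell_eq ?(leq_ltn_trans _ lN)// eqxx
  /=.
  have [->//|jl'] := eqVneq j l; apply: TE2; rewrite ltn_neqAle jl'; exact: jl.
Qed.

Lemma test_matrix_spec st : env st ->
  nregs (meaning test_matrix st) 0%N <> 0%N <->
  forall i j, (i < N)%N -> (j < N)%N -> matrix_at st i j = 0.
Proof.
move=> eE; rewrite /test_matrix meaning_seq; set s0 := meaning (PN _ _) st.
have e0 : env s0 by [].
pose Inv k s := rmem s = rmem st /\ (nregs s 0%N <> 0%N <->
  forall i j, (i < k)%N -> (j < N)%N -> matrix_at st i j = 0).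
have NE : neval s0 (NReg rN) = N by case: e0.
set st' := meaning _ s0; suff : Inv N st' by case.
rewrite -NE; apply: for_rule; [by []|by []|by []|].
move=> k s kN sk fr [smem sE]; rewrite NE in kN.
have es : env s by split; rewrite fr//; case: e0.
pose Inv' l s' := rmem s' = rmem st /\ (nregs s' 0%N <> 0%N <->
  (forall i j, (i < k)%N -> (j < N)%N -> matrix_at st i j = 0) /\
  forall j, (j < l)%N -> matrix_at st k j = 0).
have NE' : neval s (NReg rN) = N by case: es.
set s' := meaning _ s; suff [s'mem s'E] : Inv' N s'.
  split=> //; rewrite s'E; split=> [[H1 H2] i j|H].
    by rewrite ltnS leq_eqVlt => /orP[/eqP ->|]; [apply: H2|apply: H1].
  by split=> [i j ik|j]; apply: H => //; rewrite ltnW.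
rewrite -NE'; apply: for_rule; [by []|by []| |].
  by split=> //; rewrite sE; split=> [//|[]].
move=> l t lN tl frt [tmem tE]; rewrite NE' in lN.
have et : env t by split; rewrite frt//; case: es.
have ti : nregs t ri = k by rewrite frt.
rewrite meaning_if beval_eqR.
have -> : reval t (RMem (kaddr (NReg ri) (NReg rj))) = matrix_at st k l.
  by rewrite /matrix_at -tmem /= et.1 et.2 ti tl.
case: eqP => [K0|K0].
  split=> //; rewrite tE; split=> -[H1 H2]; split=> // j; last first.
    by move=> jl; apply: H2; rewrite ltnW.
  by rewrite ltnS leq_eqVlt => /orP[/eqP ->//|]; apply: H2.
split=> //; rewrite nregs_PN eqxx; split=> // -[_ H].
by case: K0; apply: H.
Qed.

End Specs.

(** * Solving the linear system *)

Definition solve : prog :=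
  PSeq init_matrix (PSeq value_equations (PSeq corner_equations test_matrix)).

Section Equations.
Variables (R : realType) (B m : nat) (h : nat -> R).
Implicit Types (st s : state R) (P : (nat -> R) -> Prop).
Let N := (3 * m)%N.

Definition grid_env st : Prop :=
  [/\ env B N st, nregs st rm = m &
      forall i, (i < N)%N -> rmem st (hcell B i) = h i].

Lemma same_below_h st s : same_below B N st s ->
  (forall i, (i < N)%N -> rmem st (hcell B i) = h i) ->
  forall i, (i < N)%N -> rmem s (hcell B i) = h i.
Proof. by move=> sb hE i iN; rewrite sb ?hE// /hcell; lia. Qed.

Lemma value_equations_spec st P : grid_env st ->
  spans N (matrix_at B N st) P ->
  let st' := meaning value_equations st in
  same_below B N st st' /\
  spans N (matrix_at B N st') (fun z => P z /\
    forall a, (a < N)%N -> h a = 0 \/ h a = 1 -> z a = 0).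
Proof.
move=> [eE mE hE] KP.
pose Inv k s := same_below B N st s /\
  spans N (matrix_at B N s) (fun z => P z /\
    forall a, (a < k)%N -> h a = 0 \/ h a = 1 -> z a = 0).
have NE : neval st (NReg rN) = N by case: eE.
set st' := meaning _ st; suff : Inv N st' by [].
rewrite -NE; apply: for_rule; [by []|by []| |].
  by split=> //; apply: spans_ext KP => z; split=> [|[]].
move=> k s kN sk fr [sb KE]; rewrite NE in kN.
have es : env B N s by split; rewrite fr//; case: eE.
have hk : reval s (RMem (haddr (NReg ra))) = h k.
  rewrite -(same_below_h sb hE kN) /=; by rewrite es.1 sk.
have testE : beval s (BAnd (BNot (eqR (RMem (haddr (NReg ra))) RZero))
    (BNot (eqR (RMem (haddr (NReg ra))) ROne))) = (h k != 0) && (h k != 1).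
  rewrite -[LHS]/(~~ beval s (eqR _ _) && ~~ beval s (eqR _ _)).
  by rewrite !beval_eqR hk.
rewrite meaning_if testE -negb_or; case: ifP => [|/negbFE] test.
  split=> //; apply: spans_ext KE => z; split=> -[Pz zE]; split=> // a ak.
    move: ak; rewrite ltnS leq_eqVlt => /orP[/eqP ->|]; last exact: zE.
    by case=> hk'; rewrite hk' eqxx ?orbT in test.
  by apply: zE; rewrite ltnW.
rewrite !meaning_seq; set s1 := meaning (PN rc _) _.
have e1 : env B N s1 by [].
have [ak bk ck] : [/\ nregs s1 ra = k, nregs s1 rb = k & nregs s1 rc = k].
  by rewrite -sk.
have rin : rows_in N s1 by split; rewrite ?ak ?bk ?ck.
have [sb1 el] := eliminate_spec e1 rin; rewrite ak bk ck in el.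
split; first by apply: same_below_trans sb _.
apply: spans_ext (spans_eliminated kN kN kN KE el) => z.
rewrite /eqform addrK; split=> [[[Pz zE] zk]|[Pz zE]].
  split=> // a; rewrite ltnS leq_eqVlt => /orP[/eqP -> //|]; exact: zE.
split; last by apply: zE => //; case/orP: test => /eqP; [left|right].
by split=> // a ak'; apply: zE; rewrite ltnW.
Qed.

Lemma corner_registers_spec s k l c :
  nregs s rk = k -> nregs s rl = l -> nregs s rm = m ->
  (k < m)%N -> (l < m)%N -> c \in corner_types ->
  let: (t1, t2, t3, e) := c in
  let s' := meaning (corner_registers c) s in
  [/\ rmem s' = rmem s, nregs s' ra = (3 * k + t1)%N,
    nregs s' rb = (3 * l + t2)%N,
      nregs s' rc = (3 * ((k + l + e) %% m) + t3)%N & rows_in N s'].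
Proof.
move=> sk sl sm km lm.
have main t1 t2 t3 e : (t1 < 3)%N -> (t2 < 3)%N -> (t3 < 3)%N -> (e <= 1)%N ->
    let s' := meaning (corner_registers (t1, t2, t3, e)) s in
    [/\ rmem s' = rmem s, nregs s' ra = (3 * k + t1)%N,
        nregs s' rb = (3 * l + t2)%N,
        nregs s' rc = (3 * ((k + l + e) %% m) + t3)%N & rows_in N s'].
  move=> t1s t2s t3s e1 s'.
  have aE : nregs s' ra = (3 * k + t1)%N.
    rewrite /s' /corner_registers meaning_seq meaning_frame//.
    by rewrite nregs_PN eqxx -sk.
  have bE : nregs s' rb = (3 * l + t2)%N.
    rewrite /s' /corner_registers !meaning_seq meaning_frame// meaning_frame//.
    by rewrite meaning_frame// nregs_PN eqxx -sl.
  have cE : nregs s' rc = (3 * ((k + l + e) %% m) + t3)%N.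
    rewrite /s' /corner_registers !meaning_seq.
    set u := meaning (PN rz _) _; set w := meaning (PIf _ _ _) u.
    have uz : nregs u rz = (k + l + e)%N by rewrite /u nregs_PN eqxx -sk -sl.
    have um : nregs u rm = m by rewrite -sm.
    have wz : nregs w rz = ((k + l + e) %% m)%N.
      rewrite /w meaning_if.
      have -> : beval u (BLeN (NReg rm) (NReg rz)) = (m <= k + l + e)%N.
        by rewrite -um -uz.
      case: leqP => klm; last by rewrite uz modn_small.
      rewrite nregs_PN eqxx.
      have -> : neval u (NSub (NReg rz) (NReg rm)) = (k + l + e - m)%N.
        by rewrite -um -uz.
      by rewrite -[in RHS](subnK klm) modnDr modn_small//; lia.
    by rewrite nregs_PN eqxx -wz.
  split=> //; first by rewrite /s' /= /upd /=; case: ifP.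
  have mod_lt : ((k + l + e) %% m < m)%N by rewrite ltn_mod (leq_trans _ km).
  by split; rewrite ?aE ?bE ?cE /N; lia.
case: c => [[[t1 t2] t3] e] cc; apply: main; by move: cc; rewrite !inE;
  do 7?[case/orP]; move=> /eqP [? ? ? ?]; subst.
Qed.

Lemma corner_equation_spec s k l c P : grid_env s ->
  nregs s rk = k -> nregs s rl = l -> (k < m)%N -> (l < m)%N ->
  c \in corner_types -> spans N (matrix_at B N s) P ->
  let s' := meaning (corner_equation c) s in
  same_below B N s s' /\
  spans N (matrix_at B N s') (fun z => P z /\
    (defect m h k l c = 0 -> defect m z k l c = 0)).
Proof.
move=> [eE mE hE] sk sl km lm cc KP; rewrite /corner_equation meaning_seq.
have := corner_registers_spec sk sl mE km lm cc.
case: c cc => [[[t1 t2] t3] e] cc;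
  set s1 := meaning _ s => -[mem1 aE bE cE rin].
have e1 : env B N s1 by apply: env_frame.
have K1 i j : matrix_at B N s1 i j = matrix_at B N s i j.
  by rewrite /matrix_at mem1.
have defE : reval s1 (form_exp (fun e => RMem (haddr e))) =
    defect m h k l (t1, t2, t3, e).
  have hE1 r : (nregs s1 r < N)%N -> reval s1 (RMem (haddr (NReg r))) = h
    (nregs s1 r).
    by move=> rN'; rewrite -hE// -mem1 /hcell -e1.1.
  by rewrite /form_exp !reval_op; case: rin => *; rewrite !hE1// aE bE cE.
rewrite meaning_if beval_eqR defE; case: eqP => d0; last first.
  split; first by move=> a _ _; rewrite mem1.
  have KP1 : spans N (matrix_at B N s1) P by rewrite (_ : matrix_at B N s1 =
    matrix_at B N s)// /matrix_at mem1.
  by apply: spans_ext KP1 => z; split=> [|[]].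
have [sb el] := eliminate_spec e1 rin.
split; first by move=> a aB a3; rewrite sb// mem1.
have KP1 : spans N (matrix_at B N s1) P by rewrite (_ : matrix_at B N s1 =
  matrix_at B N s)// /matrix_at mem1.
case: rin => aN bN cN.
apply: spans_ext (spans_eliminated aN bN cN KP1 el) => z; rewrite aE bE cE.
by split=> -[Pz dz]; split=> //; apply: dz.
Qed.

Lemma corner_list_spec s k l cs P : grid_env s ->
  nregs s rk = k -> nregs s rl = l -> (k < m)%N -> (l < m)%N ->
  {subset cs <= corner_types} -> spans N (matrix_at B N s) P ->
  let s' := meaning (foldr (fun c => PSeq (corner_equation c)) PSkip cs) s in
  same_below B N s s' /\
  spans N (matrix_at B N s') (fun z => P z /\
    forall c, c \in cs -> defect m h k l c = 0 -> defect m z k l c = 0).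
Proof.
elim: cs s P => [|c cs IH] s P gE sk sl km lm cc KP.
  by split=> //=; apply: spans_ext KP => z; split=> [|[]].
have ccs : {subset cs <= corner_types}.
  by move=> d dcs; apply: cc; rewrite inE dcs orbT.
have c0 : c \in corner_types by apply: cc; rewrite mem_head.
rewrite [foldr _ _ _]/= meaning_seq.
have [sb1 KP1] := corner_equation_spec gE sk sl km lm c0 KP.
set s1 := meaning _ s in sb1 KP1 *.
have fr r : r \in [:: rB; rN; rm; rk; rl] -> nregs s1 r = nregs s r.
  rewrite !inE /s1; case: c {cc c0 sb1 KP1 s1} => [[[? ?] ?] ?].
  by do 4?[case/orP]; move=> /eqP ->; rewrite meaning_frame.
have g1 : grid_env s1.
  case: gE => -[eB eN] mE hE; split; first by split; rewrite fr.
    by rewrite fr.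
  exact: same_below_h sb1 hE.
have [||sb2 KP2] := IH s1 _ g1 _ _ km lm ccs KP1; rewrite ?fr//.
split; first exact: same_below_trans sb1 sb2.
apply: spans_ext KP2 => z; split=> [[[Pz dc] dcs]|[Pz dz]].
  by split=> // d; rewrite inE => /orP[/eqP ->//|]; apply: dcs.
split; first by split=> //; apply: dz; rewrite mem_head.
by move=> d dcs; apply: dz; rewrite inE dcs orbT.
Qed.

Lemma corner_equations_spec st P : grid_env st ->
  spans N (matrix_at B N st) P ->
  let st' := meaning corner_equations st in
  same_below B N st st' /\
  spans N (matrix_at B N st') (fun z => P z /\
    forall k l c, (k < m)%N -> (l < m)%N -> c \in corner_types ->
      defect m h k l c = 0 -> defect m z k l c = 0).
Proof.
move=> [eE mE hE] KP.
pose Inv k s := same_below B N st s /\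
  spans N (matrix_at B N s) (fun z => P z /\
    forall k' l c, (k' < k)%N -> (l < m)%N -> c \in corner_types ->
      defect m h k' l c = 0 -> defect m z k' l c = 0).
set st' := meaning _ st; suff : Inv m st' by [].
rewrite -[X in Inv X]mE; apply: (for_rule (e := NReg rm)); [by []|by []| |].
  by split=> //; apply: spans_ext KP => z; split=> [|[]].
move=> k s km sk fr [sb KE]; rewrite [neval _ _]mE in km.
have sm : nregs s rm = m by rewrite fr.
pose Inv' l s' := same_below B N st s' /\
  spans N (matrix_at B N s') (fun z => (P z /\
    forall k' l c, (k' < k)%N -> (l < m)%N -> c \in corner_types ->
      defect m h k' l c = 0 -> defect m z k' l c = 0) /\
    forall l' c, (l' < l)%N -> c \in corner_types ->
      defect m h k l' c = 0 -> defect m z k l' c = 0).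
set s' := meaning _ s; suff [sb' KE'] : Inv' m s'.
  split=> //; apply: spans_ext KE' => z; split=> [[[Pz z1] z2]|[Pz z1]].
    split=> // k' l c; rewrite ltnS leq_eqVlt => /orP[/eqP ->|];
      [exact: z2|exact: z1].
  split; first by split=> // k' l c k'k; apply: z1; rewrite ltnW.
  by move=> l c lm; apply: z1.
rewrite -[X in Inv' X]sm; apply: (for_rule (e := NReg rm)); [by []|by []| |].
  by split=> //; apply: spans_ext KE => z; split=> [|[]].
move=> l t lm tl frt [tb TE]; rewrite [neval _ _]sm in lm.
have gt : grid_env t.
  split; last exact: same_below_h tb hE.
    by split; rewrite frt// fr//; case: eE.
  by rewrite frt.
have tk : nregs t rk = k by rewrite frt.
have [tb' TE'] := corner_list_spec gt tk tl km lm (fun _ => id) TE.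
split; first exact: same_below_trans tb tb'.
apply: spans_ext TE' => z; split=> [[[Pz z1] z2]|[Pz z1]].
  split=> // l' c; rewrite ltnS leq_eqVlt => /orP[/eqP -> cc|];
    [exact: z2|exact: z1].
split; first by split=> // l' c l'l; apply: z1; rewrite ltnW.
by move=> c cc; apply: z1.
Qed.

Lemma solve_spec st : grid_env st ->
  nregs (meaning solve st) 0%N <> 0%N <->
  forall z, tight_system m h z ->
    forall k t, (k < m)%N -> (t < 3)%N -> z (3 * k + t)%N = 0.
Proof.
move=> [eE mE hE]; rewrite /solve !meaning_seq.
have [sb1 /spans_id K1] := init_matrix_spec eE.
set s1 := meaning init_matrix st in sb1 K1 *.
have e1 : env B N s1 by apply: env_frame.
have m1 : nregs s1 rm = m by rewrite meaning_frame.
have h1 := same_below_h sb1 hE.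
have [sb2 K2] := value_equations_spec (And3 e1 m1 h1) K1.
set s2 := meaning value_equations s1 in sb2 K2 *.
have e2 : env B N s2 by apply: env_frame.
have m2 : nregs s2 rm = m by rewrite meaning_frame.
have h2 := same_below_h sb2 h1.
have [sb3 K3] := corner_equations_spec (And3 e2 m2 h2) K2.
set s3 := meaning corner_equations s2 in sb3 K3 *.
have e3 : env B N s3 by apply: env_frame.
rewrite (test_matrix_spec e3) (spans_trivial K3).
have idx i : (i < N)%N -> exists k t, [/\ (k < m)%N,
  (t < 3)%N & i = (3 * k + t)%N].
  move=> iN; exists (i %/ 3)%N, (i %% 3)%N; split;
    last by rewrite mulnC -divn_eq.
    by rewrite ltn_divLR// mulnC.
  by rewrite ltn_mod.
split=> [H z [z1 z2] k t km t3|H z [[_ z1] z2] i iN].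
  apply: H; last by rewrite /N; lia.
  split; last exact: z2.
  by split=> // a /idx[k' [t' [k'm t'3 ->]]]; apply: z1.
have [k [t [km t3 ->]]] := idx i iN.
apply: H => //; split=> [k' t' k'm t'3|//]; apply: z1; rewrite /N; lia.
Qed.

End Equations.

Local Notation rbad := 16%N (only parsing).
Local Notation rhit := 17%N (only parsing).

(** * Reading the input *)

Definition input_x k : rexp := RMem (NAdd (NCst k) (NReg ri)).
Definition input_coef k : rexp :=
  RMem (NAdd (NAdd (NMul (NCst k) (NReg rn)) (NCst 2)) (NReg ri)).

Definition setup : prog :=
  PSeq (PN rn (NReg 0))
    (PSeq (PN rB (NAdd (NMul (NCst 4) (NReg rn)) (NCst 2))) (PN rbad (NCst 1))).

Definition next_candidate : prog :=
  PSeq (PN rq (NAdd (NReg rq) (NCst 1)))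
    (PSeq (PN rbad (NCst 0))
      (PR (scratch 0) (RAdd (RMem (scratch 0)) ROne))).

(** Scratch cell 0 holds the candidate denominator as a real number and cell 1
    counts 0, 1, 2 and so on: as the breakpoints lie in [0, 1], a multiple of
    one by the candidate is an integer iff it is met while counting up to the
    candidate. *)
Definition check_multiples : prog :=
  PFor rj (NAdd (NReg rq) (NCst 1))
    (PSeq
      (PIf (eqR (RMem (scratch 1)) (RMul (RMem (scratch 0)) (input_x 1)))
        (PN rhit (NCst 1)) PSkip)
      (PR (scratch 1) (RAdd (RMem (scratch 1)) ROne))).

Definition check_candidate : prog :=
  PFor ri (NAdd (NReg rn) (NCst 1))
    (PSeq (PN rhit (NCst 0)) (PSeq (PR (scratch 1) RZero)
      (PSeq check_multiples
        (PIf (BLeN (NReg rhit) (NCst 0)) (PN rbad (NCst 1)) PSkip)))).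

Definition search : cmd :=
  While (BLeN (NCst 1) (NReg rbad))
    (Seq (compile next_candidate) (compile check_candidate)).

Definition grid_setup : prog :=
  PSeq (PN rm (NMul (NCst 3) (NReg rq)))
    (PSeq (PN rN (NMul (NCst 3) (NReg rm)))
      (PSeq (PR (scratch 1) (RDiv ROne (RAdd (RMem (scratch 0))
                (RAdd (RMem (scratch 0)) (RMem (scratch 0))))))
        (PR (scratch 2) RZero))).

Definition line (u : rexp) : rexp := RAdd (RMul (input_coef 2) u) (input_coef
  3).

Definition entry t : nexp := haddr (NAdd (NMul (NCst 3) (NReg rk)) (NCst t)).

(** Scratch cell 1 holds the step of the grid and cell 2 the current grid
    point. *)
Definition fill_interval : prog :=
  PFor ri (NReg rn)
    (PIf (BAnd (BLeR (input_x 1) (RMem (scratch 2)))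
               (BNot (BLeR (input_x 2) (RMem (scratch 2)))))
      (PSeq (PIf (eqR (input_x 1) (RMem (scratch 2)))
               (PR (entry 0) (input_coef 1))
               (PR (entry 0) (line (RMem (scratch 2)))))
      (PSeq (PR (entry 1) (line (RMem (scratch 2))))
            (PR (entry 2) (line (RAdd (RMem (scratch 2)) (RMem (scratch 1)))))))
      PSkip).

Definition fill : prog :=
  PFor rk (NReg rm)
    (PSeq fill_interval
      (PR (scratch 2) (RAdd (RMem (scratch 2)) (RMem (scratch 1))))).

Definition decide_extreme : cmd :=
  Seq (compile setup)
    (Seq search (Seq (compile grid_setup) (compile (PSeq fill solve)))).

Section ReadingSpecs.
Variables (R : realType) (n : nat).
Implicit Types (st s : state R).
Let B := (4 * n + 2)%N.

Lemma check_multiples_spec st : nregs st rB = B -> (nregs st ri <= n)%N ->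
  rmem st (B + 1)%N = 0 -> nregs st rhit = 0%N ->
  let st' := meaning check_multiples st in
  (forall a, a <> (B + 1)%N -> rmem st' a = rmem st a) /\
  (nregs st' rhit <> 0%N <-> exists2 k, (k <= nregs st rq)%N &
     k%:R = rmem st B * rmem st (1 + nregs st ri)%N).
Proof.
move=> eB iN z0 hit0.
pose Inv k s := [/\ forall a, a <> (B + 1)%N -> rmem s a = rmem st a,
  rmem s (B + 1)%N = k%:R &
  (nregs s rhit <> 0%N <-> exists2 j, (j < k)%N &
     j%:R = rmem st B * rmem st (1 + nregs st ri)%N)].
set st' := meaning _ st.
have qE : neval st (NAdd (NReg rq) (NCst 1)) = (nregs st rq).+1.
  exact: addn1.
suff [m0 _ hE] : Inv (nregs st rq).+1 st'.
  by split=> //; rewrite hE; split=> -[k kq kE]; exists k.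
rewrite -qE; apply: for_rule; [by []|by []| |].
  by split=> //; rewrite hit0; split=> [//|[]].
move=> k s _ sk fr [sm sc sh].
have sB : nregs s rB = B by rewrite fr.
have si : nregs s ri = nregs st ri by rewrite fr.
rewrite meaning_seq; set s1 := meaning (PIf _ _ _) s.
have testE : beval s (eqR (RMem (scratch 1)) (RMul (RMem (scratch 0)) (input_x
  1))) =
    (k%:R == rmem st B * rmem st (1 + nregs st ri)%N).
  rewrite beval_eqR /= sB si sc addn0 !sm//; rewrite /B; lia.
have mem1 : rmem s1 = rmem s by rewrite /s1 meaning_if; case: ifP.
have sB1 : nregs s1 rB = B by rewrite /s1 meaning_frame.
split.
- move=> a aB; rewrite rmem_PR [neval _ _]/= sB1.
  by move/eqP: (aB) => /negbTE ->; rewrite mem1 sm.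
- rewrite rmem_PR [neval _ _]/= sB1 eqxx reval_op.
  by rewrite -natr1 -sc -mem1 /= sB1.
- rewrite -[nregs _ rhit]/(nregs s1 rhit) /s1 meaning_if testE.
  case: eqP => kE; first by split=> // _; exists k.
  rewrite sh; split=> -[j jk jE]; exists j => //; first by rewrite ltnW.
  by move: jk; rewrite ltnS leq_eqVlt => /orP[/eqP jk|//]; rewrite -jk jE in kE.
Qed.

Lemma check_candidate_spec st : nregs st rB = B -> nregs st rn = n ->
  let st' := meaning check_candidate st in
  (forall a, a <> (B + 1)%N -> rmem st' a = rmem st a) /\
  (nregs st' rbad <> 0%N <-> nregs st rbad <> 0%N \/
   exists2 i, (i <= n)%N & ~ exists2 k, (k <= nregs st rq)%N &
     k%:R = rmem st B * rmem st (1 + i)%N).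
Proof.
move=> eB en.
pose hits i := exists2 k,
  (k <= nregs st rq)%N & k%:R = rmem st B * rmem st (1 + i)%N.
pose Inv k s := (forall a, a <> (B + 1)%N -> rmem s a = rmem st a) /\
  (nregs s rbad <> 0%N <-> nregs st rbad <> 0%N \/
   exists2 i, (i < k)%N & ~ hits i).
set st' := meaning _ st.
have nE : neval st (NAdd (NReg rn) (NCst 1)) = n.+1.
  by rewrite -en; apply: addn1.
suff [sm sb] : Inv n.+1 st'.
  by split.
rewrite -nE; apply: for_rule; [by []|by []| |].
  by split=> //; split=> [?|[//|[]//]]; left.
move=> i s iN si fr [sm sb]; rewrite nE ltnS in iN.
rewrite !meaning_seq; set s1 := meaning (PR _ _) _.
have sB : nregs s rB = B by rewrite fr.
have B1 : nregs s1 rB = B by rewrite -sB.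
have i1 : nregs s1 ri = i by rewrite -si.
have mem1 a : rmem s1 a = if a == (B + 1)%N then 0 else rmem s a.
  by rewrite rmem_PR -sB.
have iN1 : (nregs s1 ri <= n)%N by rewrite i1.
have c1 : rmem s1 (B + 1)%N = 0 by rewrite mem1 eqxx.
have h1 : nregs s1 rhit = 0%N by [].
have [s2m s2h] := check_multiples_spec B1 iN1 c1 h1.
set s2 := meaning check_multiples s1 in s2m s2h *.
have {}s2m a : a <> (B + 1)%N -> rmem s2 a = rmem st a.
  by move=> aB; rewrite s2m// mem1; move/eqP: (aB) => /negbTE ->; exact: sm.
have {}s2h : nregs s2 rhit <> 0%N <-> hits i.
  rewrite s2h i1 !mem1 !ifF ?sm//; try by apply/negbTE; rewrite /B; lia.
  - by have -> : nregs s1 rq = nregs st rq by rewrite -[LHS]/(nregs s rq) fr.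
  - by rewrite /B; lia.
  - by rewrite /B; lia.
have s2b : nregs s2 rbad = nregs s rbad.
  by rewrite meaning_frame.
rewrite meaning_if.
have -> : beval s2 (BLeN (NReg rhit) (NCst 0)) = (nregs s2 rhit == 0%N).
  by rewrite -leqn0.
case: eqP => hit.
  split; first by move=> a aB; exact: s2m.
  rewrite nregs_PN eqxx; split=> // _; right; exists i => // /s2h.
  by rewrite hit.
split=> [//|]; rewrite s2b sb; split=> -[]; try by left.
  by case=> j ji nh; right; exists j => //; rewrite ltnW.
case=> j; rewrite ltnS leq_eqVlt => /orP[/eqP ->|ji] nh; last by right;
  exists j.
by case: nh; apply/s2h.
Qed.

Variables (m : nat) (X : nat -> R) (delta : R) (idx : nat -> nat).
Let N := (3 * m)%N.

Definition pos k : R := k%:R * delta.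
Definition line_at i (u : R) : R :=
  X (2 * n + 2 + i)%N * u + X (3 * n + 2 + i)%N.

(** The contents of [h] for interval [k], which lies in the input's interval
    number [idx k]. *)
Definition grid_value k t : R :=
  if t == 0%N then
    if X (1 + idx k)%N == pos k then X (1 * n + 2 + idx k)%N
    else line_at (idx k) (pos k)
  else if t == 1%N then line_at (idx k) (pos k)
  else line_at (idx k) (pos k + delta).

Definition fill_env st : Prop :=
  [/\ env B N st, nregs st rn = n, rmem st (B + 1)%N = delta
    & forall a, (a < B)%N -> rmem st a = X a].

Hypothesis idxP : forall k, (k < m)%N -> (idx k < n)%N /\
  forall i, (i < n)%N ->
    (X (1 + i)%N <= pos k) && ~~ (X (2 + i)%N <= pos k) = (i == idx k).

Lemma fill_interval_spec st k : fill_env st -> nregs st rk = k -> (k < m)%N ->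
  rmem st (B + 2)%N = pos k ->
  let st' := meaning fill_interval st in
  (forall a, (a < B + 4 + 3 * k)%N -> rmem st' a = rmem st a) /\
  forall t, (t < 3)%N -> rmem st' (hcell B (3 * k + t)) = grid_value k t.
Proof.
move=> [[eB eN] en ed eX] stk km sp; have [idxn idxE] := idxP km.
pose Inv i s := (forall a, (a < B + 4 + 3 * k)%N -> rmem s a = rmem st a) /\
  ((idx k < i)%N ->
   forall t, (t < 3)%N -> rmem s (hcell B (3 * k + t)) = grid_value k t).
have NE : neval st (NReg rn) = n by [].
set st' := meaning _ st; suff [sm sg] : Inv n st' by split=> //; apply: sg.
rewrite -NE; apply: for_rule; [by []|by []|by []|].
move=> i s iN si fr [sm sg]; rewrite NE in iN.
have sB : nregs s rB = B by rewrite fr.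
have sn : nregs s rn = n by rewrite fr.
have sk : nregs s rk = k by rewrite fr.
have xE s1 c : nregs s1 = nregs s ->
    (forall a, (a < B + 4 + 3 * k)%N -> rmem s1 a = rmem s a) -> (c <= 2)%N ->
    reval s1 (input_x c) = X (c + i)%N.
  move=> rE mE c2; rewrite /= rE si mE ?sm ?eX// /B; lia.
have cE s1 c : nregs s1 = nregs s ->
    (forall a, (a < B + 4 + 3 * k)%N -> rmem s1 a = rmem s a) -> (c <= 3)%N ->
    reval s1 (input_coef c) = X (c * n + 2 + i)%N.
  move=> rE mE c3; have cn : (c * n <= 3 * n)%N by rewrite leq_mul2r c3 orbT.
  by rewrite /= rE si sn mE ?sm ?eX// /B; lia.
have lE s1 e u : nregs s1 = nregs s ->
    (forall a, (a < B + 4 + 3 * k)%N -> rmem s1 a = rmem s a) ->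
    reval s1 e = u -> reval s1 (line e) = line_at i u.
  by move=> rE mE uE; rewrite /line !reval_op !cE// uE.
have pE s1 : nregs s1 = nregs s ->
    (forall a, (a < B + 4 + 3 * k)%N -> rmem s1 a = rmem s a) ->
    reval s1 (RMem (scratch 2)) = pos k.
  by move=> rE mE; rewrite /= rE sB mE ?sm ?sp//; lia.
have dE s1 : nregs s1 = nregs s ->
    (forall a, (a < B + 4 + 3 * k)%N -> rmem s1 a = rmem s a) ->
    reval s1 (RMem (scratch 1)) = delta.
  by move=> rE mE; rewrite /= rE sB mE ?sm ?ed//; lia.
have aE s1 t : nregs s1 = nregs s -> neval s1 (entry t) = hcell B (3 * k + t).
  by move=> rE; rewrite /= rE sB sk.
have testE : beval s (BAnd (BLeR (input_x 1) (RMem (scratch 2)))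
               (BNot (BLeR (input_x 2) (RMem (scratch 2))))) = (i == idx k).
  rewrite -idxE//.
  rewrite -[LHS]/((reval s (input_x 1) <= reval s (RMem (scratch 2))) &&
    ~~ (reval s (input_x 2) <= reval s (RMem (scratch 2)))).
  by rewrite !xE// pE.
rewrite meaning_if testE; case: eqP => [ik|ik]; last first.
  split=> //; rewrite ltnS leq_eqVlt => /orP[/eqP ik'|]; last exact: sg.
  by case: ik.
rewrite !meaning_seq; set s1 := meaning (PIf _ _ _) s.
have r1 : nregs s1 = nregs s by rewrite /s1 meaning_if; case: ifP.
have m1 a : rmem s1 a = if a == hcell B (3 * k + 0) then grid_value k 0 else
  rmem s a.
  rewrite /s1 meaning_if beval_eqR xE// pE// /grid_value eqxx -ik.
  by case: ifP => _; rewrite rmem_PR aE// ?cE// (lE _ _ (pos k))// pE.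
have l1 a : (a < B + 4 + 3 * k)%N -> rmem s1 a = rmem s a.
  by move=> aB; rewrite m1 ifF//; apply/negbTE; rewrite /hcell; lia.
set s2 := meaning (PR (entry 1) _) s1.
have r2 : nregs s2 = nregs s by [].
have m2 a : rmem s2 a = if a == hcell B (3 * k + 1) then grid_value k 1 else
  rmem s1 a.
  by rewrite /s2 rmem_PR aE// (lE _ _ (pos k))// ?pE// /grid_value /= -ik.
have l2 a : (a < B + 4 + 3 * k)%N -> rmem s2 a = rmem s a.
  by move=> aB; rewrite m2 ifF ?l1//; apply/negbTE; rewrite /hcell; lia.
have m3 a : rmem (meaning (PR (entry 2)
      (line (RAdd (RMem (scratch 2)) (RMem (scratch 1))))) s2) a =
    if a == hcell B (3 * k + 2) then grid_value k 2 else rmem s2 a.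
  rewrite rmem_PR aE// (lE _ _ (pos k + delta))//;
    last by rewrite reval_op pE// dE.
  by rewrite /grid_value /= -ik.
split=> [a aB|_ t t3]; first by rewrite m3 ifF ?l2 ?sm//; apply/negbTE;
  rewrite /hcell; lia.
rewrite m3 m2 m1 /hcell !eqn_add2l.
by case: t t3 => [|[|[|]]].
Qed.

Lemma fill_spec st : fill_env st -> nregs st rm = m ->
  rmem st (B + 2)%N = 0 ->
  let st' := meaning fill st in
  forall k t, (k < m)%N -> (t < 3)%N ->
    rmem st' (hcell B (3 * k + t)) = grid_value k t.
Proof.
move=> [[eB eN] en ed eX] em p0.
pose Inv k s := [/\ rmem s (B + 1)%N = delta, rmem s (B + 2)%N = pos k,
  forall a, (a < B)%N -> rmem s a = X a &
  forall k' t, (k' < k)%N -> (t < 3)%N ->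
    rmem s (hcell B (3 * k' + t)) = grid_value k' t].
have mE : neval st (NReg rm) = m by [].
set st' := meaning _ st; suff [] : Inv m st' by [].
rewrite -mE; apply: for_rule; [by []|by []| |].
  by split=> //; rewrite p0 /pos mul0r.
move=> k s kN sk fr [sd sp sX sh]; rewrite mE in kN.
have es : fill_env s by split=> //; [split|]; rewrite fr.
have [fm fh] := fill_interval_spec es sk kN sp.
rewrite meaning_seq; set s1 := meaning fill_interval s in fm fh *.
have sB : nregs s rB = B by rewrite fr.
have s1B : nregs s1 rB = B by rewrite meaning_frame.
have m2 a : rmem (meaning (PR (scratch 2)
      (RAdd (RMem (scratch 2)) (RMem (scratch 1)))) s1) a =
    if a == (B + 2)%N then pos k + delta else rmem s1 a.
  have sc c : neval s1 (scratch c) = (B + c)%N by rewrite -s1B.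
  have rc' c : reval s1 (RMem (scratch c)) = rmem s1 (B + c)%N by rewrite -sc.
  by rewrite rmem_PR reval_op !rc' sc (fm (B + 2)%N) ?(fm (B + 1)%N) ?sp ?sd//;
    lia.
split.
- by rewrite m2 ifF ?fm//; [lia|apply/negbTE; lia].
- by rewrite m2 eqxx /pos -natr1 mulrDl mul1r.
- by move=> a aB; rewrite m2 ifF ?fm ?sX//; [lia|apply/negbTE; lia].
move=> k' t; rewrite m2 ifF; last by apply/negbTE; rewrite /hcell; lia.
rewrite ltnS leq_eqVlt => /orP[/eqP -> |k'k t3]; first exact: fh.
rewrite fm ?sh// /hcell; lia.
Qed.

End ReadingSpecs.

(** * The algorithm *)

Section Glue.
Variables (R : realType) (f : R) (n : nat).
Variables (x : n.+1.-tuple R) (v a b : n.-tuple R).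
Variables (pi : R -> R) (q : nat).
Hypotheses (plin : piecewise_linear x v a b pi).
Hypothesis (lcd : least_common_denominator x q).
Let X k := (encode f x v a b)`_k.
Let B := (4 * n + 2)%N.

Let x_lt i : (i < n)%N -> x`_i < x`_i.+1.
Proof. by case: plin => _ _ + _ _; apply. Qed.
Let x_0 : x`_0 = 0. Proof. by case: plin. Qed.
Let x_n : x`_n = 1. Proof. by case: plin. Qed.
Let q0 : (0 < q)%N. Proof. by case: lcd => -[]. Qed.

Lemma input_size : size (encode f x v a b) = B.
Proof. by rewrite /= !size_cat !size_tuple /B; lia. Qed.

Lemma input_x_at i : (i <= n)%N -> X (1 + i)%N = x`_i.
Proof. by move=> iN; rewrite /X /encode /= nth_cat size_tuple ltnS iN. Qed.

Lemma input_coef_at i : (i < n)%N ->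
  [/\ X (1 * n + 2 + i)%N = v`_i, X (2 * n + 2 + i)%N = a`_i
    & X (3 * n + 2 + i)%N = b`_i].
Proof.
move=> iN; rewrite /X /encode.
have -> : (1 * n + 2 + i = (n.+1 + i).+1)%N by lia.
have -> : (2 * n + 2 + i = (n.+1 + (n + i)).+1)%N by lia.
have -> : (3 * n + 2 + i = (n.+1 + (n + (n + i))).+1)%N by lia.
by split; rewrite /= !nth_cat !size_tuple ?(ltnNge _ n.+1) ?leq_addr /= ?addKn
  ?iN ?(ltnNge (n + _) n) ?leq_addr /= ?addKn ?iN ?(ltnNge (n + _) n) ?leq_addr
    /= ?addKn.
Qed.

Lemma breakpoints_le i j : (i <= j)%N -> (j <= n)%N -> x`_i <= x`_j.
Proof.
elim: j => [|j IH]; first by rewrite leqn0 => /eqP ->.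
rewrite leq_eqVlt => /orP[/eqP ->//|ij jn].
exact: le_trans (IH ij (ltnW jn)) (ltW (x_lt jn)).
Qed.

Lemma breakpoint_interval u : 0 <= u < 1 ->
  exists i, [/\ (i < n)%N, x`_i <= u & u < x`_i.+1].
Proof.
move=> /andP[u0 u1].
have H j : (j <= n)%N -> (exists i, [/\ (i < n)%N,
  x`_i <= u & u < x`_i.+1]) \/ x`_j <= u.
  elim: j => [|j IH] jn; first by right; rewrite x_0.
  have [|xj] := IH (ltnW jn); first by left.
  by have [?|lt] := leP x`_j.+1 u; [right|left; exists j].
by have [//|] := H n (leqnn n); rewrite x_n leNgt u1.
Qed.

(** Each cell of a grid that refines the multiples of [1 / q] lies inside one
    of the given intervals. *)
Lemma grid_interval c k : (0 < c)%N -> (k < c * q)%N ->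
  exists i, [/\ (i < n)%N, x`_i <= k%:R / (c * q)%:R
              & k.+1%:R / (c * q)%:R <= x`_i.+1].
Proof.
move=> c0 kcq; have cq0 : 0 < (c * q)%:R :> R by rewrite ltr0n muln_gt0 c0.
have u01 : 0 <= (k%:R / (c * q)%:R : R) < 1.
  by rewrite divr_ge0 ?ler0n//= ltr_pdivrMr// mul1r ltr_nat.
have [i [iN xi iu]] := breakpoint_interval u01.
exists i; split=> //; rewrite ler_pdivrMr//.
have xin : x`_i.+1 \in x by apply: mem_nth; rewrite size_tuple.
have [[_ /(_ _ xin) /intrP[z zE]] _] := lcd.
have E : x`_i.+1 * (c * q)%:R = (Posz c * z)%:~R.
  by rewrite natrM intrM -zE -pmulrn; ring.
move: iu; rewrite ltr_pdivrMr// E !pmulrn ltr_int ler_int; lia.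
Qed.

(** The numbers [q * x_i] are distinct integers from 0 to [q]. *)
Lemma breakpoints_at_most : (n <= q)%N.
Proof.
have H i : (i <= n)%N -> i%:R <= q%:R * x`_i.
  elim: i => [|i IH] iN; first by rewrite x_0 mulr0.
  have [[_ qx] _] := lcd.
  have xin j : (j <= n)%N -> x`_j \in x by move=> jn; apply: mem_nth;
    rewrite size_tuple.
  have /intrP[z zE] := qx _ (xin i (ltnW iN)).
  have /intrP[y yE] := qx _ (xin i.+1 iN).
  have := IH (ltnW iN).
  have : q%:R * x`_i < q%:R * x`_i.+1 by rewrite ltr_pM2l ?ltr0n// x_lt.
  by rewrite zE yE !pmulrn ltr_int !ler_int; lia.
by have := H n (leqnn n); rewrite x_n mulr1 ler_nat.
Qed.

Lemma breakpoint_unique i j u : (i < n)%N -> (j < n)%N ->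
  x`_i <= u < x`_i.+1 -> x`_j <= u < x`_j.+1 -> i = j.
Proof.
move=> iN jN /andP[i1 i2] /andP[j1 j2]; apply/eqP; rewrite eqn_leq.
apply/andP; split; rewrite leqNgt; apply/negP => ij.
  have := breakpoints_le ij (ltnW iN); lra.
have := breakpoints_le ij (ltnW jN); lra.
Qed.

Lemma affine_on_grid c k : (0 < c)%N -> (k < c * q)%N ->
  affine_on (fun xi => pi (gridpt (c * q) k xi)).
Proof.
move=> c0 kcq; have cq0 : 0 < (c * q)%:R :> R by rewrite ltr0n muln_gt0 c0.
have [i [iN xi ix]] := grid_interval c0 kcq.
exists (a`_i * k%:R / (c * q)%:R + b`_i), (a`_i / (c * q)%:R) => t /andP[t0 t1].
case: plin => _ _ _ _ /(_ i iN)[_ ->].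
  by rewrite /gridpt; move: (gt_eqF cq0); move: (c * q)%:R => w w0; field;
    rewrite w0.
apply/andP; split.
  by apply: le_lt_trans xi _; rewrite ltr_pM2r ?invr_gt0// ltrDl.
by apply: lt_le_trans ix; rewrite ltr_pM2r ?invr_gt0// -natr1 ltrD2l.
Qed.

Lemma pi_on_grid : exists h, pi = pwl q h.
Proof.
case: plin => _ _ _ per _; have [|h piE] := pwl_refine q0 per.
  by move=> k kq; have := @affine_on_grid 1 k isT; rewrite mul1n; apply.
by exists h; apply/funext.
Qed.

Let m := (3 * q)%N.
Let delta : R := m%:R^-1.

Lemma interval_index : exists idx : nat -> nat, forall k, (k < m)%N ->
  [/\ (idx k < n)%N, x`_(idx k) <= pos delta k,
      k.+1%:R / m%:R <= x`_(idx k).+1 &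
      forall i, (i < n)%N ->
        (X (1 + i)%N <= pos delta k) && ~~ (X (2 + i)%N <= pos delta k) =
        (i == idx k)].
Proof.
have /choice[idx idxP] k : exists i, (k < m)%N ->
    [/\ (i < n)%N, x`_i <= pos delta k & k.+1%:R / m%:R <= x`_i.+1].
  have [km|] := boolP (k < m)%N; last by exists 0%N.
  by have [i iP] := @grid_interval 3 k isT km; exists i.
exists idx => k km; have [iN xi ix] := idxP k km; split=> // i iN'.
have m0 : 0 < m%:R :> R by rewrite ltr0n muln_gt0.
have ix' : pos delta k < x`_(idx k).+1.
  by apply: lt_le_trans ix; rewrite ltr_pM2r ?invr_gt0// ltr_nat.
rewrite -[(2 + i)%N]/(1 + i.+1)%N !input_x_at// ?(ltnW iN')// -ltNge.
apply/idP/eqP => [xP|->]; last by rewrite xi ix'.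
by apply: (breakpoint_unique (u := pos delta k)) => //; rewrite xi ix'.
Qed.

Lemma pi_grid_value (idx : nat -> nat) (h : nat -> R) :
  (forall k, (k < m)%N -> [/\ (idx k < n)%N, x`_(idx k) <= pos delta k &
     k.+1%:R / m%:R <= x`_(idx k).+1]) ->
  (forall k t, (k < m)%N -> (t < 3)%N ->
     h (3 * k + t)%N = grid_value n X delta idx k t) ->
  pi = pwl m h.
Proof.
move=> idxP hE; have m0 : (0 < m)%N by rewrite muln_gt0.
have m0' : 0 < m%:R :> R by rewrite ltr0n.
case: plin => _ _ _ per pE; apply/funext => y.
have [k [xi [j [km /andP[xi0 xi1] ->]]]] := gridptP y m0.
rewrite per pwl_periodic pwl_gridpt ?xi0// modn_small//.
have [iN xk kx] := idxP k km; have [pv pl] := pE _ iN.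
have [vE aE bE] := input_coef_at iN.
have lE u : line_at n X (idx k) u = a`_(idx k) * u + b`_(idx k).
  by rewrite /line_at aE bE.
have posE : gridpt m k 0 = pos delta k by rewrite /gridpt addr0.
have lt_next t : t < 1 -> gridpt m k t < x`_(idx k).+1.
  move=> t1; apply: lt_le_trans kx.
  by rewrite ltr_pM2r ?invr_gt0// -natr1 ltrD2l.
move: xi0; rewrite le_eqVlt => /orP[/eqP <-|xi0].
  rewrite piece_end -[(3 * k)%N]addn0 hE// /grid_value /= input_x_at ?(ltnW
    iN)//.
  rewrite vE lE posE; case: eqP => [<-//|ne].
  apply: pl; rewrite -posE lt_next// andbT posE lt_neqAle xk andbT.
  exact/eqP.
rewrite piece_in// !hE// /grid_value /= !lE pl; last first.
  rewrite lt_next// andbT (le_lt_trans xk)// -posE.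
  by rewrite ltr_pM2r ?invr_gt0// ltrD2l.
by rewrite /pos /gridpt /delta; move: (gt_eqF m0'); move: m%:R => w w0; field;
  rewrite w0.
Qed.

Lemma common_denominatorP t : (0 < t)%N ->
  (exists2 i, (i <= n)%N & ~ exists2 k,
    (k <= t)%N & k%:R = t%:R * X (1 + i)%N) <->
  ~ common_denominator x t.
Proof.
move=> t0; split=> [[i iN nk] [_ cd]|ncd].
  have xin : x`_i \in x by apply: mem_nth; rewrite size_tuple.
  have /intrP[z zE] := cd _ xin.
  have x01 : 0 <= x`_i <= 1.
    by rewrite -{1}x_0 -x_n !breakpoints_le.
  have z0 : (0 <= z)%R.
    by rewrite -(ler_int R) -zE mulr_ge0//; case/andP: x01.
  have zt : (z <= t)%R.
    by rewrite -(ler_int R) -zE -pmulrn ler_piMr//; case/andP: x01.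
  apply: nk; exists `|z|%N; first lia.
  by rewrite input_x_at// zE pmulrn gez0_abs.
apply: contrapT => nex; apply: ncd; split=> // r rx.
have /nthP-/(_ 0)[i] := rx; rewrite size_tuple ltnS => iN <-.
apply: contrapT => nint; apply: nex; exists i => // -[k _ kE].
by apply: nint; rewrite -input_x_at// -kE; apply/natr_int.
Qed.

(** The state after testing the candidates 1, ..., [t]; for [t = 0] the flag is
    set, in agreement with 0 not being a denominator. *)
Definition searching t (s : state R) : Prop :=
  [/\ nregs s rn = n /\ nregs s rB = B, nregs s rq = t, rmem s B = t%:R,
      forall c, c <> B -> c <> (B + 1)%N -> rmem s c = X c &
      nregs s rbad <> 0%N <-> ~ common_denominator x t].

Lemma search_step t s : searching t s ->
  searching t.+1 (meaning check_candidate (meaning next_candidate s)).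
Proof.
move=> [[sn sB] sq sr sX _]; set s1 := meaning next_candidate s.
have n1 : nregs s1 rn = n by rewrite meaning_frame.
have B1 : nregs s1 rB = B by rewrite meaning_frame.
have q1 : nregs s1 rq = t.+1 by rewrite -sq; apply: addn1.
have b1 : nregs s1 rbad = 0%N by [].
have m1 c : rmem s1 c = if c == B then t.+1%:R else rmem s c.
  have -> : rmem s1 c = if c == (nregs s rB + 0)%N then rmem s (nregs s rB +
    0)%N + 1
     else rmem s c by [].
  by rewrite sB addn0 sr natr1.
have [cm cb] := check_candidate_spec B1 n1.
set s2 := meaning check_candidate s1 in cm cb *.
have BB : B <> (B + 1)%N by lia.
split.
- by split; rewrite meaning_frame.
- by rewrite meaning_frame.
- by rewrite cm// m1 eqxx.
- by move=> c cB cB1; rewrite cm// m1; move/eqP: (cB) => /negbTE ->; apply: sX.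
rewrite cb b1 q1 -common_denominatorP//.
have E i : (i <= n)%N -> rmem s1 B * rmem s1 (1 + i)%N = t.+1%:R * X (1 + i)%N.
  move=> iN; rewrite !m1 eqxx ifF; last by apply/negbTE; rewrite /B; lia.
  by rewrite sX//; rewrite /B; lia.
split=> [[//|[i iN nk]]|[i iN nk]]; last right; exists i => // -[k kt kE];
  by apply: nk; exists k => //; rewrite kE E.
Qed.

(** Every candidate below the least common denominator fails, so the search
    stops exactly there. *)
Lemma search_exec M s : (n < M)%N -> (q < M)%N -> searching 0 s ->
  exists T s', [/\ exec search s T s', searching q s' &
    (T <= q * (cost M next_candidate + cost M check_candidate + 5) + 4)%N].
Proof.
move=> nM qM s0.
set w := (cost M next_candidate + cost M check_candidate + 5)%N.
suff H k t s1 : (t + k = q)%N -> searching t s1 ->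
    exists T s', [/\ exec search s1 T s', searching q s' & (T <= k * w + 4)%N].
  exact: H q 0%N s erefl s0.
elim: k t s1 => [|k IH] t s1.
  rewrite addn0 => -> sq; have [_ _ _ _ bad] := sq.
  exists 4%N, s1; split=> //;
    apply: (@ExecWhileFalse _ s1 (BLeN (NCst 1) (NReg rbad))).
  change (~~ (0 < nregs s1 rbad)%N); rewrite -eqn0Ngt; apply/eqP.
  by apply: contrapT => /bad; apply; case: lcd.
move=> tk st; have [_ _ _ _ bad] := st.
have b0 : beval s1 (BLeN (NCst 1) (NReg rbad)).
  change (0 < nregs s1 rbad)%N; rewrite lt0n; apply/eqP/bad => cd.
  by have := lcd.2 _ cd; lia.
have [||t1 e1 le1] := @compile_meaning R [::] M next_candidate s1.
- by [].
- by [].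
have st' := search_step st; set s2 := meaning next_candidate s1 in st' e1 *.
have [[n1 _] q1 _ _ _] := st.
have n2 : nregs s2 rn = n by rewrite meaning_frame.
have q2 : nregs s2 rq = t.+1 by rewrite -q1; apply: addn1.
have [||t2 e2 le2] := @compile_meaning R [:: rn; rq] M check_candidate s2.
- by [].
- have bn : (neval s2 (NAdd (NReg rn) (NCst 1)) <= M)%N.
    by change (nregs s2 rn + 1 <= M)%N; rewrite n2 addn1.
  have bq : (neval s2 (NAdd (NReg rq) (NCst 1)) <= M)%N.
    by change (nregs s2 rq + 1 <= M)%N; rewrite q2; lia.
  by [].
have [|T [s' [e' sq le']]] := IH t.+1 _ _ st'; first by lia.
exists (3 + (t1 + t2).+1 + T).+1, s'; split=> //.
  exact: (ExecWhileTrue b0 (ExecSeq e1 e2) e').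
by rewrite mulSn {1}/w; lia.
Qed.

Lemma setup_spec : searching 0 (meaning setup (init n (encode f x v a b))).
Proof.
have zB : rmem (meaning setup (init n (encode f x v a b))) B = 0.
  by change (X B = 0); apply: nth_default; rewrite input_size.
by split=> //; split=> // _ [].
Qed.

Lemma decision_spec s f' : minimal f' pi -> searching q s ->
  nregs (meaning (PSeq fill solve) (meaning grid_setup s)) 0%N <> 0%N <->
  extreme f' pi.
Proof.
move=> mp [[sn sB] sq sr sX _].
have m0 : (0 < m)%N by rewrite muln_gt0.
have qr0 : q%:R != 0 :> R by rewrite pnatr_eq0 -lt0n.
set s1 := meaning grid_setup s.
have n1 : nregs s1 rn = n by rewrite meaning_frame.
have B1 : nregs s1 rB = B by rewrite meaning_frame.
have m1 : nregs s1 rm = m by rewrite /m -sq.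
have N1 : nregs s1 rN = (3 * m)%N by rewrite /m -sq.
have mem1 c : rmem s1 c = if c == (B + 2)%N then 0 else
    if c == (B + 1)%N then 1 / (rmem s B + (rmem s B + rmem s B)) else rmem s c.
  have -> : rmem s1 c = if c == (nregs s rB + 2)%N then 0 else
    if c == (nregs s rB + 1)%N then
      1 / (rmem s (nregs s rB + 0)%N +
        (rmem s (nregs s rB + 0)%N + rmem s (nregs s rB + 0)%N))
    else rmem s c by [].
  by rewrite sB addn0.
have [idx idxP] := interval_index.
have fe : fill_env n m X delta s1.
  split=> //.
    rewrite mem1 ifF ?eqxx; last by apply/negbTE; lia.
    rewrite sr /delta /m natrM div1r; congr (_^-1); ring.
  move=> c cB; rewrite mem1 !ifF ?sX//; try (by apply/negbTE; lia);
    rewrite -/B; lia.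
have idx' k : (k < m)%N -> (idx k < n)%N /\ forall i, (i < n)%N ->
    (X (1 + i)%N <= pos delta k) && ~~ (X (2 + i)%N <= pos delta k) = (i == idx
      k).
  by move=> km; have [? _ _ ?] := idxP k km.
have c1 : rmem s1 (B + 2)%N = 0 by rewrite mem1 eqxx.
have hE := fill_spec idx' fe m1 c1.
rewrite meaning_seq; set s2 := meaning fill s1 in hE *.
pose h i := rmem s2 (hcell B i).
have ge : grid_env B m h s2 by split=> //; [split|]; rewrite meaning_frame.
rewrite (solve_spec ge).
have [h' piq] := pi_on_grid.
have pim : pi = pwl m h.
  apply: (@pi_grid_value idx) => [k km|k t km t3]; last exact: hE.
  by have [? ? ? _] := idxP k km.
exact: iff_sym (extreme_tight_system q0 mp piq pim).
Qed.

Lemma decision_exec M s : (n <= M)%N -> (9 * q <= M)%N -> searching q s ->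
  exists T, [/\ exec (Seq (compile grid_setup) (compile (PSeq fill solve))) s T
      (meaning (PSeq fill solve) (meaning grid_setup s)) &
    (T <= (cost M grid_setup + cost M (PSeq fill solve)).+1)%N].
Proof.
move=> nM qM [[sn sB] sq sr sX _].
have [||t1 e1 le1] := @compile_meaning R [::] M grid_setup s; [by []|by []|].
set s1 := meaning grid_setup s in e1 *.
have bn : (neval s1 (NReg rn) <= M)%N.
  by change (nregs s1 rn <= M)%N; rewrite meaning_frame// sn.
have bm : (neval s1 (NReg rm) <= M)%N.
  by change (3 * nregs s rq <= M)%N; rewrite sq; lia.
have bN : (neval s1 (NReg rN) <= M)%N.
  by change (3 * (3 * nregs s rq) <= M)%N; rewrite sq; lia.
have [||t2 e2 le2] := @compile_meaning R [:: rn; rm; rN] M (PSeq fill solve) s1.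
- by [].
- by repeat split.
by exists (t1 + t2).+1; split; [exact: ExecSeq e1 e2|rewrite ltnS leq_add].
Qed.

End Glue.

(** The loops are bounded by [n + 1], [q + 1], [3 * q] and [9 * q], whence the
    bound [9 * q + 1] on their lengths. *)
Theorem theorem1p3 (R : realType) :
  exists (alg : cmd) (p : {poly nat}),
    forall (f : R) (n : nat) (x : n.+1.-tuple R) (v a b : n.-tuple R)
           (pi : R -> R) (q : nat),
      minimal f pi ->
      piecewise_linear x v a b pi ->
      least_common_denominator x q ->
      decides_within alg n (encode f x v a b) p.[q] (extreme f pi).
Proof.
pose P : {poly nat} := 9%N%:P * 'X + 1%:P.
have PE q : P.[q] = (9 * q + 1)%N by rewrite hornerD hornerM !hornerC hornerX.
have [Q1 E1] := cost_poly P setup; have [Q2 E2] := cost_poly P next_candidate.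
have [Q3 E3] := cost_poly P check_candidate;
  have [Q4 E4] := cost_poly P grid_setup.
have [Q5 E5] := cost_poly P (PSeq fill solve).
exists decide_extreme, (Q1 + ('X * (Q2 + Q3 + 5%N%:P) + (Q4 + Q5 + 10%N%:P))).
move=> f n x v a b pi q mp plin lcd.
have q0 : (0 < q)%N by case: lcd => -[].
have nq := breakpoints_at_most plin lcd.
pose M := P.[q]; have ME : M = (9 * q + 1)%N by exact: PE.
have [||t1 e1 le1] := @compile_meaning R [::] M setup (init n (encode f x v a
  b)).
- by [].
- by [].
have s1 := @setup_spec R f n x v a b q lcd.
have [||T [s2 [e2 sq le2]]] := search_exec plin lcd _ _ s1 (M := M);
  rewrite ?ME; try lia.
have [||t3 [e3 le3]] := decision_exec lcd _ _ sq (M := M); rewrite ?ME; try lia.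
exists (t1 + (T + t3).+1).+1,
  (meaning (PSeq fill solve) (meaning grid_setup s2)).
split.
- exact: ExecSeq e1 (ExecSeq e2 e3).
- rewrite !(hornerD, hornerM, hornerX, hornerC) -E1 -E2 -E3 -E4 -E5 -/M.
  by move: le1 le2 le3; lia.
- exact: (decision_spec plin lcd mp sq).
Qed.
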